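(* Let $f:\mathbb{R}^d\to\mathbb{R}^d$ be of class $\mathcal{C}^2$ and assume that there exists $q\in\mathbb{N}$ such that \[ \sup_{x\in\mathbb{R}^d}\frac{\|f(x)\|+\sum_{j=1}^{2}\sup_{\|h_1\|,\ldots,\|h_j\|\le 1}\|D^jf(x).(h_1,\ldots,h_j)\|}{1+\|x\|^q}<\infty, \] and that there exists $\gamma>0$ such that $\langle f(x_2)-f(x_1),x_2-x_1\rangle\le-\gamma\|x_2-x_1\|^2$ for all $x_1,x_2\in\mathbb{R}^d$. Let $\mu_\star$ be the unique invariant distribution of the SDE $dX(t)=f(X(t))dt+\sum_{k=1}^K\sigma_k d\beta^k(t)$ on $\mathbb{R}^d$, and for $\Delta t\in(0,\Delta t_0]$ let $(X_n)_{n\ge 0}$ be defined by $X_0=x_0$ and \[ X_{n+1}=X_n+\frac{\Delta t}{1+\alpha\Delta t\|f(X_n)\|}f(X_n)+\sum_{k=1}^K\sigma_k\,\Delta\beta_n^k,\qquad n\ge 0 . \] Let $x_0\in\mathbb{R}^d$, $r\in\mathbb{N}$, and let $\varphi:\mathbb{R}^d\to\mathbb{R}$ be of class $\mathcal{C}^2$ such that \[ \mathcal{N}_r(\varphi)=\sup_{x\in\mathbb{R}^d}\frac{|\varphi(x)|+\sum_{j=1}^{2}\sup_{\|h_1\|,\ldots,\|h_j\|\le 1}|D^j\varphi(x).(h_1,\ldots,h_j)|}{1+\|x\|^r}<\infty . \] Then there exist a constant $C=C(x_0,\varphi)\in(0,\infty)$ and $R\in\mathbb{N}$ such that for all $\varepsilon\in(0,1)$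 there exist a time-step size $\Delta t\in(0,\Delta t_0]$ and a number of steps $N\in\mathbb{N}$ for which \[ \Bigl|\mathbb{E}[\varphi(X_N)]-\int\varphi\,d\mu_\star\Bigr|\le\varepsilon , \] with a computational cost $\mathcal{C}(\varepsilon)$ (number of steps $N$ of the scheme, up to a proportionality factor) satisfying \[ \mathcal{C}(\varepsilon)\le C\,\varepsilon^{-1}|\log(\varepsilon)|^{1+R}. \]
   Context: $d\in\mathbb{N}$; $\langle\cdot,\cdot\rangle$ and $\|\cdot\|$ are the standard inner product and norm on $\mathbb{R}^d$. $D^jg(x).(h_1,\ldots,h_j)$ denotes the $j$-th derivative of $g$ at $x$ in directions $h_1,\ldots,h_j\in\mathbb{R}^d$. $\sigma_1,\ldots,\sigma_K\in\mathbb{R}^d$ are fixed vectors, and $\beta^1,\ldots,\beta^K$ are independent standard real-valued Wiener processes on a probability space satisfying the usual conditions. Under the assumptions on $f$, the SDE is globally well-posed, its solutions have moments of all orders bounded uniformly in time, and it admits a unique invariant probability distribution $\mu_\star$. $\Delta t_0>0$ is arbitrarily fixed, $t_n=n\Delta t$, $\Delta\beta_n^k=\beta^k(t_{n+1})-\beta^k(t_n)$, and $\alpha\in(0,\infty)$ is a fixed parameter. The computational cost is the cost of sampling one realization of $X_N$, which is proportional to the number of steps $N$. The constants $C$ and $R$ may also depend on the fixed data $f,\gamma,\sigma_1,\ldots,\sigma_K,\alpha,\Delta t_0,d$ and on $r$, but not on $\varepsilon$.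
   Formalization: In the cost bound, |log ε| is replaced by max(1,|log ε|): the literal bound tends to 0 as ε→1, forcing N=0, and fails for f(x)=−x, φ(x)=x, x₀=10; for ε≤1/e the bound is unchanged. *)

(* Defs.v *)
From HB Require Import structures.
From mathcomp Require Import all_boot all_order all_algebra.
From mathcomp Require Import all_classical all_reals all_analysis.
Set Implicit Arguments. Unset Strict Implicit. Unset Printing Implicit Defensive.
Import Order.TTheory GRing.Theory Num.Theory.
Import numFieldNormedType.Exports.
Local Open Scope classical_set_scope.
Local Open Scope ring_scope.

(* The ambient norm of 'rV[R]_d is the sup norm.  It is only used here through
   the topology (limits, derivatives, Borel sets), which is the Euclidean one;
   all estimates are stated with [enorm]. *)
Definition inner (R : realType) (d : nat) (x y : 'rV[R]_d) : R :=
  \sum_(i < d) x ord0 i * y ord0 i.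

Definition enorm (R : realType) (d : nat) (x : 'rV[R]_d) : R :=
  Num.sqrt (inner x x).

Definition borel_rV (R : realType) (d : nat) :=
  g_sigma_algebraType (@open 'rV[R]_d).

(* D^1 g(x).(h) = 'D_h g x  and  D^2 g(x).(h1, h2) = 'D_h2 ('D_h1 g) x. *)
Definition classC2 (R : realType) (d : nat) (W : normedModType R)
    (g : 'rV[R]_d -> W) : Prop :=
  [/\ forall x, differentiable g x,
      forall h x, differentiable ('D_h g) x &
      forall h1 h2, continuous ('D_h2 ('D_h1 g))].

(* [nrm] is the norm on the codomain: Euclidean for vector fields, absolute
   value for real functions. *)
Definition growth_norm (R : realType) (d : nat) (W : normedModType R)
    (nrm : W -> R) (r : nat) (g : 'rV[R]_d -> W) : \bar R :=
  let B := [set h : 'rV[R]_d | enorm h <= 1] in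
  ereal_sup (range (fun x : 'rV[R]_d =>
    (((nrm (g x))%:E
      + (ereal_sup [set (nrm ('D_h g x))%:E | h in B]
         + ereal_sup [set (nrm ('D_h.2 ('D_h.1 g) x))%:E | h in B `*` B]))
     * ((1 + enorm x ^+ r)^-1)%:E)%E)).

Definition C2_growth (R : realType) (d : nat) (W : normedModType R)
    (nrm : W -> R) (r : nat) (g : 'rV[R]_d -> W) : Prop :=
  classC2 g /\ (growth_norm nrm r g < +oo)%E.

(* Processes are indexed by all of R; only times t >= 0 are meaningful. *)
Record usual_conditions (disp : measure_display) (T : measurableType disp)
    (R : realType) (P : probability T R) (F : R -> set (set T)) : Prop := {
  uc_sigma_algebra : forall t : R, 0 <= t -> sigma_algebra setT (F t) ;
  uc_measurable : forall t : R, 0 <= t -> F t `<=` measurable ;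
  uc_increasing : forall s t : R, 0 <= s -> s <= t -> F s `<=` F t ;
  uc_complete : P.-negligible `<=` F 0 ;
  uc_right_continuous : forall t : R, 0 <= t ->
    F t = \bigcap_(s in [set s | t < s]) F s
}.

(* The independence clause says that the increments of the K components over
   [s, t] are independent of one another and of F s; iterating it over times
   yields the independence of the K processes and of their increments. *)
Record independent_wiener_processes (disp : measure_display)
    (T : measurableType disp) (R : realType) (P : probability T R)
    (F : R -> set (set T)) (K : nat) (beta : 'I_K -> R -> T -> R) : Prop := {
  wiener_adapted : forall k (t : R) (B : set R), 0 <= t -> measurable B ->
    F t (beta k t @^-1` B) ;
  wiener_start : forall k, \forall w \ae P, beta k 0 w = 0 ;
  wiener_continuous : forall k, \forall w \ae P,
    {within `[0, +oo[, continuous (fun t => beta k t w)} ;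
  wiener_gaussian : forall k (s t : R) (B : set R), 0 <= s -> s < t -> measurable B ->
    P ((beta k t \- beta k s) @^-1` B)
    = normal_prob 0 (Num.sqrt (t - s)) B ;
  wiener_independent : forall (s t : R) (A : set T) (B : 'I_K -> set R),
    0 <= s -> s < t -> F s A -> (forall k, measurable (B k)) ->
    P (A `&` \bigcap_(k in [set: 'I_K]) ((beta k t \- beta k s) @^-1` B k))
    = (P A * \prod_(k < K) P ((beta k t \- beta k s)%R @^-1` B k))%E
}.

(* The noise is additive, so the stochastic integral of the constant sigma k
   against beta k over [0, t] is beta k t *: sigma k (beta k starts at 0). *)
Record sde_solution (disp : measure_display) (T : measurableType disp)
    (R : realType) (P : probability T R) (F : R -> set (set T)) (d K : nat)
    (f : 'rV[R]_d -> 'rV[R]_d) (sigma : 'I_K -> 'rV[R]_d)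
    (beta : 'I_K -> R -> T -> R) (x : 'rV[R]_d) (X : R -> T -> 'rV[R]_d)
    : Prop := {
  sde_adapted : forall (t : R) (A : set (borel_rV R d)), 0 <= t -> measurable A ->
    F t (X t @^-1` A) ;
  sde_continuous : \forall w \ae P,
    {within `[0, +oo[, continuous (fun t => X t w)} ;
  sde_equation : \forall w \ae P, forall t : R, 0 <= t ->
    X t w = x
      + \row_(i < d) Rintegral lebesgue_measure `[0, t]
                       (fun s : R => f (X s w) ord0 i)
      + \sum_(k < K) beta k t w *: sigma k
}.

(* X x is the solution started at x, so that P (X x t @^-1` A) is the
   transition probability from x to A in time t. *)
Definition invariant_distribution (disp : measure_display)
    (T : measurableType disp) (R : realType) (P : probability T R) (d : nat)
    (X : 'rV[R]_d -> R -> T -> 'rV[R]_d) (mu : probability (borel_rV R d) R)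
    : Prop :=
  forall (t : R) (A : set (borel_rV R d)), 0 <= t -> measurable A ->
    (\int[mu]_x P (X x t @^-1` A) = mu A)%E.

Fixpoint tamed_euler (T : Type) (R : realType) (d K : nat)
    (f : 'rV[R]_d -> 'rV[R]_d) (sigma : 'I_K -> 'rV[R]_d)
    (beta : 'I_K -> R -> T -> R) (alpha dt : R) (x0 : 'rV[R]_d) (n : nat)
    (w : T) : 'rV[R]_d :=
  if n is m.+1 then
    let Xm := tamed_euler f sigma beta alpha dt x0 m w in
    Xm + (dt / (1 + alpha * dt * enorm (f Xm))) *: f Xm
    + \sum_(k < K) (beta k (m.+1%:R * dt) w - beta k (m%:R * dt) w) *: sigma k
  else x0.

(* Main.v *)
(* Since the noise is additive, the scheme has strong order one.  The scheme of
   step h is compared with its own refinement of step h/m: over a coarse step the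
   linear part Df(X_n).xi of the local error has mean zero and is decorrelated from
   the error at the beginning of the step, so that by dissipativity the mean square
   distance is O(h^2 + h/m), uniformly in n as long as n h^2 <= 1.  The moments
   needed here are obtained by subtracting from the scheme an Ornstein-Uhlenbeck
   chain driven by the same noise: either this chain stays below the level at which
   the taming is felt, and a Lyapunov inequality holds, or a crude bound polynomial
   in 1/h is compensated by the Gaussian tails.  As m tends to infinity the
   refinement converges pathwise to the solution, and Fatou's lemma gives
   E|X_n - X(nh)|^2 = O(h^2), hence a weak error O(h).  Two solutions driven by the
   same noise contract at rate exp(-gamma t); with the invariance of mu this yields
   |E phi(X(t)) - mu(phi)| = O(exp(-gamma t)).  It remains to take h of order eps and
   N h of order |log eps|, so that n h^2 <= 1 holds up to N, and one may take L = 0. *)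

Require Import Defs.
From HB Require Import structures.
From mathcomp Require Import all_boot all_order all_algebra.
From mathcomp Require Import all_classical all_reals all_analysis.
From mathcomp Require Import measurable_realfun ring lra.
Set Implicit Arguments. Unset Strict Implicit. Unset Printing Implicit Defensive.
Import Order.TTheory GRing.Theory Num.Theory.
Import numFieldNormedType.Exports.
Local Open Scope classical_set_scope.
Local Open Scope ring_scope.

(** * Euclidean norm *)

(** The solution enters only through its pathwise integral equation: all probabilistic estimates are
    made on the scheme, where they rest on Gaussian increments independent of the past, and the
    solution inherits its moments from the scheme. The main obstacle is that the Lyapunov inequality
    is lost where the taming is felt. There, the only control left is that one drift step moves the
    chain by at most [1/alpha]; this costs powers of the number [n] of steps, which are paid for by
    a high power of [h], and this trade is what restricts the horizon to [n h^2 <= 1]. With [h] of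
    order [eps] and [n h] of order [|log eps|], the quantity [n h^2] is of order [eps |log eps|] and
    stays bounded. A second obstacle lies in the invariant distribution: the moments of [mu] and the
    measurability of [x -> P (X x t in A)] have to be established before invariance can be applied
    to an unbounded observable, and both are drawn from the contraction of solutions. Young's
    inequality with weights in [h] replaces Hölder's inequality throughout, so that dependent
    factors are separated before means are taken. *)

Lemma cvg_finsum {R : numFieldType} {V : normedModType R} {T I : Type}
    (F : set_system T) {FF : Filter F} (s : seq I) (u : I -> T -> V) (l : I -> V) :
  (forall i, u i x @[x --> F] --> l i) ->
  (\sum_(i <- s) u i x) @[x --> F] --> \sum_(i <- s) l i.
Proof.
move=> ul; elim: s => [|i s ih].
  by under eq_fun do rewrite big_nil; rewrite big_nil; exact: cvg_cst.
under eq_fun do rewrite big_cons.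
by rewrite big_cons; apply: cvgD.
Qed.

Section Euclidean.
Context {R : realType} {d : nat}.
Implicit Types (x y z : 'rV[R]_d) (a : R).

Lemma innerC x y : inner x y = inner y x.
Proof. by apply: eq_bigr => i _; rewrite mulrC. Qed.

Lemma innerDl x y z : inner (x + y) z = inner x z + inner y z.
Proof. by rewrite -big_split; apply: eq_bigr => i _; rewrite mxE mulrDl. Qed.

Lemma innerZl a x y : inner (a *: x) y = a * inner x y.
Proof. by rewrite /inner mulr_sumr; apply: eq_bigr => i _; rewrite mxE mulrA. Qed.

Lemma innerDr x y z : inner x (y + z) = inner x y + inner x z.
Proof. by rewrite innerC innerDl !(innerC x). Qed.

Lemma innerZr a x y : inner x (a *: y) = a * inner x y.
Proof. by rewrite innerC innerZl innerC. Qed.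

Lemma innerNl x y : inner (- x) y = - inner x y.
Proof. by rewrite -scaleN1r innerZl mulN1r. Qed.

Lemma innerNr x y : inner x (- y) = - inner x y.
Proof. by rewrite innerC innerNl innerC. Qed.

Lemma innerBl x y z : inner (x - y) z = inner x z - inner y z.
Proof. by rewrite innerDl innerNl. Qed.

Lemma innerBr x y z : inner x (y - z) = inner x y - inner x z.
Proof. by rewrite innerDr innerNr. Qed.

Lemma inner_sumr (I : Type) (s : seq I) (F : I -> 'rV[R]_d) x :
  inner x (\sum_(i <- s) F i) = \sum_(i <- s) inner x (F i).
Proof.
elim: s => [|i s ih]; last by rewrite !big_cons innerDr ih.
by rewrite !big_nil -(scale0r 0) innerZr mul0r.
Qed.

Lemma inner_ge0 x : 0 <= inner x x.
Proof. by apply: sumr_ge0 => i _; rewrite -expr2 sqr_ge0. Qed.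

Lemma enorm_ge0 x : 0 <= enorm x.
Proof. exact: sqrtr_ge0. Qed.

Lemma enorm_sqr x : enorm x ^+ 2 = inner x x.
Proof. by rewrite sqr_sqrtr// inner_ge0. Qed.

Lemma enormZ a x : enorm (a *: x) = `|a| * enorm x.
Proof.
by rewrite /enorm innerZl innerZr mulrA -expr2 sqrtrM ?sqr_ge0// sqrtr_sqr.
Qed.

Lemma enormN x : enorm (- x) = enorm x.
Proof. by rewrite -scaleN1r enormZ normrN1 mul1r. Qed.

Lemma enorm0 : enorm (0 : 'rV[R]_d) = 0.
Proof. by rewrite -(scale0r 0) enormZ normr0 mul0r. Qed.

Lemma enorm_coord x i : `|x ord0 i| <= enorm x.
Proof.
rewrite -(@ler_pXn2r _ 2)// ?nnegrE ?enorm_ge0// enorm_sqr real_normK ?num_real//.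
rewrite /inner (bigD1 i)//= -expr2 lerDl sumr_ge0// => j _.
by rewrite -expr2 sqr_ge0.
Qed.

Lemma enorm0_eq0 x : enorm x = 0 -> x = 0.
Proof.
move=> x0; apply/rowP => i; rewrite mxE; apply/eqP.
by rewrite -normr_le0 -x0 enorm_coord.
Qed.

Lemma enorm_le_sum x : enorm x <= \sum_(i < d) `|x ord0 i|.
Proof.
have s0 : 0 <= \sum_(i < d) `|x ord0 i| by apply: sumr_ge0.
rewrite -(@ler_pXn2r _ 2)// ?nnegrE ?enorm_ge0// enorm_sqr expr2 mulr_suml.
apply: ler_sum => i _; rewrite -expr2 -[_ ^+ 2]real_normK ?num_real//.
rewrite expr2 ler_wpM2l// (bigD1 i)//= lerDl; exact: sumr_ge0.
Qed.

Lemma inner_le x y : inner x y <= enorm x * enorm y.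
Proof.
have [/enorm0_eq0->|y0] := eqVneq (enorm y) 0.
  by rewrite enorm0 mulr0 -(scale0r 0) innerZr mul0r.
have ypos : 0 < enorm y by rewrite lt0r y0 enorm_ge0.
have [/enorm0_eq0->|x0] := eqVneq (enorm x) 0.
  by rewrite enorm0 mul0r -(scale0r 0) innerZl mul0r.
have xpos : 0 < enorm x by rewrite lt0r x0 enorm_ge0.
have := inner_ge0 (enorm y *: x - enorm x *: y).
rewrite innerBl !innerBr !innerZl !innerZr -!enorm_sqr (innerC y x) => h.
have hp : 0 < enorm x * enorm y by exact: mulr_gt0.
rewrite -(ler_pM2l hp); nra.
Qed.

Lemma inner_norm_le x y : `|inner x y| <= enorm x * enorm y.
Proof.
by rewrite ler_norml inner_le andbT lerNl -innerNl (le_trans (inner_le _ _))// enormN.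
Qed.

Lemma enormD x y : enorm (x + y) <= enorm x + enorm y.
Proof.
rewrite -(@ler_pXn2r _ 2)// ?nnegrE ?addr_ge0 ?enorm_ge0//.
rewrite enorm_sqr innerDl !innerDr (innerC y x) sqrrD -!enorm_sqr.
have := inner_le x y; lra.
Qed.

Lemma enormB x y : enorm (x - y) <= enorm x + enorm y.
Proof. by rewrite (le_trans (enormD _ _))// enormN. Qed.

Lemma enorm_distC x y : enorm (x - y) = enorm (y - x).
Proof. by rewrite -enormN opprB. Qed.

Lemma enorm_dist_triangle x y : enorm x <= enorm y + enorm (x - y).
Proof. by rewrite -{1}(subrK y x) addrC enormD. Qed.

Lemma enorm_sqrD x y :
  enorm (x + y) ^+ 2 = enorm x ^+ 2 + 2 * inner x y + enorm y ^+ 2.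
Proof. by rewrite !enorm_sqr innerDl !innerDr (innerC y x); lra. Qed.

Lemma enorm_sqrD_le x y : enorm (x + y) ^+ 2 <= 2 * (enorm x ^+ 2 + enorm y ^+ 2).
Proof.
rewrite enorm_sqrD; have := inner_le x y.
have := sqr_ge0 (enorm x - enorm y); nra.
Qed.

Lemma enorm_sum (I : Type) (s : seq I) (P : pred I) (F : I -> 'rV[R]_d) :
  enorm (\sum_(i <- s | P i) F i) <= \sum_(i <- s | P i) enorm (F i).
Proof.
elim/big_ind2: _ => [|u a v b h1 h2|//]; first by rewrite enorm0.
by rewrite (le_trans (enormD _ _))// lerD.
Qed.

Lemma mx_norm_le_enorm x : `|x| <= enorm x.
Proof.
rewrite [leLHS]/Num.norm /= mx_normrE; apply/bigmax_leP; split=> [|[i j] _ /=].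
  exact: enorm_ge0.
by rewrite ord1 enorm_coord.
Qed.

Lemma coord_le_mx_norm x i : `|x ord0 i| <= `|x|.
Proof.
by rewrite [leRHS]/Num.norm /= mx_normrE; apply/bigmax_geP; right; exists (ord0, i).
Qed.

Lemma enorm_le_mx_norm x : enorm x <= d%:R * `|x|.
Proof.
apply: le_trans (enorm_le_sum x) _.
have -> : d%:R * `|x| = \sum_(i < d) `|x| by rewrite sumr_const card_ord mulr_natl.
by apply: ler_sum => i _; exact: coord_le_mx_norm.
Qed.

Lemma continuous_inner (T : topologicalType) (u v : T -> 'rV[R]_d) (t : T) :
  {for t, continuous u} -> {for t, continuous v} ->
  {for t, continuous (fun s => inner (u s) (v s))}.
Proof.
move=> cu cv; rewrite /inner; apply: cvg_finsum => i.
apply: cvgM.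
  exact: (continuous_comp cu (@coord_continuous _ _ _ ord0 i _)).
exact: (continuous_comp cv (@coord_continuous _ _ _ ord0 i _)).
Qed.

Lemma continuous_enorm : continuous (@enorm R d).
Proof.
move=> x; apply: (@continuous_comp _ _ _ (fun y : 'rV[R]_d => inner y y) Num.sqrt).
  by apply: continuous_inner; exact: cvg_id.
exact: sqrt_continuous.
Qed.

End Euclidean.

Ltac nonneg := repeat first
  [ done | exact: ltW | exact: sqr_ge0 | exact: enorm_ge0 | exact: expR_ge0
  | apply: exprn_ge0 | apply: mulr_ge0 | apply: divr_ge0 | apply: addr_ge0
  | rewrite invr_ge0 | (apply: sumr_ge0 => ? _) ].

(** * First and second order estimates for fields of polynomial growth *)

Section GrowthBounds.
Context {R : realType} {d : nat} {W : normedModType R}.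

Definition growth_bound (nrm : W -> R) (r : nat) (g : 'rV[R]_d -> W) (M : R) :=
  [/\ forall x, nrm (g x) <= M * (1 + enorm x ^+ r),
      forall x h, enorm h <= 1 -> nrm ('D_h g x) <= M * (1 + enorm x ^+ r) &
      forall x h1 h2, enorm h1 <= 1 -> enorm h2 <= 1 ->
        nrm ('D_h2 ('D_h1 g) x) <= M * (1 + enorm x ^+ r)].

(** The direction 0 shows that both suprema are nonnegative, so no term can compensate another and
    each is bounded by the finite total. Adding 1 to the total makes the constant positive. *)
Lemma C2_growth_bound (nrm : W -> R) r (g : 'rV[R]_d -> W) :
  (forall w, 0 <= nrm w) -> C2_growth nrm r g ->
  exists M : R, 0 < M /\ growth_bound nrm r g M.
Proof.
move=> n0 [_ gfin]; move: gfin; rewrite /growth_norm.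
set S := ereal_sup _ => gfin.
have one_le (x : 'rV[R]_d) : 1 <= 1 + enorm x ^+ r by rewrite lerDl exprn_ge0 ?enorm_ge0.
have gt0 (x : 'rV[R]_d) : 0 < 1 + enorm x ^+ r by exact: lt_le_trans ltr01 (one_le x).
have B0 : enorm (0 : 'rV[R]_d) <= 1 by rewrite enorm0.
pose S1 x := ereal_sup [set (nrm ('D_h g x))%:E | h in [set h | enorm h <= 1]].
pose S2 x := ereal_sup [set (nrm ('D_h.2 ('D_h.1 g) x))%:E |
  h in [set h | enorm h <= 1] `*` [set h | enorm h <= 1]].
have S10 x : (0 <= S1 x)%E.
  by apply: ereal_sup_ge; exists (nrm ('D_0 g x))%:E; [exists 0|rewrite lee_fin].
have S20 x : (0 <= S2 x)%E.
  apply: ereal_sup_ge; exists (nrm ('D_0 ('D_0 g) x))%:E; last by rewrite lee_fin.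
  by exists (0, 0).
have bd x : (((nrm (g x))%:E + (S1 x + S2 x)) <= S * (1 + enorm x ^+ r)%:E)%E.
  rewrite -lee_pdivrMr; last exact: gt0.
  by apply: ereal_sup_ubound; exists x.
have S0 : (0 <= S)%E.
  have /le_trans := bd 0; have : (0 < 1 + enorm (0 : 'rV[R]_d) ^+ r)%R by exact: gt0.
  move=> h0 H.
  have : (0 <= S * (1 + enorm (0 : 'rV[R]_d) ^+ r)%:E)%E.
    by apply: le_trans (bd 0); rewrite !adde_ge0// lee_fin.
  by rewrite pmule_lge0.
have Sfin : S \is a fin_num by rewrite ge0_fin_numE.
exists (fine S + 1); split; first by rewrite ltr_wpDl// fine_ge0.
have up (x : 'rV[R]_d) : (S * (1 + enorm x ^+ r)%:E <= ((fine S + 1) *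
  (1 + enorm x ^+ r))%:E)%E.
  rewrite -{1}(fineK Sfin) -EFinM lee_fin; apply: ler_wpM2r; first exact: ltW.
  by rewrite lerDl.
split.
- move=> x; rewrite -lee_fin; apply: le_trans (le_trans (bd x) (up x)).
  by rewrite leeDl// adde_ge0.
- move=> x h h1; rewrite -lee_fin; apply: le_trans (le_trans (bd x) (up x)).
  apply: (@le_trans _ _ (S1 x)); first by apply: ereal_sup_ubound; exists h.
  by rewrite addeCA leeDl// adde_ge0// lee_fin.
- move=> x h1 h2 l1 l2; rewrite -lee_fin; apply: le_trans (le_trans (bd x) (up x)).
  apply: (@le_trans _ _ (S2 x)); first by apply: ereal_sup_ubound; exists (h1, h2).
  by rewrite addeA leeDr// adde_ge0// lee_fin.
Qed.

End GrowthBounds.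

(** * Lipschitz and Taylor estimates from the mean value theorem *)

Section MeanValue.
Context {R : realType} {d : nat}.
Implicit Types (x h : 'rV[R]_d).

Lemma mvt_direction (g : 'rV[R]_d -> R) x h :
  (forall t : R, derivable g (x + t *: h) h) ->
  exists2 t : R, 0 <= t <= 1 & g (x + h) - g x = 'D_h g (x + t *: h).
Proof.
move=> dg; pose u (t : R) := g (x + t *: h).
have uE (t : R) : (fun s => s^-1 *: ((u \o shift t) (s *: (1 : R)) - u t)) =
    (fun s => s^-1 *: ((g \o shift (x + t *: h)) (s *: h) - g (x + t *: h))).
  apply/funext => s; rewrite /u /= /shift /=; congr (_ *: (g _ - _)).
  by rewrite [s *: 1]mulr1 scalerDl addrCA.
have du (t : R) : is_derive t 1 u ('D_h g (x + t *: h)).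
  split; first by rewrite /derivable uE; exact: dg.
  by rewrite /derive uE.
have cu : {within `[0, 1], continuous u}.
  apply: continuous_subspaceT => t; apply: differentiable_continuous.
  by apply/derivable1_diffP; have [] := du t.
have [t t01] := @MVT_segment R u (fun t => 'D_h g (x + t *: h)) 0 1 ler01
  (fun t _ => du t) cu.
rewrite subr0 mulr1 /u scale1r scale0r addr0 => ->.
by exists t => //; move: t01; rewrite in_itv.
Qed.

(** On a segment the norm is at most the larger of its values at the two ends, so no power of 2 is
    lost. *)
Lemma enorm_segment_le x y (t : R) (q : nat) : 0 <= t <= 1 ->
  1 + enorm (x + t *: (y - x)) ^+ q <= 1 + enorm x ^+ q + enorm y ^+ q.
Proof.
move=> /andP[t0 t1]; rewrite -addrA lerD2l.
have h : enorm (x + t *: (y - x)) <= (1 - t) * enorm x + t * enorm y.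
  have -> : x + t *: (y - x) = (1 - t) *: x + t *: y.
    by rewrite scalerBr scalerBl scale1r addrCA addrC -addrA [- _ + _]addrC.
  by rewrite (le_trans (enormD _ _))// !enormZ !ger0_norm// subr_ge0.
have := enorm_ge0 x; have := enorm_ge0 y => y0 x0.
have [xy|/ltW xy] := leP (enorm x) (enorm y).
- apply: (@le_trans _ _ (enorm y ^+ q)); last by rewrite lerDr exprn_ge0.
  rewrite lerXn2r ?nnegrE ?enorm_ge0// (le_trans h)//; nra.
- apply: (@le_trans _ _ (enorm x ^+ q)); last by rewrite lerDl exprn_ge0.
  rewrite lerXn2r ?nnegrE ?enorm_ge0// (le_trans h)//; nra.
Qed.

Lemma derive_scale_dir {W : normedModType R} (g : 'rV[R]_d -> W) x h (a : R) :
  differentiable g x -> 'D_(a *: h) g x = a *: 'D_h g x.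
Proof. by move=> dg; rewrite !deriveE// linearZ. Qed.

(** Homogeneity carries the bound from the unit ball to every direction; the direction 0 is separate
    because it cannot be normalised. *)
Lemma growth_derive_le {W : normedModType R} (nrm : W -> R) r
    (g : 'rV[R]_d -> W) M x h :
  (forall (a : R) w, nrm (a *: w) = `|a| * nrm w) ->
  differentiable g x -> growth_bound nrm r g M ->
  nrm ('D_h g x) <= M * (1 + enorm x ^+ r) * enorm h.
Proof.
move=> nZ dg [_ b1 _].
have [h0|h0] := eqVneq (enorm h) 0.
  rewrite h0 mulr0 (enorm0_eq0 h0) -(scale0r 0) derive_scale_dir// nZ normr0 mul0r.
  exact: lexx.
have hp : 0 < enorm h by rewrite lt0r h0 enorm_ge0.
set k := (enorm h)^-1 *: h.
have hk : h = enorm h *: k by rewrite /k scalerA divff// scale1r.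
have k1 : enorm k <= 1 by rewrite enormZ ger0_norm ?invr_ge0 ?enorm_ge0// mulVf.
rewrite {1}hk derive_scale_dir// nZ ger0_norm ?enorm_ge0// mulrC.
by rewrite ler_wpM2r ?enorm_ge0// b1.
Qed.

Lemma growth_derive2_le {W : normedModType R} (nrm : W -> R) r
    (g : 'rV[R]_d -> W) M x h :
  (forall (a : R) w, nrm (a *: w) = `|a| * nrm w) ->
  (forall x, differentiable g x) -> (forall h x, differentiable ('D_h g) x) ->
  growth_bound nrm r g M ->
  nrm ('D_h ('D_h g) x) <= M * (1 + enorm x ^+ r) * enorm h ^+ 2.
Proof.
move=> nZ dg d2g [_ _ b2].
have [h0|h0] := eqVneq (enorm h) 0.
  rewrite h0 expr2 mulr0 mulr0 (enorm0_eq0 h0) -(scale0r 0) derive_scale_dir//.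
  by rewrite nZ normr0 mul0r.
have hp : 0 < enorm h by rewrite lt0r h0 enorm_ge0.
set k := (enorm h)^-1 *: h.
have hk : h = enorm h *: k by rewrite /k scalerA divff// scale1r.
have k1 : enorm k <= 1 by rewrite enormZ ger0_norm ?invr_ge0 ?enorm_ge0// mulVf.
have D1 : 'D_h g = enorm h \*: 'D_k g.
  by apply/funext => y; rewrite {1}hk derive_scale_dir.
rewrite D1 deriveZ; last exact: diff_derivable.
rewrite {2}hk derive_scale_dir// !nZ ger0_norm ?enorm_ge0// mulrA -expr2 mulrC.
by rewrite ler_wpM2r ?sqr_ge0// b2.
Qed.

Lemma derivable_inner (v : 'rV[R]_d) (f : 'rV[R]_d -> 'rV[R]_d) x h :
  derivable f x h ->
  is_derive x h (fun y => inner v (f y)) (inner v ('D_h f x)).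
Proof.
move=> df; have /derivable_mxP dfi := df.
have -> : (fun y => inner v (f y)) =
    \sum_(i < d) (v ord0 i \*: (fun y => f y ord0 i)).
  by apply/funext => y; rewrite fct_sumE; apply: eq_bigr.
have dz (i : 'I_d) : derivable (v ord0 i \*: (fun y => f y ord0 i)) x h.
  by apply: derivableZ; exact: dfi.
split; first exact: derivable_sum.
rewrite derive_sum//; apply: eq_bigr => i _.
rewrite deriveZ; last exact: dfi.
by rewrite derive_mx// mxE.
Qed.

Lemma C2_scalar_lipschitz r (g : 'rV[R]_d -> R) M x y :
  (forall z, differentiable g z) -> growth_bound Num.norm r g M -> 0 <= M ->
  `|g y - g x| <= M * (1 + enorm x ^+ r + enorm y ^+ r) * enorm (y - x).
Proof.
move=> dg bg M0.
have [t t01] : exists2 t : R, 0 <= t <= 1 &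
    g (x + (y - x)) - g x = 'D_(y - x) g (x + t *: (y - x)).
  by apply: mvt_direction => t; exact: diff_derivable.
rewrite [x + (y - x)]addrC subrK => ->; apply: le_trans (growth_derive_le _ _ _ bg) _ => //.
  by move=> a w; rewrite normrM.
by rewrite ler_wpM2r ?enorm_ge0// ler_wpM2l// enorm_segment_le.
Qed.

(** The mean value theorem is scalar, so it is applied to [inner v (f _)] with [v] the increment of
    [f] itself; a factor [enorm v] is then divided out. *)
Lemma C2_field_lipschitz r (f : 'rV[R]_d -> 'rV[R]_d) M x y :
  (forall z, differentiable f z) -> growth_bound (@enorm R d) r f M -> 0 <= M ->
  enorm (f y - f x) <= M * (1 + enorm x ^+ r + enorm y ^+ r) * enorm (y - x).
Proof.
move=> df bf M0; set v := f y - f x; set h := y - x.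
have der z := derivable_inner v (@diff_derivable _ _ _ f z h (df z)).
have [t t01] : exists2 t : R, 0 <= t <= 1 &
    inner v (f (x + h)) - inner v (f x) =
    'D_h (fun z => inner v (f z)) (x + t *: h).
  by apply: mvt_direction => t; have [] := der (x + t *: h).
have [_ ->] := der (x + t *: h).
rewrite [x + h]addrC subrK -innerBr -/v -enorm_sqr => e.
have [->|v0] := eqVneq (enorm v) 0.
  by rewrite !mulr_ge0 ?enorm_ge0// !addr_ge0 ?exprn_ge0 ?enorm_ge0.
have vp : 0 < enorm v by rewrite lt0r v0 enorm_ge0.
rewrite -(ler_pM2l vp) -expr2 e (le_trans (inner_le _ _))// ler_wpM2l ?enorm_ge0//.
apply: le_trans (growth_derive_le _ _ _ bf) _ => //; first exact: enormZ.
by rewrite ler_wpM2r ?enorm_ge0// ler_wpM2l// enorm_segment_le.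
Qed.

(** Two successive mean value theorems, tested against the remainder [v]: the first gives a point
    [t] of the segment, the second a point [s * t]. The factor [t] left over is bounded by 1. *)
Lemma C2_field_taylor r (f : 'rV[R]_d -> 'rV[R]_d) M x y :
  (forall z, differentiable f z) -> (forall h z, differentiable ('D_h f) z) ->
  growth_bound (@enorm R d) r f M -> 0 <= M ->
  enorm (f y - f x - 'D_(y - x) f x) <=
    M * (1 + enorm x ^+ r + enorm y ^+ r) * enorm (y - x) ^+ 2.
Proof.
move=> df d2f bf M0; set h := y - x; set v := f y - f x - 'D_h f x.
have der1 z := derivable_inner v (@diff_derivable _ _ _ f z h (df z)).
have der2 k z := derivable_inner v (@diff_derivable _ _ _ _ z k (d2f h z)).
have [t t01] : exists2 t : R, 0 <= t <= 1 &
    inner v (f (x + h)) - inner v (f x) =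
    'D_h (fun z => inner v (f z)) (x + t *: h).
  by apply: mvt_direction => t; have [] := der1 (x + t *: h).
have [_ ->] := der1 (x + t *: h).
have [s s01] : exists2 s : R, 0 <= s <= 1 &
    inner v ('D_h f (x + t *: h)) - inner v ('D_h f x) =
    'D_(t *: h) (fun z => inner v ('D_h f z)) (x + s *: (t *: h)).
  by apply: mvt_direction => s; have [] := der2 (t *: h) (x + s *: (t *: h)).
have [_ ->] := der2 (t *: h) (x + s *: (t *: h)).
rewrite derive_scale_dir// innerZr scalerA => e2.
rewrite [x + h]addrC /h subrK -/h => e1.
have e : enorm v ^+ 2 = t * inner v ('D_h ('D_h f) (x + (s * t) *: h)).
  by rewrite enorm_sqr {2}/v 2!innerBr e1 e2.
have [->|v0] := eqVneq (enorm v) 0.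
  by rewrite !mulr_ge0 ?enorm_ge0 ?sqr_ge0// !addr_ge0 ?exprn_ge0 ?enorm_ge0.
have vp : 0 < enorm v by rewrite lt0r v0 enorm_ge0.
move: t01 s01 => /andP[t0 t1] /andP[s0 s1].
have st01 : 0 <= s * t <= 1 by rewrite mulr_ge0//= mulr_ile1.
rewrite -(ler_pM2l vp) -expr2 e.
apply: (@le_trans _ _ (t * (enorm v * (M * (1 + enorm x ^+ r + enorm y ^+ r) * enorm h ^+ 2)))).
  rewrite ler_wpM2l// (le_trans (inner_le _ _))// ler_wpM2l ?enorm_ge0//.
  apply: le_trans (growth_derive2_le _ _ _ _ _ bf) _ => //; first exact: enormZ.
  by rewrite ler_wpM2r ?sqr_ge0// ler_wpM2l// enorm_segment_le.
rewrite ler_piMl// !mulr_ge0 ?sqr_ge0 ?enorm_ge0//.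
by rewrite !addr_ge0 ?exprn_ge0 ?enorm_ge0.
Qed.

End MeanValue.

(** * Borel measurability of random vectors *)

Section BorelVectors.
Context {R : realType} {d : nat}.

(** Only the coordinates are known to be measurable. An open set is the countable union of the
    sup-norm boxes with rational centre and radius [1/(n+1)] that it contains, and the preimage of a
    box is a finite intersection of conditions on coordinates. *)
Lemma open_preimage_measurable {disp} {T : measurableType disp}
    (v : T -> 'rV[R]_d) (U : set 'rV[R]_d) :
  (forall i, measurable_fun [set: T] (fun w => v w ord0 i)) -> open U ->
  measurable (v @^-1` U).
Proof.
move=> mv oU.
pose box (p : 'rV[rat]_d * nat) := [set y : 'rV[R]_d |
  forall i, `|ratr (p.1 ord0 i) - y ord0 i| < p.2.+1%:R^-1].
(* Boxes that leave [U] are replaced by the empty set, so that the union runs over a countable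
   type. *)
pose F p := if pselect (box p `<=` U) then v @^-1` (box p) else set0.
have -> : v @^-1` U = \bigcup_p F p.
  apply/seteqP; split => [w /= Uvw|w [p _]]; last first.
    by rewrite /F; case: pselect => // pU bw; exact: pU bw.
  have /nbhs_ballP[e /= e0 eU] := oU _ Uvw.
  have [n ne] : exists n : nat, n.+1%:R^-1 < e / 2.
    have /ltr_add_invr[n] : 0 < e / 2 by exact: divr_gt0.
    by rewrite add0r => ?; exists n.
  have q_ex i : exists q : rat, `|ratr q - v w ord0 i| < n.+1%:R^-1.
    have : v w ord0 i - n.+1%:R^-1 < v w ord0 i + n.+1%:R^-1.
      by rewrite ltrBlDr -addrA ltrDl addr_gt0 ?invr_gt0.
    move=> /rat_in_itvoo[q]; rewrite in_itv/= => /andP[q1 q2]; exists q.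
    by rewrite ltr_norml ltrBrDr ltrBlDl addrC q1.
  pose p : 'rV[rat]_d * nat := (\row_i sval (cid (q_ex i)), n).
  have bp : box p (v w) by move=> i; rewrite mxE; exact: svalP (cid (q_ex i)).
  have bU : box p `<=` U.
    move=> y yb; apply: eU; split=> // i j; rewrite ord1 /ball /=.
    have := bp j; have := yb j; rewrite /= mxE => h1 h2.
    rewrite (_ : v w 0 j - y 0 j = (v w ord0 j - ratr (sval (cid (q_ex j)))) +
      (ratr (sval (cid (q_ex j))) - y ord0 j)); last by rewrite addrA subrK.
    rewrite (le_lt_trans (ler_normD _ _))// [`|v w _ _ - _|]distrC.
    rewrite (splitr e) ltrD//; exact: lt_trans ne.
  by exists p => //; rewrite /F; case: pselect.
apply: countable_bigcupT_measurable => [|p]; first exact: countableP.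
rewrite /F; case: pselect => pU; last exact: measurable0.
have -> : v @^-1` box p = \bigcap_(i in [set: 'I_d])
    ((fun w => `|ratr (p.1 ord0 i) - v w ord0 i|) @^-1` `]-oo, p.2.+1%:R^-1[).
  apply/seteqP; split=> [w bw i _ /=|w bw i]; first by rewrite in_itv/=; exact: bw.
  by have := bw i I; rewrite /= in_itv.
apply: fin_bigcap_measurable; first exact: finite_finset.
move=> i _; rewrite -[X in measurable X]setTI.
have : measurable_fun [set: T] (fun w => `|ratr (p.1 ord0 i) - v w ord0 i|).
  apply: measurableT_comp => //; apply: measurable_funB => //.
by apply => //; exact: measurable_itv.
Qed.

(** The scheme is built coordinate by coordinate, whereas the solution and [mu] are given on Borel
    sets; this is the passage between the two descriptions. *)
Lemma measurable_borel_rVP {disp} {T : measurableType disp} (v : T -> 'rV[R]_d) :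
  (forall i, measurable_fun [set: T] (fun w => v w ord0 i)) <->
  measurable_fun [set: T] (v : T -> borel_rV R d).
Proof.
split=> [mv|mv i].
  apply: (@measurability _ _ _ (borel_rV R d) _ _ (@open 'rV[R]_d)) => //.
  by move=> _ [U oU <-]; rewrite setTI; exact: open_preimage_measurable.
have mc : measurable_fun [set: borel_rV R d] (fun x : 'rV[R]_d => x ord0 i).
  apply: (measurability _ (RGenOpens.measurableE R)).
  move=> _ [_ [a [b ->] <-]]; rewrite setTI; apply: sub_sigma_algebra.
  move: (@coord_continuous R 1 d ord0 i) => /continuousP; apply.
  exact: interval_open.
exact: measurableT_comp mc mv.
Qed.

Lemma continuous_borel_measurable (g : 'rV[R]_d -> R) :
  continuous g -> measurable_fun [set: borel_rV R d] g.
Proof.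
move=> cg; apply: (measurability _ (RGenOpens.measurableE R)).
move=> _ [_ [a [b ->] <-]]; rewrite setTI; apply: sub_sigma_algebra.
by move: cg => /continuousP; apply; exact: interval_open.
Qed.

Lemma measurable_continuous_comp {disp} {T : measurableType disp}
    (v : T -> 'rV[R]_d) (g : 'rV[R]_d -> R) :
  (forall i, measurable_fun [set: T] (fun w => v w ord0 i)) -> continuous g ->
  measurable_fun [set: T] (fun w => g (v w)).
Proof.
move=> /measurable_borel_rVP mv /continuous_borel_measurable mg.
exact: measurableT_comp mg mv.
Qed.

Lemma measurable_continuous_coord {disp} {T : measurableType disp}
    (v : T -> 'rV[R]_d) (g : 'rV[R]_d -> 'rV[R]_d) :
  (forall i, measurable_fun [set: T] (fun w => v w ord0 i)) -> continuous g ->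
  forall i, measurable_fun [set: T] (fun w => g (v w) ord0 i).
Proof.
move=> mv cg i; apply: (@measurable_continuous_comp _ _ v (fun x => g x ord0 i) mv).
move=> x; apply: (@continuous_comp _ _ _ g (fun y : 'rV[R]_d => y ord0 i)).
  exact: cg.
exact: coord_continuous.
Qed.

End BorelVectors.

(** * Random variables with moments of all orders *)

Lemma expr_sum_le {R : realDomainType} (a b : R) (p : nat) : 0 <= a -> 0 <= b ->
  (a + b) ^+ p <= 2 ^+ p * (a ^+ p + b ^+ p).
Proof.
move=> a0 b0.
have [ab|/ltW ab] := leP a b.
- apply: (@le_trans _ _ ((2 * b) ^+ p)).
    by rewrite lerXn2r ?nnegrE ?addr_ge0 ?mulr_ge0//; lra.
  by rewrite exprMn ler_wpM2l ?exprn_ge0// lerDr exprn_ge0.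
- apply: (@le_trans _ _ ((2 * a) ^+ p)).
    by rewrite lerXn2r ?nnegrE ?addr_ge0 ?mulr_ge0//; lra.
  by rewrite exprMn ler_wpM2l ?exprn_ge0// lerDl exprn_ge0.
Qed.

Section Moments.
Context {disp : measure_display} {T : measurableType disp} {R : realType}.
Variable P : probability T R.
Implicit Types (X Y : T -> R) (p : nat).

(** A class closed under sums and products, so that no integrability exponents have to be
    tracked. *)
Definition all_moments X := measurable_fun [set: T] X /\
  forall p, P.-integrable [set: T] (EFin \o (fun w => `|X w| ^+ p)).

Lemma all_moments_measurable X : all_moments X -> measurable_fun [set: T] X.
Proof. by case. Qed.

Lemma le_all_moments X Y : measurable_fun [set: T] Y ->
  (forall w, `|Y w| <= `|X w|) -> all_moments X -> all_moments Y.
Proof.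
move=> mY YX [mX iX]; split=> // p; apply: le_integrable (iX p) => //.
  apply/measurable_EFinP; apply: measurable_funX; exact: measurableT_comp.
by move=> w _ /=; rewrite lee_fin !normrX !normr_id lerXn2r ?nnegrE.
Qed.

Lemma all_moments_cst (c : R) : all_moments (cst c).
Proof.
split=> // p; apply/integrableP; split.
  by apply/measurable_EFinP; exact: (measurable_cst (`|c| ^+ p)).
by rewrite /= integral_cst//= probability_setT mule1 ltry.
Qed.

Lemma all_momentsD X Y : all_moments X -> all_moments Y ->
  all_moments (fun w => X w + Y w).
Proof.
move=> [mX iX] [mY iY]; split; first exact: measurable_funD.
move=> p; have := integrableZl measurableT (2 ^+ p) (integrableD measurableT (iX p) (iY p)).
apply: le_integrable => //.
  apply/measurable_EFinP; apply: measurable_funX; apply: measurableT_comp => //.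
  exact: measurable_funD.
move=> w _ /=; rewrite lee_fin normrX normr_id; apply: le_trans (ler_norm _).
apply: le_trans (expr_sum_le _ _ _) => //.
by rewrite lerXn2r ?nnegrE ?addr_ge0// ler_normD.
Qed.

Lemma all_momentsX X n : all_moments X -> all_moments (fun w => X w ^+ n).
Proof.
move=> [mX iX]; split; first exact: measurable_funX.
move=> p; apply: eq_integrable (iX (n * p)%N) => // w _ /=.
by rewrite exprM normrX.
Qed.

Lemma all_moments_norm X : all_moments X -> all_moments (fun w => `|X w|).
Proof.
move=> aX; apply: le_all_moments (aX) => [|w]; last by rewrite normr_id.
by apply: measurableT_comp => //; exact: all_moments_measurable.
Qed.

Lemma all_momentsM X Y : all_moments X -> all_moments Y ->
  all_moments (fun w => X w * Y w).
Proof.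
move=> aX aY.
have := all_momentsD (all_momentsX 2 aX) (all_momentsX 2 aY).
apply: le_all_moments; first by apply: measurable_funM; exact: all_moments_measurable.
move=> w; rewrite normrM [leRHS]ger0_norm ?addr_ge0 ?sqr_ge0//.
rewrite -[X w ^+ 2]real_normK ?num_real// -[Y w ^+ 2]real_normK ?num_real//.
have := sqr_ge0 (`|X w| - `|Y w|); nra.
Qed.

Lemma all_momentsZ (c : R) X : all_moments X -> all_moments (fun w => c * X w).
Proof. by move=> aX; apply: all_momentsM => //; exact: all_moments_cst. Qed.

Lemma all_moments_sum (I : Type) (s : seq I) (X : I -> T -> R) :
  (forall i, all_moments (X i)) -> all_moments (fun w => \sum_(i <- s) X i w).
Proof.
move=> aX; elim: s => [|i s ih].
  by under eq_fun do rewrite big_nil; exact: all_moments_cst.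
by under eq_fun do rewrite big_cons; exact: all_momentsD.
Qed.

Lemma all_moments_integrable X : all_moments X -> P.-integrable [set: T] (EFin \o X).
Proof.
move=> [mX iX]; apply: le_integrable (iX 1%N) => //; first exact/measurable_EFinP.
by move=> w _ /=; rewrite expr1 normr_id.
Qed.

Lemma mean_cst (c : R) : \int[P]_w c = c.
Proof. by rewrite Rintegral_cst//= probability_setT mulr1. Qed.

Lemma meanD X Y : all_moments X -> all_moments Y ->
  \int[P]_w (X w + Y w) = \int[P]_w X w + \int[P]_w Y w.
Proof. by move=> aX aY; rewrite RintegralD//; exact: all_moments_integrable. Qed.

Lemma meanZ (c : R) X : all_moments X -> \int[P]_w (c * X w) = c * \int[P]_w X w.
Proof. by move=> aX; rewrite RintegralZl//; exact: all_moments_integrable. Qed.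

Lemma mean_sum (I : Type) (s : seq I) (X : I -> T -> R) :
  (forall i, all_moments (X i)) ->
  \int[P]_w (\sum_(i <- s) X i w) = \sum_(i <- s) \int[P]_w X i w.
Proof.
move=> aX; elim: s => [|i s ih].
  by under eq_Rintegral do rewrite big_nil; rewrite mean_cst big_nil.
under eq_Rintegral do rewrite big_cons.
by rewrite meanD// ?big_cons ?ih//; exact: all_moments_sum.
Qed.

Lemma mean_le X Y : all_moments X -> all_moments Y ->
  (forall w, X w <= Y w) -> \int[P]_w X w <= \int[P]_w Y w.
Proof.
by move=> aX aY XY; apply: le_Rintegral => //; exact: all_moments_integrable.
Qed.

Lemma EFin_mean X : all_moments X ->
  (\int[P]_w (X w)%:E)%E = (\int[P]_w X w)%:E.
Proof.
move=> /all_moments_integrable iX; rewrite /Rintegral fineK//.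
exact: integrable_fin_num.
Qed.

(** The law of the pair and the product of the laws agree on rectangles, hence everywhere, and
    Tonelli's theorem applies. Nonnegative functions are taken so that the identity holds in the
    extended reals, before any integrability is known, as moment generating functions require. *)
Lemma all_moments_indep_mul X Y :
  (forall A B : set R, measurable A -> measurable B ->
    P (X @^-1` A `&` Y @^-1` B) = (P (X @^-1` A) * P (Y @^-1` B))%E) ->
  measurable_fun [set: T] X -> measurable_fun [set: T] Y ->
  forall a b : R -> R, measurable_fun [set: R] a -> measurable_fun [set: R] b ->
  (forall x, 0 <= a x) -> (forall x, 0 <= b x) ->
  (\int[P]_w (a (X w) * b (Y w))%:E =
   \int[P]_w (a (X w))%:E * \int[P]_w (b (Y w))%:E)%E.
Proof.
move=> ind mX mY a b ma mb a0 b0.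
pose X' : {mfun T >-> R} := HB.pack X (isMeasurableFun.Build _ _ _ _ _ mX).
pose Y' : {mfun T >-> R} := HB.pack Y (isMeasurableFun.Build _ _ _ _ _ mY).
have mXY : measurable_fun [set: T] (fun w => (X w, Y w)).
  exact: measurable_fun_pair.
pose Z : {mfun T >-> (R * R)%type} :=
  HB.pack (fun w => (X w, Y w)) (isMeasurableFun.Build _ _ _ _ _ mXY).
have PZ : forall S : set (R * R), measurable S ->
    (distribution P X' \x distribution P Y')%E S = distribution P Z S.
  apply: product_measure_unique => A B mA mB /=.
  by rewrite /distribution /pushforward /= -ind.
have mab : measurable_fun [set: R * R] (fun z : R * R => (a z.1 * b z.2)%:E).
  apply/measurable_EFinP; apply: measurable_funM.
    exact: measurableT_comp.
  exact: measurableT_comp.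
transitivity (\int[distribution P Z]_z (a z.1 * b z.2)%:E)%E.
  by rewrite ge0_integral_distribution// => y; rewrite lee_fin mulr_ge0.
transitivity (\int[distribution P X' \x distribution P Y']_z (a z.1 * b z.2)%:E)%E.
  by apply: eq_measure_integral => A mA _; exact/esym/PZ.
rewrite fubini_tonelli1 /fubini_F /=; [|exact: mab|by move=> z; rewrite lee_fin mulr_ge0].
have eb : (\int[distribution P Y']_y (b y)%:E = \int[P]_w (b (Y w))%:E)%E.
  by rewrite ge0_integral_distribution//; exact/measurable_EFinP.
have ea : (\int[distribution P X']_y (a y)%:E = \int[P]_w (a (X w))%:E)%E.
  by rewrite ge0_integral_distribution//; exact/measurable_EFinP.
transitivity (\int[distribution P X']_x ((a x)%:E * \int[P]_w (b (Y w))%:E))%E.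
  apply: eq_integral => x _; rewrite -eb.
  under eq_integral do rewrite EFinM.
  rewrite ge0_integralZl//; first exact/measurable_EFinP.
    by move=> y _; rewrite lee_fin.
  by rewrite lee_fin.
rewrite ge0_integralZr//; first by rewrite ea.
- exact/measurable_EFinP.
- by move=> y _; rewrite lee_fin.
- by apply: integral_ge0 => w _; rewrite lee_fin.
Qed.

(** Each variable is split into its positive and negative parts, which are functions of that
    variable alone; the nonnegative case applies to the four products. *)
Lemma mean_indepM X Y :
  (forall A B : set R, measurable A -> measurable B ->
    P (X @^-1` A `&` Y @^-1` B) = (P (X @^-1` A) * P (Y @^-1` B))%E) ->
  all_moments X -> all_moments Y ->
  \int[P]_w (X w * Y w) = \int[P]_w X w * \int[P]_w Y w.
Proof.
move=> ind aX aY; have [mX _] := aX; have [mY _] := aY.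
pose pos (x : R) := Num.max x 0; pose neg (x : R) := Num.max (- x) 0.
have mpos : measurable_fun [set: R] pos by exact: measurable_maxr.
have mneg : measurable_fun [set: R] neg by apply: measurable_maxr.
have pos0 x : 0 <= pos x by rewrite le_max lexx orbT.
have neg0 x : 0 <= neg x by rewrite le_max lexx orbT.
have pn x : x = pos x - neg x by rewrite /pos /neg; case: (leP x 0); case: (leP (- x) 0); lra.
have posN x : `|pos x| <= `|x|.
  by rewrite ger0_norm// /pos ge_max normr_ge0 ler_norm.
have negN x : `|neg x| <= `|x|.
  by rewrite ger0_norm// /neg ge_max normr_ge0 -normrN ler_norm.
have am Z (c : R -> R) : all_moments Z -> measurable_fun [set: R] c ->
    (forall x, `|c x| <= `|x|) -> all_moments (fun w => c (Z w)).
  move=> aZ mc cZ; apply: le_all_moments (aZ) => //.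
  exact: measurableT_comp mc (all_moments_measurable aZ).
have [apX anX] := (am X pos aX mpos posN, am X neg aX mneg negN).
have [apY anY] := (am Y pos aY mpos posN, am Y neg aY mneg negN).
have E (a b : R -> R) : measurable_fun [set: R] a -> measurable_fun [set: R] b ->
    (forall x, 0 <= a x) -> (forall x, 0 <= b x) ->
    all_moments (fun w => a (X w)) -> all_moments (fun w => b (Y w)) ->
    \int[P]_w (a (X w) * b (Y w)) = \int[P]_w a (X w) * \int[P]_w b (Y w).
  move=> ma mb a0 b0 aa ab; apply: EFin_inj; rewrite -EFin_mean; last exact: all_momentsM.
  by rewrite all_moments_indep_mul// EFinM !EFin_mean.
have eX : \int[P]_w X w = \int[P]_w pos (X w) - \int[P]_w neg (X w).
  rewrite -mulN1r -meanZ// -meanD//; last exact: all_momentsZ.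
  by apply: eq_Rintegral => w _; rewrite mulN1r -pn.
have eY : \int[P]_w Y w = \int[P]_w pos (Y w) - \int[P]_w neg (Y w).
  rewrite -mulN1r -meanZ// -meanD//; last exact: all_momentsZ.
  by apply: eq_Rintegral => w _; rewrite mulN1r -pn.
rewrite eX eY mulrBl !mulrBr -!E// opprB addrA.
rewrite -[- \int[P]_w (pos (X w) * neg (Y w))]mulN1r.
rewrite -[- \int[P]_w (neg (X w) * pos (Y w))]mulN1r.
rewrite -!meanZ; try exact: all_momentsM.
rewrite -!meanD; do ?[exact: all_momentsM | apply: all_momentsD | apply: all_momentsZ].
apply: eq_Rintegral => w _; rewrite {1}(pn (X w)) {1}(pn (Y w)); ring.
Qed.

End Moments.

(** * Gaussian moments *)

Section Subgaussian.
Context {disp : measure_display} {T : measurableType disp} {R : realType}.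
Variable P : probability T R.
Implicit Types (X : T -> R) (v : R).

(** An inequality, with [v] as a bound for the variance, because for the Ornstein-Uhlenbeck chain
    only a bound uniform in time is needed. *)
Definition subgaussian v X := measurable_fun [set: T] X /\
  forall l : R, (\int[P]_w (expR (l * X w))%:E <= (expR (l ^+ 2 * v / 2))%:E)%E.

Lemma subgaussianN v X : subgaussian v X -> subgaussian v (fun w => - X w).
Proof.
move=> [mX gX]; split; first exact: measurableT_comp.
move=> l; have := gX (- l); rewrite sqrrN.
by under eq_integral do rewrite mulNr -mulrN.
Qed.

Lemma expr_le_expR (p : nat) (y : R) : 0 <= y -> y ^+ p <= p%:R ^+ p * expR y.
Proof.
move=> y0; case: p => [|p]; first by rewrite !expr0 mul1r -[leLHS]expR0 ler_expR.
have -> : expR y = expR (y / p.+1%:R) ^+ p.+1.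
  by rewrite -expRM_natl mulrC divfK// pnatr_eq0.
rewrite -exprMn lerXn2r ?nnegrE ?mulr_ge0 ?expR_ge0//.
rewrite mulrC -ler_pdivrMr ?ltr0n//; apply: le_trans (expR_ge1Dx _).
by rewrite lerDr.
Qed.

(** With [y = |X| / sqrt v], one has [y ^ p <= p ^ p * exp y] and [exp y] is at most the sum of the
    exponentials of [X / sqrt v] and of its opposite; each of these has mean at most
    [exp (1/2) <= exp 1]. *)
Definition moment_constant (p : nat) : R := 2 * p%:R ^+ p * expR 1.

Lemma moment_constant_ge0 p : 0 <= moment_constant p.
Proof. by rewrite !mulr_ge0 ?exprn_ge0 ?expR_ge0. Qed.

Lemma subgaussian_moment_integral v X p : 0 < v -> subgaussian v X ->
  (\int[P]_w (`|X w| ^+ p)%:E <= (moment_constant p * Num.sqrt v ^+ p)%:E)%E.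
Proof.
move=> v0 [mX gX]; set s := Num.sqrt v.
have s0 : 0 < s by rewrite sqrtr_gt0.
have s2 : s ^+ 2 = v by rewrite sqr_sqrtr// ltW.
have me (l : R) : measurable_fun [set: T] (fun w => (expR (l * X w))%:E).
  apply/measurable_EFinP; apply: measurableT_comp => //.
  exact: measurable_funM.
have bd (l : R) : l ^+ 2 * v = 1 ->
    (\int[P]_w (expR (l * X w))%:E <= (expR 1)%:E)%E.
  by move=> e; apply: le_trans (gX l) _; rewrite e lee_fin ler_expR; lra.
have c0 : 0 <= s ^+ p * p%:R ^+ p by rewrite mulr_ge0 ?exprn_ge0// ltW.
apply: (@le_trans _ _ (\int[P]_w ((s ^+ p * p%:R ^+ p)%:E *
    ((expR (s^-1 * X w))%:E + (expR (- s^-1 * X w))%:E)))%E).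
  apply: ge0_le_integral => //.
  - by apply/measurable_EFinP; apply: measurable_funX; exact: measurableT_comp.
  - by apply: measurable_funeM; apply: emeasurable_funD; exact: me.
  move=> w _; rewrite -EFinD -EFinM lee_fin -mulrA.
  have -> : `|X w| ^+ p = s ^+ p * (`|X w| / s) ^+ p.
    by rewrite -exprMn mulrCA divff ?mulr1// gt_eqF.
  rewrite ler_wpM2l ?exprn_ge0 ?(ltW s0)//.
  apply: le_trans (expr_le_expR _ _) _; first by rewrite divr_ge0// ltW.
  rewrite ler_wpM2l ?exprn_ge0// mulNr mulrC.
  have [x0|x0] := leP 0 (X w).
    by rewrite ger0_norm// lerDl expR_ge0.
  by rewrite ltr0_norm// mulrN lerDr expR_ge0.
rewrite ge0_integralZl//; last 2 first.
- exact: emeasurable_funD.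
- by move=> w _; rewrite adde_ge0// lee_fin expR_ge0.
rewrite ge0_integralD//.
have -> : moment_constant p * s ^+ p = s ^+ p * p%:R ^+ p * (expR 1 + expR 1).
  by rewrite /moment_constant; ring.
rewrite [leRHS]EFinM lee_wpmul2l ?lee_fin// EFinD leeD//; apply: bd.
  by rewrite exprVn s2 mulVf// gt_eqF.
by rewrite sqrrN exprVn s2 mulVf// gt_eqF.
Qed.

Lemma subgaussian_all_moments v X : 0 < v -> subgaussian v X -> all_moments P X.
Proof.
move=> v0 gX; have [mX _] := gX; split=> // p; apply/integrableP; split.
  by apply/measurable_EFinP; apply: measurable_funX; exact: measurableT_comp.
under eq_integral do rewrite /= normrX normr_id.
by apply: le_lt_trans (subgaussian_moment_integral p v0 gX) _; rewrite ltry.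
Qed.

Lemma subgaussian_moment v X p : 0 < v -> subgaussian v X ->
  \int[P]_w (`|X w| ^+ p) <= moment_constant p * Num.sqrt v ^+ p.
Proof.
move=> v0 gX; rewrite -lee_fin -EFin_mean; first exact: subgaussian_moment_integral.
by apply: all_momentsX; apply: all_moments_norm; exact: subgaussian_all_moments gX.
Qed.

(** A positive mean [m] would give [1 + l m <= E exp (l X) <= exp (l^2 v / 2) <= 1 + l^2 v], which
    fails for small positive [l]. *)
Lemma subgaussian_mean_le0 v X : 0 < v -> subgaussian v X -> \int[P]_w X w <= 0.
Proof.
move=> v0 gX; have aX := subgaussian_all_moments v0 gX; have [mX gl] := gX.
rewrite leNgt; apply/negP => m0; set m := \int[P]_w X w in m0.
(* Small enough for [l v < m], the contradiction, and for [l^2 v <= 1], where the exponential is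
   below its linear bound. *)
pose l := m / ((1 + v) * (1 + m)).
have v1 : 0 < 1 + v by rewrite addr_gt0.
have m1 : 0 < 1 + m by rewrite addr_gt0.
have l0 : 0 < l by rewrite divr_gt0// mulr_gt0.
have lv : l * v < m.
  rewrite /l mulrAC ltr_pdivrMr ?mulr_gt0// ltr_pM2l//; nra.
have l1 : l * (1 + v) <= 1.
  rewrite /l mulrAC ler_pdivrMr ?mulr_gt0//; nra.
have u1 : l ^+ 2 * v / 2 <= 2^-1 by rewrite expr2; nra.
have lower : ((1 + l * m)%:E <= \int[P]_w (expR (l * X w))%:E)%E.
  have <- : \int[P]_w (1 + l * X w) = 1 + l * m.
    rewrite meanD ?meanZ ?mean_cst//; first exact: all_moments_cst.
    exact: all_momentsZ.
  have a1 : all_moments P (fun w => 1 + l * X w).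
    by apply: all_momentsD; [exact: all_moments_cst|exact: all_momentsZ].
  rewrite -EFin_mean//; have [ifin|] := boolP ((\int[P]_w (expR (l * X w))%:E)%E \is a fin_num).
    apply: le_integral => //; first exact: all_moments_integrable.
      apply/integrableP; split.
        apply/measurable_EFinP; apply: measurableT_comp => //.
        exact: measurable_funM.
      under eq_integral do rewrite /= ger0_norm ?expR_ge0//.
      by rewrite -ge0_fin_numE// integral_ge0// => w _; rewrite lee_fin expR_ge0.
    by move=> w _; rewrite lee_fin expR_ge1Dx.
  rewrite ge0_fin_numE; last by apply: integral_ge0 => w _; rewrite lee_fin expR_ge0.
  by rewrite -leNgt leye_eq => /eqP ->; rewrite leey.
have := le_trans lower (gl l); rewrite lee_fin; set u := l ^+ 2 * v / 2 in u1 *.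
have u0 : 0 <= u by rewrite divr_ge0// mulr_ge0 ?sqr_ge0// ltW.
have : expR u <= 1 + 2 * u.
  have := expR_ge1Dx (- u); have := expR_gt0 u.
  by rewrite expRN; set e := expR u => e0 he; have : e * (1 - u) <= 1;
    [rewrite -[leRHS](mulfV (lt0r_neq0 e0)) ler_wpM2l// ltW|nra].
move=> h1 h2; have : l * m <= l * (l * v).
  rewrite -(lerD2l 1); apply: le_trans h2 (le_trans h1 _).
  by rewrite /u; lra.
by rewrite ler_pM2l// leNgt lv.
Qed.

Lemma subgaussian_mean0 v X : 0 < v -> subgaussian v X -> \int[P]_w X w = 0.
Proof.
move=> v0 gX; have aX := subgaussian_all_moments v0 gX.
apply/eqP; rewrite eq_le (subgaussian_mean_le0 v0 gX)/=.
have := subgaussian_mean_le0 v0 (subgaussianN gX).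
under eq_Rintegral do rewrite -mulN1r.
by rewrite meanZ// mulN1r oppr_le0.
Qed.

End Subgaussian.

(** * Moment generating function of the normal law *)

Section NormalMgf.
Context {R : realType}.

(** The Radon-Nikodym derivative and the normal density have the same integral over every measurable
    set, hence agree almost everywhere. *)
Lemma ge0_integral_normal_prob (m s : R) (g : R -> \bar R) :
  measurable_fun [set: R] g -> (forall x, 0 <= g x)%E ->
  (\int[normal_prob m s]_x g x =
   \int[lebesgue_measure]_x (g x * (normal_pdf m s x)%:E))%E.
Proof.
move=> mg g0.
have dom := normal_prob_dominates m s.
rewrite -(Radon_Nikodym_SigmaFinite.change_of_variables dom g0 measurableT mg).
have iN := Radon_Nikodym_SigmaFinite.f_integrable dom.
have mpdf : measurable_fun [set: R] (fun x => (normal_pdf m s x)%:E).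
  by apply/measurable_EFinP; exact: measurable_normal_pdf.
apply: ae_eq_integral => //.
- by apply: emeasurable_funM => //; exact: measurable_int iN.
- exact: emeasurable_funM.
have : ae_eq lebesgue_measure [set: R] (Radon_Nikodym_SigmaFinite.f
  (normal_prob m s) lebesgue_measure)
    (fun x => (normal_pdf m s x)%:E).
  apply: integral_ae_eq => // E _ mE.
  by rewrite -Radon_Nikodym_SigmaFinite.f_integral.
by apply: filterS => x h xT /=; rewrite h.
Qed.

Lemma normal_prob_mgf (s l : R) : s != 0 ->
  (\int[normal_prob 0 s]_x (expR (l * x))%:E = (expR (l ^+ 2 * s ^+ 2 / 2))%:E)%E.
Proof.
move=> s0; rewrite ge0_integral_normal_prob//; last first.
  by apply/measurable_EFinP; apply: measurableT_comp => //; exact: measurable_funM.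
(* Completing the square: the exponential tilt of a centred normal density is a normal density with
   mean [l s^2], up to a constant factor. *)
have e x : ((expR (l * x))%:E * (normal_pdf 0 s x)%:E =
    (expR (l ^+ 2 * s ^+ 2 / 2))%:E * (normal_pdf (l * s ^+ 2) s x)%:E)%E.
  rewrite -!EFinM; congr _%:E; rewrite /normal_pdf (negbTE s0) /normal_fun.
  rewrite mulrCA [RHS]mulrCA -!expRD; congr (_ * expR _).
  by field.
under eq_integral do rewrite e.
rewrite ge0_integralZl//.
- by rewrite integral_normal_pdf mule1.
- by apply/measurable_EFinP; exact: measurable_normal_pdf.
- by move=> x _; rewrite lee_fin normal_pdf_ge0.
Qed.

End NormalMgf.

(** * Increments of Wiener processes *)

Section Wiener.
Context {disp : measure_display} {T : measurableType disp} {R : realType}.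
Context (P : probability T R) (F : R -> set (set T)) (hF : usual_conditions P F).
Context (K : nat) (beta : 'I_K -> R -> T -> R)
  (hbeta : independent_wiener_processes P F beta).
Implicit Types (X : T -> R) (s t : R).

(** Phrased as measurability for the sigma-algebra generated by [F t], so that sums, products and
    continuous images of adapted variables are covered by the usual closure rules; [adaptedP]
    returns to preimages. *)
Definition adapted t X := measurable_fun [set: g_sigma_algebraType (F t)] X.

Lemma adaptedP t X : 0 <= t ->
  adapted t X <-> forall B : set R, measurable B -> F t (X @^-1` B).
Proof.
move=> t0; have sF := sigma_algebra_id (uc_sigma_algebra hF t0); split=> [aX B mB|h _ B mB].
  by have := aX measurableT _ mB; rewrite setTI /measurable /= sF.
by rewrite setTI; apply: sub_sigma_algebra; exact: h.
Qed.

Lemma adapted_le s t X : 0 <= s -> s <= t -> adapted s X -> adapted t X.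
Proof.
move=> s0 st /(adaptedP _ s0) h; apply/(adaptedP _ (le_trans s0 st)) => B mB.
by apply: uc_increasing hF _ _ s0 st _ _; exact: h.
Qed.

Lemma adapted_measurable t X : 0 <= t -> adapted t X -> measurable_fun [set: T] X.
Proof.
move=> t0 /(adaptedP _ t0) h _ B mB; rewrite setTI.
by apply: uc_measurable hF _ t0 _ _; exact: h.
Qed.

Lemma adapted_beta k s t : 0 <= s -> s <= t -> adapted t (beta k s).
Proof.
move=> s0 st; apply: (adapted_le s0 st); apply/(adaptedP _ s0) => B mB.
exact: wiener_adapted hbeta _ _ _ s0 mB.
Qed.

Definition increment k s t w := beta k t w - beta k s w.

Lemma adapted_increment k s s' t : 0 <= s -> s <= s' -> s' <= t ->
  adapted t (increment k s s').
Proof.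
move=> s0 ss' s't; apply: measurable_funB.
  exact: adapted_beta (le_trans s0 ss') s't.
exact: adapted_beta s0 (le_trans ss' s't).
Qed.

Lemma measurable_increment k s t : 0 <= s -> s <= t ->
  measurable_fun [set: T] (increment k s t).
Proof.
move=> s0 st; apply: (@adapted_measurable t); first exact: le_trans st.
exact: adapted_increment.
Qed.

(** The joint independence clause is used with the whole line as target set for every component
    other than [k]. *)
Lemma increment_indep k s t X : 0 <= s -> s < t -> adapted s X ->
  forall A B : set R, measurable A -> measurable B ->
  P (X @^-1` A `&` increment k s t @^-1` B) =
  (P (X @^-1` A) * P (increment k s t @^-1` B))%E.
Proof.
move=> s0 st /(adaptedP _ s0) aX A B mA mB.
pose B' (j : 'I_K) := if j == k then B else [set: R].
have mB' j : measurable (B' j) by rewrite /B'; case: ifP.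
have := wiener_independent hbeta s0 st (aX _ mA) mB'.
have -> : \bigcap_(j in [set: 'I_K]) ((beta j t \- beta j s) @^-1` B' j) =
    increment k s t @^-1` B.
  apply/seteqP; split=> [w /(_ k I)|w h j _]; first by rewrite /B' /= eqxx.
  by rewrite /B'; have [->|] := eqVneq j k.
move=> ->; congr (_ * _)%E; rewrite (bigD1 k)//= big1 ?mule1.
  by rewrite /B' eqxx.
move=> j jk; rewrite /B' (negbTE jk) preimage_setT; exact: probability_setT.
Qed.

Lemma increment_mgf k s t l : 0 <= s -> s < t ->
  (\int[P]_w (expR (l * increment k s t w))%:E = (expR (l ^+ 2 * (t - s) / 2))%:E)%E.
Proof.
move=> s0 st; have st0 : 0 < t - s by rewrite subr_gt0.
have mi := measurable_increment k s0 (ltW st).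
pose X' : {mfun T >-> measurableTypeR R} :=
  HB.pack (increment k s t : T -> measurableTypeR R)
    (isMeasurableFun.Build _ _ T (measurableTypeR R) _ mi).
have me : measurable_fun [set: R] (fun x => (expR (l * x))%:E).
  by apply/measurable_EFinP; apply: measurableT_comp => //; exact: measurable_funM.
transitivity (\int[distribution P X']_x (expR (l * x))%:E)%E.
  by rewrite ge0_integral_distribution// => x; rewrite lee_fin expR_ge0.
transitivity (\int[normal_prob 0 (Num.sqrt (t - s))]_x (expR (l * x))%:E)%E.
  apply: eq_measure_integral => A mA _.
  exact: (wiener_gaussian hbeta k s0 st mA).
by rewrite normal_prob_mgf ?sqr_sqrtr ?(ltW st0)// gt_eqF// sqrtr_gt0.
Qed.

Lemma increment_subgaussian k s t : 0 <= s -> s < t ->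
  subgaussian P (t - s) (increment k s t).
Proof.
move=> s0 st; split; first by apply: measurable_increment => //; exact: ltW.
by move=> l; rewrite increment_mgf.
Qed.

Lemma mean_adapted_increment k s t X : 0 <= s -> s < t -> adapted s X ->
  all_moments P X -> \int[P]_w (X w * increment k s t w) = 0.
Proof.
move=> s0 st aX mX; have st0 : 0 < t - s by rewrite subr_gt0.
have g := increment_subgaussian k s0 st.
rewrite mean_indepM ?(subgaussian_mean0 st0 g) ?mulr0//; first exact: increment_indep.
exact: subgaussian_all_moments g.
Qed.

(* An Ornstein--Uhlenbeck chain driven by the increments of [beta k]: unlike
   [beta k] itself, it has moments bounded uniformly in time. *)
Fixpoint ou (h : R) (k : 'I_K) (n : nat) (w : T) : R :=
  if n is m.+1 then (1 - h) * ou h k m w + increment k (m%:R * h) (m.+1%:R * h) w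
  else 0.

Lemma adapted_ou h k n : 0 < h -> adapted (n%:R * h) (ou h k n).
Proof.
move=> h0; elim: n => [|n ih]; first exact: measurable_cst.
have n0 : 0 <= n%:R * h by rewrite mulr_ge0// ltW.
have nn : n%:R * h <= n.+1%:R * h by rewrite ler_wpM2r ?ler_nat// ltW.
apply: measurable_funD; last exact: adapted_increment.
by apply: measurable_funM => //; exact: adapted_le ih.
Qed.

(** The new increment is independent of the chain, so variance bounds add up:
    [(1 - h)^2 + h = 1 - h (1 - h) <= 1]. The bound 1 is therefore reproduced at every step. *)
Lemma ou_subgaussian h k n : 0 < h -> h <= 1 -> subgaussian P 1 (ou h k n).
Proof.
move=> h0 h1; elim: n => [|n [mn ih]].
  split; first exact: measurable_cst.
  move=> l /=; rewrite mulr0 integral_cst//= probability_setT mule1 lee_fin.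
  by rewrite ler_expR divr_ge0// mulr_ge0// sqr_ge0.
have n0 : 0 <= n%:R * h by rewrite mulr_ge0// ltW.
have nn : n%:R * h < n.+1%:R * h by rewrite ltr_pM2r// ltr_nat.
have an : adapted (n%:R * h) (ou h k n) by exact: adapted_ou.
have mi : measurable_fun [set: T] (increment k (n%:R * h) (n.+1%:R * h)).
  exact: measurable_increment n0 (ltW nn).
split; first by apply: measurable_funD => //; exact: measurable_funM.
move=> l /=.
have mexp (c : R) : measurable_fun [set: R] (fun x => expR (c * x)).
  by apply: measurableT_comp => //; exact: measurable_funM.
under eq_integral do rewrite mulrDr expRD [l * (_ * _)]mulrA.
rewrite (all_moments_indep_mul (increment_indep k n0 nn an) mn mi
  (mexp (l * (1 - h))) (mexp l) (fun x => expR_ge0 _) (fun x => expR_ge0 _)).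
rewrite increment_mgf//; apply: le_trans (lee_wpmul2r _ (ih _)) _.
  by rewrite lee_fin expR_ge0.
have -> : n.+1%:R * h - n%:R * h = h by rewrite -natr1; ring.
rewrite -EFinM -expRD lee_fin ler_expR exprMn.
have := sqr_ge0 l; set a := l ^+ 2 => a0; have : 0 <= a * h * (1 - h).
  by apply: mulr_ge0; [apply: mulr_ge0 => //; exact: ltW|rewrite subr_ge0].
nra.
Qed.

End Wiener.

(** * Moments of the tamed scheme *)

(** Jensen's inequality for powers, by induction on the exponent; the step uses that [u - v] and
    [u ^ p - v ^ p] have the same sign. *)
Lemma convex_expr {R : realDomainType} (a u v : R) (p : nat) :
  0 <= a <= 1 -> 0 <= u -> 0 <= v ->
  ((1 - a) * u + a * v) ^+ p <= (1 - a) * u ^+ p + a * v ^+ p.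
Proof.
move=> /andP[a0 a1] u0 v0; elim: p => [|p ih]; first by rewrite !expr0; lra.
have c0 : 0 <= (1 - a) * u + a * v by rewrite addr_ge0 ?mulr_ge0// subr_ge0.
rewrite exprS; apply: le_trans (ler_wpM2l c0 ih) _; rewrite !exprS.
have d0 : 0 <= (u - v) * (u ^+ p - v ^+ p).
  have [uv|/ltW uv] := leP u v.
    by apply: mulr_le0; rewrite subr_le0 ?lerXn2r ?nnegrE.
  by apply: mulr_ge0; rewrite subr_ge0 ?lerXn2r ?nnegrE.
have : 0 <= a * (1 - a) * ((u - v) * (u ^+ p - v ^+ p)).
  by apply: mulr_ge0 => //; apply: mulr_ge0; rewrite ?subr_ge0.
move=> h; rewrite -subr_ge0; apply: le_trans h _.
by rewrite le_eqVlt; apply/orP; left; apply/eqP; ring.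
Qed.

Lemma argmax_initial {R : realDomainType} (u : nat -> R) n :
  exists2 j, (j <= n)%N & forall i, (i <= n)%N -> u i <= u j.
Proof.
elim: n => [|n [j jn ih]]; first by exists 0%N => // i; rewrite leqn0 => /eqP ->.
have [h|/ltW h] := leP (u n.+1) (u j).
  exists j => [|i]; first exact: leqW.
  by rewrite leq_eqVlt => /predU1P[->//|]; rewrite ltnS; exact: ih.
exists n.+1 => // i; rewrite leq_eqVlt => /predU1P[->//|]; rewrite ltnS => /ih.
by move=> /le_trans; apply.
Qed.

Section TamedPath.
Context {R : realType} {d : nat}.
Context (f : 'rV[R]_d -> 'rV[R]_d) (alpha gamma M : R) (q : nat).
Context (alpha0 : 0 < alpha) (gamma0 : 0 < gamma) (M0 : 0 < M).
Context (f_growth : forall x, enorm (f x) <= M * (1 + enorm x ^+ q)).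
Context (f_diss : forall x y,
  inner (f x - f y) (x - y) <= - gamma * enorm (x - y) ^+ 2).
Implicit Types (x y z : 'rV[R]_d) (h : R).

Definition tamed h x := (1 + alpha * h * enorm (f x))^-1 *: f x.

Definition zsize z : R := 1 + enorm z.

Lemma zsize_ge1 z : 1 <= zsize z.
Proof. by rewrite lerDl enorm_ge0. Qed.

Lemma zsize_ge0 z : 0 <= zsize z.
Proof. exact: le_trans (zsize_ge1 z). Qed.

Lemma enorm_le_zsize z : enorm z <= zsize z.
Proof. by rewrite lerDr. Qed.

Lemma tamed_factor h x : 0 <= h -> 1 <= 1 + alpha * h * enorm (f x).
Proof. by move=> h0; rewrite lerDl !mulr_ge0 ?enorm_ge0// ltW. Qed.

Lemma tamed_le h x : 0 <= h -> enorm (tamed h x) <= enorm (f x).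
Proof.
move=> h0; have t1 := tamed_factor x h0.
rewrite enormZ ger0_norm ?invr_ge0 ?(le_trans ler01)//.
by rewrite ler_piMl ?enorm_ge0// invf_le1// (lt_le_trans ltr01).
Qed.

(** What the taming buys: wherever the chain is, one drift step moves it by a bounded amount.
    [crude_bound] rests on this alone. *)
Lemma tamed_bounded h x : 0 < h -> h * enorm (tamed h x) <= alpha^-1.
Proof.
move=> h0; have t1 := tamed_factor x (ltW h0).
have tp : 0 < 1 + alpha * h * enorm (f x) by exact: lt_le_trans t1.
rewrite enormZ ger0_norm ?invr_ge0 ?(ltW tp)// mulrCA ler_pdivrMl//.
rewrite [leRHS]mulrC ler_pdivlMl//; lra.
Qed.

Lemma tamed_consistent h x : 0 <= h ->
  enorm (f x - tamed h x) <= alpha * h * enorm (f x) ^+ 2.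
Proof.
move=> h0; have t1 := tamed_factor x h0.
set u := alpha * h * enorm (f x) in t1 *.
have tp : 0 < 1 + u by exact: lt_le_trans t1.
have u0 : 0 <= u by rewrite /u !mulr_ge0 ?enorm_ge0// ltW.
have -> : f x - tamed h x = (u / (1 + u)) *: f x.
  rewrite /tamed -/u -{1}[f x]scale1r -scalerBl; congr (_ *: _).
  by rewrite -{1}(divff (lt0r_neq0 tp)) -[in X in _ - X]div1r -mulrBl addrC addKr.
rewrite enormZ ger0_norm ?divr_ge0 ?(ltW tp)// expr2 mulrA ler_wpM2r ?enorm_ge0//.
by rewrite -/u ler_pdivrMr// mulrDr mulr1 lerDl mulr_ge0.
Qed.

(** Young's inequality leaves [2 / gamma * (enorm (f z) + enorm z) ^ 2], and the square of the drift
    step leaves [2 + 2 * enorm z ^ 2]. Both are bounded by multiples of [zsize z ^ (2 (q+1))],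
    through [enorm (f z) <= 2 M * zsize z ^ (q+1)]. *)
Definition drift_constant : R := 2 / gamma * (2 * M + 1) ^+ 2 + 4.

(* [D] is the distance of the scheme to the Ornstein--Uhlenbeck chain [z]; as long
   as the taming is inactive ([h |f|^2 <= 1]) the dissipativity of [f] gives a
   discrete Lyapunov inequality. *)
Lemma lyapunov_step h D z : 0 < h -> h <= 1 -> alpha ^+ 2 * h <= 1 ->
  h * enorm (f (D + z)) ^+ 2 <= 1 ->
  enorm (D + h *: tamed h (D + z) + h *: z) ^+ 2 <=
    (1 - gamma / 2 * h) * enorm D ^+ 2 + h * (drift_constant * zsize z ^+ (2 * q.+1)).
Proof.
move=> h0 h1 ah hf.
set x := D + z in hf *; set V := enorm D ^+ 2.
set tau := (1 + alpha * h * enorm (f x))^-1.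
have t1 := tamed_factor x (ltW h0).
have tp : 0 < 1 + alpha * h * enorm (f x) by exact: lt_le_trans t1.
have tau1 : tau <= 1 by rewrite invf_le1.
have fx0 := enorm_ge0 (f x).
(* At least half of the dissipation survives the taming, because the square of [alpha h |f|] is the
   product of [alpha^2 h] and [h |f|^2], both at most 1. *)
have tau2 : 2^-1 <= tau.
  rewrite lef_pV2 ?posrE//; suff : alpha * h * enorm (f x) <= 1 by lra.
  rewrite -(@ler_pXn2r _ 2)// ?nnegrE ?mulr_ge0 ?(ltW alpha0) ?(ltW h0)//.
  rewrite expr1n (_ : _ ^+ 2 = (alpha ^+ 2 * h) * (h * enorm (f x) ^+ 2)); last ring.
  by rewrite mulr_ile1// mulr_ge0 ?sqr_ge0// ltW.
have -> : D + h *: tamed h x + h *: z = D + h *: (tamed h x + z).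
  by rewrite scalerDr addrA.
rewrite enorm_sqrD innerZr enormZ exprMn (ger0_norm (ltW h0)) innerDr.
have -> : inner D (tamed h x) = tau * inner D (f x) by rewrite innerZr.
have dDf : inner D (f x) <= - gamma * V + enorm D * enorm (f z).
  have -> : inner D (f x) = inner (f x - f z) (x - z) + inner D (f z).
    by rewrite {2}/x addrK innerBl (innerC (f x)) (innerC (f z)) subrK.
  by rewrite lerD ?inner_le// (le_trans (f_diss _ _))// {1}/x addrK.
have nrm : enorm (tamed h x + z) ^+ 2 <= 2 * (enorm (f x) ^+ 2 + enorm z ^+ 2).
  apply: le_trans (enorm_sqrD_le _ _) _; rewrite ler_pM2l// lerD2r.
  by rewrite lerXn2r ?nnegrE ?enorm_ge0// tamed_le// ltW.
have V0 : 0 <= V by exact: sqr_ge0.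
have Dz := inner_le D z.
set a := enorm D; set b := enorm (f z); set e := enorm z.
have a0 : 0 <= a by exact: enorm_ge0.
have b0 : 0 <= b by exact: enorm_ge0.
have e0 : 0 <= e by exact: enorm_ge0.
rewrite -/a -/b -/e in dDf nrm Dz.
have VE : V = a ^+ 2 by [].
have step1 : tau * inner D (f x) <= - (gamma / 2) * V + a * b.
  apply: (@le_trans _ _ (tau * (- gamma * V + a * b))).
    by rewrite ler_wpM2l// (le_trans _ tau2)// invr_ge0.
  rewrite mulrDr lerD//; last by rewrite ler_piMl// mulr_ge0.
  have : gamma * V * 2^-1 <= gamma * V * tau.
    by rewrite ler_wpM2l// mulr_ge0// ltW.
  lra.
(* The weight is chosen to absorb half of the dissipation [gamma * V] that is available after
   doubling [step1]. *)
have amgm : 2 * (a * (b + e)) <= gamma / 2 * V + 2 / gamma * (b + e) ^+ 2.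
  have : 0 <= gamma / 2 * (a - 2 / gamma * (b + e)) ^+ 2.
    by rewrite mulr_ge0 ?sqr_ge0// divr_ge0// ltW.
  have -> : gamma / 2 * (a - 2 / gamma * (b + e)) ^+ 2 =
    gamma / 2 * a ^+ 2 + 2 / gamma * (b + e) ^+ 2 - 2 * (a * (b + e)).
    by field; rewrite gt_eqF.
  rewrite VE; lra.
have step2 : 2 * (tau * inner D (f x) + inner D z) <=
    - (gamma / 2) * V + 2 / gamma * (b + e) ^+ 2 by lra.
have step3 : h * enorm (tamed h x + z) ^+ 2 <= 2 + 2 * e ^+ 2.
  apply: le_trans (ler_wpM2l (ltW h0) nrm) _.
  have : h * e ^+ 2 <= e ^+ 2 by rewrite ler_piMl// sqr_ge0.
  lra.
have z1 := zsize_ge1 z.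
have zp : 1 <= zsize z ^+ q.+1 by rewrite exprn_ege1.
have eq1 : e <= zsize z ^+ q.+1.
  apply: le_trans (enorm_le_zsize z) _.
  by rewrite exprS ler_peMr ?zsize_ge0// exprn_ege1.
have bq : b <= 2 * M * zsize z ^+ q.+1.
  apply: le_trans (f_growth z) _.
  have : enorm z ^+ q <= zsize z ^+ q.+1.
    apply: (@le_trans _ _ (zsize z ^+ q)).
      by rewrite lerXn2r ?nnegrE ?zsize_ge0 ?enorm_ge0// enorm_le_zsize.
    by rewrite exprS ler_peMl ?exprn_ge0// zsize_ge0.
  by move=> hz; rewrite [2 * M]mulrC -mulrA ler_wpM2l ?(ltW M0)//; lra.
have be : (b + e) ^+ 2 <= (2 * M + 1) ^+ 2 * zsize z ^+ (2 * q.+1).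
  rewrite mulnC exprM -exprMn lerXn2r ?nnegrE ?addr_ge0//.
    by rewrite mulr_ge0 ?exprn_ge0 ?zsize_ge0// addr_ge0// mulr_ge0// ltW.
  by rewrite mulrDl mul1r lerD.
have e2 : e ^+ 2 <= zsize z ^+ (2 * q.+1).
  by rewrite mulnC exprM lerXn2r ?nnegrE ?exprn_ge0 ?zsize_ge0.
have zp2 : 1 <= zsize z ^+ (2 * q.+1) by rewrite exprn_ege1.
have fin : 2 / gamma * (b + e) ^+ 2 + (2 + 2 * e ^+ 2) <=
    drift_constant * zsize z ^+ (2 * q.+1).
  set Z := zsize z ^+ (2 * q.+1) in zp2 be e2 *.
  have -> : drift_constant * Z = 2 / gamma * ((2 * M + 1) ^+ 2 * Z) + 4 * Z.
    by rewrite /drift_constant; ring.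
  have : 2 / gamma * (b + e) ^+ 2 <=
      2 / gamma * ((2 * M + 1) ^+ 2 * Z).
    by rewrite ler_wpM2l// divr_ge0// ltW.
  lra.
have H : (2 * (tau * inner D (f x) + inner D z) + h * enorm (tamed h x + z) ^+ 2)
   <= - (gamma / 2) * V + drift_constant * zsize z ^+ (2 * q.+1) by lra.
have := ler_wpM2l (ltW h0) H; rewrite -/V; lra.
Qed.

Context (h : R) (h0 : 0 < h) (h1 : h <= 1) (ah : alpha ^+ 2 * h <= 1)
  (gh : gamma / 2 * h <= 1).
Context (x0 : 'rV[R]_d) (xs zs : nat -> 'rV[R]_d).
Context (xs0 : xs 0%N = x0) (zs0 : zs 0%N = 0).
Context (xsS : forall n, xs n.+1 =
  xs n + h *: tamed h (xs n) + (zs n.+1 - (1 - h) *: zs n)).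

(** The last term is the equilibrium of the recursion of [lyapunov_step] with unit noise size; the
    others cover the initial value and make the level at least 1. *)
Definition lyapunov_level : R :=
  1 + enorm x0 ^+ 2 + drift_constant / (gamma / 2).

(** If the noise chain has size at most [b] and [enorm D ^ 2 <= A * b ^ (2 (q+1))] with [A] the
    level, then [|f|^2] is at most [b ^ (2 q (q+1))] divided by this threshold. Hence
    [h * b ^ (2 q (q+1)) <= level_threshold] forces [h |f|^2 <= 1]. *)
Definition level_threshold : R :=
  (4 * M ^+ 2 * (lyapunov_level + 1) ^+ (2 * q))^-1.

Let D n := xs n - zs n.

Let DS n : D n.+1 = D n + h *: tamed h (D n + zs n) + h *: zs n.
Proof.
rewrite /D subrK xsS; set t := tamed _ _.
by apply/rowP => i; rewrite !mxE; ring.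
Qed.

Lemma drift_constant_ge0 : 0 <= drift_constant.
Proof. by rewrite addr_ge0// mulr_ge0 ?sqr_ge0// divr_ge0// ltW. Qed.

Lemma lyapunov_level_ge1 : 1 <= lyapunov_level.
Proof.
rewrite /lyapunov_level -addrA lerDl addr_ge0 ?sqr_ge0//.
by rewrite divr_ge0 ?drift_constant_ge0// divr_ge0// ltW.
Qed.

Lemma level_threshold_gt0 : 0 < level_threshold.
Proof.
rewrite invr_gt0 !mulr_gt0 ?exprn_gt0//.
by rewrite addr_gt0// (lt_le_trans ltr01)// lyapunov_level_ge1.
Qed.

(** The source is rewritten with the weight [gamma / 2 * h], which [drift_constant <= gamma / 2 *
    lyapunov_level] allows. The step is then a convex combination, so it preserves levels and its
    powers can be taken by [convex_expr]. *)
Lemma lyapunov_stepn b n : 1 <= b -> zsize (zs n) <= b ->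
  h * b ^+ (2 * (q * q.+1)) <= level_threshold ->
  enorm (D n) ^+ 2 <= lyapunov_level * b ^+ (2 * q.+1) ->
  enorm (D n.+1) ^+ 2 <= (1 - gamma / 2 * h) * enorm (D n) ^+ 2 +
    gamma / 2 * h * (lyapunov_level * zsize (zs n) ^+ (2 * q.+1)).
Proof.
move=> b1 zb hb Vb; have A1 := lyapunov_level_ge1; set A := lyapunov_level in A1 Vb *.
have b0 : 0 <= b by exact: le_trans b1.
have A0 : 0 <= A by exact: le_trans A1.
have Dn : enorm (D n) <= A * b ^+ q.+1.
  rewrite -(@ler_pXn2r _ 2)// ?nnegrE ?enorm_ge0 ?mulr_ge0 ?exprn_ge0//.
  apply: le_trans Vb _; rewrite exprMn -exprM mulnC ler_wpM2r ?exprn_ge0//.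
  by rewrite expr2 ler_peMr.
have bq : b <= b ^+ q.+1 by rewrite exprS ler_peMr// exprn_ege1.
have xn : enorm (D n + zs n) <= (A + 1) * b ^+ q.+1.
  apply: le_trans (enormD _ _) _; rewrite mulrDl mul1r lerD//.
  by apply: le_trans bq; apply: le_trans zb; exact: enorm_le_zsize.
have fn : enorm (f (D n + zs n)) <= 2 * M * (A + 1) ^+ q * b ^+ (q * q.+1).
  apply: le_trans (f_growth _) _.
  have e1 : enorm (D n + zs n) ^+ q <= (A + 1) ^+ q * b ^+ (q * q.+1).
    rewrite mulnC exprM -exprMn lerXn2r ?nnegrE ?enorm_ge0//.
    by rewrite mulr_ge0 ?exprn_ge0// addr_ge0.
  have e2 : 1 <= (A + 1) ^+ q * b ^+ (q * q.+1).
    by rewrite mulr_ege1// exprn_ege1// lerDr.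
  by rewrite [2 * M]mulrC -!mulrA ler_wpM2l ?(ltW M0)//; lra.
have hf : h * enorm (f (D n + zs n)) ^+ 2 <= 1.
  apply: (@le_trans _ _ (h * (2 * M * (A + 1) ^+ q * b ^+ (q * q.+1)) ^+ 2)).
    rewrite ler_wpM2l ?(ltW h0)// lerXn2r ?nnegrE ?enorm_ge0//.
    by nonneg.
  have -> : h * (2 * M * (A + 1) ^+ q * b ^+ (q * q.+1)) ^+ 2 =
      level_threshold^-1 * (h * b ^+ (2 * (q * q.+1))).
    rewrite /level_threshold invrK -/A ![(2 * _)%N]mulnC 2!(exprM _ _ 2).
    by set B := b ^+ _; set A' := (A + 1) ^+ _; ring.
  by rewrite ler_pdivrMl ?level_threshold_gt0// mulr1.
rewrite DS; apply: le_trans (lyapunov_step h0 h1 ah hf) _.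
have dcA : drift_constant <= gamma / 2 * A.
  rewrite -ler_pdivrMl ?divr_gt0// mulrC.
  by rewrite /A /lyapunov_level lerDr addr_ge0// sqr_ge0.
set Z := zsize (zs n) ^+ _; have Z0 : 0 <= Z by rewrite /Z; nonneg; exact: zsize_ge0.
rewrite lerD2l (_ : gamma / 2 * h * (A * Z) = h * (gamma / 2 * A * Z)); last ring.
by rewrite ler_wpM2l ?(ltW h0)// ler_wpM2r.
Qed.

(** The recursion of [lyapunov_stepn] raised to the power [p] term by term. It is affine in powers
    of the noise sizes, so its mean can be followed step by step from the moments of the
    Ornstein-Uhlenbeck chain. *)
Fixpoint lyapunov_majorant (p n : nat) : R :=
  if n is m.+1 then (1 - gamma / 2 * h) * lyapunov_majorant p m +
    gamma / 2 * h * (lyapunov_level * zsize (zs m) ^+ (2 * q.+1)) ^+ p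
  else (enorm x0 ^+ 2) ^+ p.

Lemma lyapunov_majorant_ge0 p n : 0 <= lyapunov_majorant p n.
Proof.
have A0 : 0 <= lyapunov_level by rewrite (le_trans ler01)// lyapunov_level_ge1.
elim: n => [|n ih] /=; first by rewrite exprn_ge0// sqr_ge0.
rewrite addr_ge0// mulr_ge0 ?subr_ge0//; first by rewrite mulr_ge0 ?divr_ge0 ?ltW.
by rewrite exprn_ge0// mulr_ge0// exprn_ge0// zsize_ge0.
Qed.

Lemma lyapunov_good b n p : 1 <= b ->
  (forall j, (j <= n)%N -> zsize (zs j) <= b) ->
  h * b ^+ (2 * (q * q.+1)) <= level_threshold ->
  (enorm (D n) ^+ 2) ^+ p <= lyapunov_majorant p n.
Proof.
move=> b1 zb hb; have A1 := lyapunov_level_ge1.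
have b0 : 0 <= b by exact: le_trans b1.
have A0 : 0 <= lyapunov_level by exact: le_trans A1.
have c0 : 0 <= gamma / 2 * h by rewrite mulr_ge0 ?divr_ge0// ltW.
(* This level keeps the taming inactive at the next step, so it is propagated before the comparison
   of [p]-th powers. *)
have level j : (j <= n)%N -> enorm (D j) ^+ 2 <= lyapunov_level * b ^+ (2 * q.+1).
  elim: j => [_|j ih jn].
    rewrite /D xs0 zs0 subr0 -[leLHS]mulr1 ler_pM ?sqr_ge0// ?exprn_ege1//.
    rewrite /lyapunov_level addrAC lerDr addr_ge0//.
    by rewrite divr_ge0 ?drift_constant_ge0// divr_ge0// ltW.
  have jn' : (j <= n)%N by exact: ltnW.
  apply: le_trans (lyapunov_stepn b1 (zb _ jn') hb (ih jn')) _.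
  set X := lyapunov_level * b ^+ (2 * q.+1).
  have -> : X = (1 - gamma / 2 * h) * X + gamma / 2 * h * X.
    by rewrite -mulrDl subrK mul1r.
  rewrite lerD// ler_wpM2l ?subr_ge0//; first exact: ih.
  rewrite ler_wpM2l// lerXn2r ?nnegrE// ?zsize_ge0//.
  exact: zb.
suff main j : (j <= n)%N -> (enorm (D j) ^+ 2) ^+ p <= lyapunov_majorant p j by exact: main.
elim: j => [_|j ih jn] /=; first by rewrite /D xs0 zs0 subr0.
have jn' : (j <= n)%N by exact: ltnW.
have st := lyapunov_stepn b1 (zb _ jn') hb (level _ jn').
have w0 : 0 <= lyapunov_level * zsize (zs j) ^+ (2 * q.+1).
  by rewrite mulr_ge0// exprn_ge0// zsize_ge0.
apply: (@le_trans _ _ (((1 - gamma / 2 * h) * enorm (D j) ^+ 2 +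
    gamma / 2 * h * (lyapunov_level * zsize (zs j) ^+ (2 * q.+1))) ^+ p)).
  rewrite lerXn2r ?nnegrE ?sqr_ge0//.
  by apply: addr_ge0; apply: mulr_ge0; rewrite ?subr_ge0 ?sqr_ge0.
apply: le_trans (convex_expr _ _ _ _) _; rewrite ?c0 ?gh ?sqr_ge0//.
by rewrite lerD2r ler_wpM2l ?subr_ge0// ih.
Qed.

Definition crude_constant : R := enorm x0 + alpha^-1 + 1.

(** Each step adds at most [alpha^-1] for the drift and [enorm (zs n)] for the linear correction,
    whatever the state. *)
Lemma crude_bound n :
  enorm (xs n) <= crude_constant * \sum_(j < n.+1) zsize (zs j).
Proof.
have ai : 0 < alpha^-1 by rewrite invr_gt0.
have Dn : enorm (D n) <= enorm x0 + (alpha^-1 + 1) * \sum_(j < n) zsize (zs j).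
  elim: n => [|n ih]; first by rewrite /D xs0 zs0 subr0 big_ord0 mulr0 addr0.
  rewrite DS big_ord_recr /= mulrDr addrA.
  have tri := le_trans (enormD _ _) (lerD (enormD (D n) (h *: tamed h (D n + zs n)))
    (lexx (enorm (h *: zs n)))).
  rewrite (enormZ h (tamed h _)) (enormZ h (zs n)) (ger0_norm (ltW h0)) in tri.
  apply: le_trans tri _; move: ih; set S := \sum_(j < n) _ => ih.
  have z1 := zsize_ge1 (zs n).
  have t := tamed_bounded (D n + zs n) h0.
  have z0 := enorm_ge0 (zs n).
  have : h * enorm (zs n) <= zsize (zs n).
    by rewrite (le_trans _ (enorm_le_zsize _))// ler_piMl.
  have : alpha^-1 <= alpha^-1 * zsize (zs n) by rewrite ler_peMr// ltW.
  lra.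
have -> : xs n = D n + zs n by rewrite subrK.
apply: le_trans (enormD _ _) _; rewrite big_ord_recr /=.
set S := \sum_(j < n) _ in Dn *.
have S0 : 0 <= S by apply: sumr_ge0 => j _; exact: zsize_ge0.
have z1 := zsize_ge1 (zs n); have x00 := enorm_ge0 x0.
have zz := enorm_le_zsize (zs n).
rewrite /crude_constant; nra.
Qed.

(* Either all the [z_j] stay below the level at which the taming becomes active,
   and the Lyapunov bound applies, or some [z_j] is so large that
   [1 <= (h z_j ^ k / threshold) ^ L], which pays for the crude bound. *)
Lemma moment_path n p L :
  enorm (xs n) ^+ (2 * p) <=
    4 ^+ p * (lyapunov_majorant p n + zsize (zs n) ^+ (2 * p)) +
    (crude_constant * n.+1%:R) ^+ (2 * p) * (h / level_threshold) ^+ L *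
      \sum_(j < n.+1) zsize (zs j) ^+ (2 * p + 2 * (q * q.+1) * L).
Proof.
have zp j k : 0 <= zsize (zs j) ^+ k.
  by rewrite exprn_ge0// zsize_ge0.
have [j jn jmax] := argmax_initial (fun j => zsize (zs j)) n.
set b := zsize (zs j) in jmax *; have b1 : 1 <= b by exact: zsize_ge1.
have b0 : 0 <= b by exact: le_trans b1.
have cc0 : 0 <= crude_constant by rewrite !addr_ge0 ?enorm_ge0// invr_ge0 ltW.
have th0 := level_threshold_gt0.
have ht0 : 0 <= h / level_threshold by rewrite divr_ge0// ltW.
have M1 := lyapunov_majorant_ge0 p n.
have [good|/ltW bad] := leP (h * b ^+ (2 * (q * q.+1))) level_threshold.
  rewrite -[leLHS]addr0 lerD//; last first.
    by nonneg; exact: zsize_ge0.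
  have G := lyapunov_good p b1 jmax good.
  have -> : xs n = D n + zs n by rewrite subrK.
  rewrite exprM (_ : 4 ^+ p = 2 ^+ p * 2 ^+ p); last by rewrite -exprMn; congr (_ ^+ _); ring.
  apply: (@le_trans _ _ ((2 * (enorm (D n) ^+ 2 + enorm (zs n) ^+ 2)) ^+ p)).
    rewrite lerXn2r ?nnegrE ?sqr_ge0 ?enorm_sqrD_le//.
    by rewrite mulr_ge0// addr_ge0 ?sqr_ge0.
  rewrite exprMn -mulrA ler_wpM2l ?exprn_ge0//.
  apply: le_trans (expr_sum_le _ _ _) _; rewrite ?sqr_ge0//.
  rewrite ler_wpM2l ?exprn_ge0// lerD// exprM lerXn2r ?nnegrE ?sqr_ge0//.
  by rewrite lerXn2r ?nnegrE ?enorm_ge0 ?zsize_ge0// enorm_le_zsize.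
rewrite -[leLHS]add0r lerD//.
  by nonneg; exact: zsize_ge0.
have sumb : \sum_(i < n.+1) zsize (zs i) <= n.+1%:R * b.
  have -> : n.+1%:R * b = \sum_(i < n.+1) b by rewrite sumr_const card_ord mulr_natl.
  by apply: ler_sum => i _; apply: jmax; rewrite -ltnS.
apply: (@le_trans _ _ ((crude_constant * n.+1%:R) ^+ (2 * p) * b ^+ (2 * p))).
  rewrite -exprMn lerXn2r ?nnegrE ?enorm_ge0 ?mulr_ge0//.
  by apply: le_trans (crude_bound n) _; rewrite -mulrA ler_wpM2l.
rewrite -mulrA ler_wpM2l ?exprn_ge0 ?mulr_ge0//.
apply: (@le_trans _ _ ((h / level_threshold) ^+ L * b ^+ (2 * p + 2 * (q * q.+1) * L))).
  rewrite exprD mulrCA ler_peMr ?exprn_ge0// exprM -exprMn exprn_ege1//.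
  by rewrite mulrAC ler_pdivlMr// mul1r.
rewrite ler_wpM2l ?exprn_ge0//.
have jn' : (j < n.+1)%N by [].
rewrite (bigD1 (Ordinal jn'))//= lerDl; apply: sumr_ge0 => i _; exact: zp.
Qed.

End TamedPath.

Lemma expr_one_sum_le {R : realType} {I : Type} (s : seq I) (p : nat) :
  exists2 C : R, 0 <= C & forall a : I -> R, (forall i, 0 <= a i) ->
    (1 + \sum_(i <- s) a i) ^+ p <= C * (1 + \sum_(i <- s) a i ^+ p).
Proof.
elim: s => [|i s [C C0 ih]].
  by exists 1 => // a _; rewrite !big_nil addr0 expr1n mulr1.
exists (2 ^+ p * (1 + C)) => [|a a0]; first by nonneg.
rewrite !big_cons addrCA; set S := \sum_(j <- s) a j; set S' := \sum_(j <- s) _ ^+ p.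
have S0 : 0 <= S by nonneg.
have S'0 : 0 <= S' by apply: sumr_ge0 => j _; rewrite exprn_ge0.
have ai0 : 0 <= a i ^+ p by rewrite exprn_ge0.
apply: le_trans (expr_sum_le p (a0 i) (addr_ge0 ler01 S0)) _.
rewrite -mulrA ler_wpM2l ?exprn_ge0//.
have := ih a a0; rewrite -/S -/S' => h.
have : 0 <= C * a i ^+ p by exact: mulr_ge0.
lra.
Qed.

Lemma expr_add_le3 {R : realDomainType} (a b c : R) (p : nat) :
  0 <= a -> 0 <= b -> 0 <= c ->
  (a + b + c) ^+ p <= 4 ^+ p * (a ^+ p + b ^+ p + c ^+ p).
Proof.
move=> a0 b0 c0; apply: le_trans (expr_sum_le p (addr_ge0 a0 b0) c0) _.
have -> : (4 : R) ^+ p = 2 ^+ p * 2 ^+ p by rewrite -exprMn; congr (_ ^+ _); ring.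
rewrite -mulrA ler_wpM2l ?exprn_ge0// mulrDr lerD ?expr_sum_le//.
by rewrite ler_peMl ?exprn_ge0// exprn_ege1// ler1n.
Qed.

(** * Moments of the scheme, uniform as long as n h^2 <= 1 *)

Section SchemeMoments.
Context {disp : measure_display} {T : measurableType disp} {R : realType}.
Context {P : probability T R} (F : R -> set (set T)) (hF : usual_conditions P F).
Context {d K : nat} (beta : 'I_K -> R -> T -> R)
  (hbeta : independent_wiener_processes P F beta).
Context (sigma : 'I_K -> 'rV[R]_d).

Definition vadapted t (v : T -> 'rV[R]_d) :=
  forall i, adapted F t (fun w => v w ord0 i).

Definition noise s t w : 'rV[R]_d := \sum_(k < K) increment beta k s t w *: sigma k.

Definition ou_vector h n w : 'rV[R]_d := \sum_(k < K) ou beta h k n w *: sigma k.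

Lemma vadapted_le s t v : 0 <= s -> s <= t -> vadapted s v -> vadapted t v.
Proof. by move=> s0 st av i; apply: (adapted_le hF s0 st); exact: av. Qed.

Lemma vadapted_measurable t v : 0 <= t -> vadapted t v ->
  forall i, measurable_fun [set: T] (fun w => v w ord0 i).
Proof. by move=> t0 av i; apply: (adapted_measurable hF t0); exact: av. Qed.

Lemma vadaptedD t u v : vadapted t u -> vadapted t v ->
  vadapted t (fun w => u w + v w).
Proof.
move=> au av i; rewrite /adapted; under eq_fun do rewrite mxE.
by apply: measurable_funD; [exact: au|exact: av].
Qed.

Lemma vadaptedZ t a v : adapted F t a -> vadapted t v ->
  vadapted t (fun w => a w *: v w).
Proof.
move=> aa av i; rewrite /adapted; under eq_fun do rewrite mxE.
by apply: measurable_funM => //; exact: av.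
Qed.

Lemma vadapted_cst t v : vadapted t (fun=> v).
Proof. by move=> i; exact: measurable_cst. Qed.

Lemma vadapted_sum t (v : 'I_K -> T -> 'rV[R]_d) :
  (forall k, vadapted t (v k)) -> vadapted t (fun w => \sum_(k < K) v k w).
Proof.
move=> av i; rewrite /adapted; under eq_fun do rewrite summxE.
by apply: measurable_sum => k; exact: av.
Qed.

Lemma vadaptedB t u v : vadapted t u -> vadapted t v ->
  vadapted t (fun w => u w - v w).
Proof.
move=> au av; apply: vadaptedD => // i; rewrite /adapted.
under eq_fun do rewrite mxE.
by apply: measurableT_comp => //; exact: av.
Qed.

Lemma adapted_inner t u v : vadapted t u -> vadapted t v ->
  adapted F t (fun w => inner (u w) (v w)).
Proof.
move=> au av; apply: measurable_sum => i.
by apply: measurable_funM; [exact: au|exact: av].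
Qed.

Lemma adapted_enorm t v : vadapted t v -> adapted F t (fun w => enorm (v w)).
Proof.
move=> av; apply: measurable_continuous_comp av _; exact: continuous_enorm.
Qed.

Lemma vadapted_comp t (g : 'rV[R]_d -> 'rV[R]_d) v : continuous g ->
  vadapted t v -> vadapted t (fun w => g (v w)).
Proof. by move=> cg av; apply: measurable_continuous_coord. Qed.

Lemma vadapted_noise s s' t : 0 <= s -> s <= s' -> s' <= t -> vadapted t (noise s s').
Proof.
move=> s0 ss' s't; apply: vadapted_sum => k; apply: vadaptedZ; last exact: vadapted_cst.
exact: (adapted_increment hF hbeta).
Qed.

Lemma vadapted_ou h n : 0 < h -> vadapted (n%:R * h) (ou_vector h n).
Proof.
move=> h0; apply: vadapted_sum => k; apply: vadaptedZ; last exact: vadapted_cst.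
exact: (adapted_ou hF hbeta).
Qed.

Lemma ou_vectorS h n w : ou_vector h n.+1 w - (1 - h) *: ou_vector h n w =
  noise (n%:R * h) (n.+1%:R * h) w.
Proof.
rewrite /ou_vector scaler_sumr -sumrB; apply: eq_bigr => k _.
by rewrite scalerA -scalerBl /=; congr (_ *: _); ring.
Qed.

Lemma enorm_noise_le s t w : enorm (noise s t w) <=
  \sum_(k < K) enorm (sigma k) * `|increment beta k s t w|.
Proof.
by apply: le_trans (enorm_sum _ _ _) _; apply: ler_sum => k _; rewrite enormZ mulrC.
Qed.

Lemma noise_all_moments s t : 0 <= s -> s < t ->
  all_moments P (fun w => enorm (noise s t w)).
Proof.
move=> s0 st.
have am : all_moments P (fun w => \sum_(k < K) enorm (sigma k) * `|increment beta k s t w|).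
  apply: all_moments_sum => k; apply: all_momentsZ; apply: all_moments_norm.
  by apply: subgaussian_all_moments (increment_subgaussian hF hbeta k s0 st); rewrite subr_gt0.
apply: le_all_moments am => [|w].
  apply: (adapted_measurable hF (le_trans s0 (ltW st))).
  apply: adapted_enorm; apply: vadapted_noise => //; exact: ltW.
rewrite ger0_norm ?enorm_ge0//; apply: le_trans (enorm_noise_le _ _ _) (ler_norm _).
Qed.

(** The factor [sqrt (t - s)] is taken out before the sum is expanded, so that the constant of
    [expr_one_sum_le] depends on neither [s] nor [t]. *)
Lemma noise_moment p : exists2 C : R, 0 <= C & forall s t, 0 <= s -> s < t ->
  \int[P]_w (enorm (noise s t w) ^+ p) <= C * Num.sqrt (t - s) ^+ p.
Proof.
have [C C0 CP] := @expr_one_sum_le R 'I_K (index_enum 'I_K) p.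
pose B := \sum_(k < K) enorm (sigma k) ^+ p * moment_constant p : R.
have mc := @moment_constant_ge0 R p.
have B0 : 0 <= B by rewrite /B; nonneg.
exists (C * (1 + B)) => [|s t s0 st]; first by nonneg.
have ts : 0 < t - s by rewrite subr_gt0.
set e := Num.sqrt (t - s); have e0 : 0 < e by rewrite sqrtr_gt0.
have am k : all_moments P (fun w => `|increment beta k s t w| ^+ p).
  apply: all_momentsX; apply: all_moments_norm.
  exact: subgaussian_all_moments (increment_subgaussian hF hbeta k s0 st).
have amS k : all_moments P (fun w => enorm (sigma k) ^+ p * `|increment beta k s t w| ^+ p).
  exact: all_momentsZ.
have path w : enorm (noise s t w) ^+ p <= C * (e ^+ p +
    \sum_(k < K) enorm (sigma k) ^+ p * `|increment beta k s t w| ^+ p).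
  apply: (@le_trans _ _ ((e * (1 + \sum_(k < K) (enorm
    (sigma k) * `|increment beta k s t w|) / e)) ^+ p)).
    rewrite lerXn2r ?nnegrE ?enorm_ge0//; first by nonneg.
    apply: le_trans (enorm_noise_le _ _ _) _.
    by rewrite -mulr_suml mulrDr mulrCA divff ?gt_eqF// !mulr1 lerDr ltW.
  rewrite exprMn; apply: (@le_trans _ _ (e ^+ p * (C * (1 + \sum_(k < K)
      ((enorm (sigma k) * `|increment beta k s t w|) / e) ^+ p)))).
    by rewrite ler_wpM2l ?exprn_ge0 ?(ltW e0)// CP// => k; nonneg.
  rewrite mulrCA ler_wpM2l// mulrDr mulr1 lerD2l mulr_sumr; apply: ler_sum => k _.
  by rewrite -exprMn -[leRHS]exprMn mulrCA divff ?gt_eqF// mulr1.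
have amR : all_moments P (fun w => C * (e ^+ p +
    \sum_(k < K) enorm (sigma k) ^+ p * `|increment beta k s t w| ^+ p)).
  by apply: all_momentsZ; apply: all_momentsD; [exact: all_moments_cst|exact: all_moments_sum].
have := mean_le (all_momentsX p (noise_all_moments s0 st)) amR path.
rewrite meanZ; last by apply: all_momentsD; [exact: all_moments_cst|exact: all_moments_sum].
rewrite meanD ?mean_cst; [|exact: all_moments_cst|exact: all_moments_sum].
rewrite mean_sum// => /le_trans; apply; rewrite -mulrA ler_wpM2l// mulrDl mul1r lerD2l.
rewrite /B mulr_suml; apply: ler_sum => k _.
rewrite meanZ// -mulrA ler_wpM2l ?exprn_ge0 ?enorm_ge0//.
exact: subgaussian_moment ts (increment_subgaussian hF hbeta k s0 st).
Qed.

Lemma zsize_ou_all_moments h n : 0 < h -> h <= 1 ->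
  all_moments P (fun w => zsize (ou_vector h n w)).
Proof.
move=> h0 h1.
have am : all_moments P (fun w => 1 + \sum_(k < K) enorm (sigma k) * `|ou beta h k n w|).
  apply: all_momentsD; first exact: all_moments_cst.
  apply: all_moments_sum => k; apply: all_momentsZ; apply: all_moments_norm.
  exact: subgaussian_all_moments ltr01 (ou_subgaussian hF hbeta k n h0 h1).
apply: le_all_moments am => [|w].
  apply: measurable_funD => //.
  apply: (@adapted_measurable _ _ _ _ _ hF (n%:R * h)); first by rewrite mulr_ge0// ltW.
  by apply: adapted_enorm; exact: vadapted_ou.
rewrite ger0_norm ?zsize_ge0// (le_trans _ (ler_norm _))// lerD2l.
by apply: le_trans (enorm_sum _ _ _) _; apply: ler_sum => k _; rewrite enormZ mulrC.
Qed.

(** Uniform in [h] and [n] because the chain has the variance bound 1 at all times. *)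
Lemma zsize_ou_moment p : exists2 C : R, 0 <= C & forall h n, 0 < h -> h <= 1 ->
  \int[P]_w (zsize (ou_vector h n w) ^+ p) <= C.
Proof.
have [C C0 CP] := @expr_one_sum_le R 'I_K (index_enum 'I_K) p.
pose B := \sum_(k < K) enorm (sigma k) ^+ p * moment_constant p : R.
have mc := @moment_constant_ge0 R p.
have B0 : 0 <= B by rewrite /B; nonneg.
exists (C * (1 + B)) => [|h n h0 h1]; first by nonneg.
have am k : all_moments P (fun w => `|ou beta h k n w| ^+ p).
  apply: all_momentsX; apply: all_moments_norm.
  exact: subgaussian_all_moments ltr01 (ou_subgaussian hF hbeta k n h0 h1).
have amS k : all_moments P (fun w => enorm (sigma k) ^+ p * `|ou beta h k n w| ^+ p).
  exact: all_momentsZ.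
have path w : zsize (ou_vector h n w) ^+ p <= C * (1 +
    \sum_(k < K) enorm (sigma k) ^+ p * `|ou beta h k n w| ^+ p).
  apply: (@le_trans _ _ ((1 + \sum_(k < K) enorm (sigma k) * `|ou beta h k n w|) ^+ p)).
    rewrite lerXn2r ?nnegrE ?zsize_ge0//; first by nonneg.
    rewrite lerD2l; apply: le_trans (enorm_sum _ _ _) _.
    by apply: ler_sum => k _; rewrite enormZ mulrC.
  apply: le_trans (CP _ _) _ => [k|]; first by nonneg.
  by under eq_bigr do rewrite exprMn.
have amR : all_moments P (fun w => C * (1 +
    \sum_(k < K) enorm (sigma k) ^+ p * `|ou beta h k n w| ^+ p)).
  by apply: all_momentsZ; apply: all_momentsD; [exact: all_moments_cst|exact: all_moments_sum].
have := mean_le (all_momentsX p (zsize_ou_all_moments n h0 h1)) amR path.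
rewrite meanZ; last by apply: all_momentsD; [exact: all_moments_cst|exact: all_moments_sum].
rewrite meanD ?mean_cst; [|exact: all_moments_cst|exact: all_moments_sum].
rewrite mean_sum// => /le_trans; apply; rewrite ler_wpM2l// lerD2l.
apply: ler_sum => k _; rewrite meanZ// ler_wpM2l ?exprn_ge0 ?enorm_ge0//.
have := subgaussian_moment p ltr01 (ou_subgaussian hF hbeta k n h0 h1).
by rewrite sqrtr1 expr1n mulr1.
Qed.

Context (f : 'rV[R]_d -> 'rV[R]_d) (alpha gamma M : R) (q : nat).
Context (alpha0 : 0 < alpha) (gamma0 : 0 < gamma) (M0 : 0 < M).
Context (f_growth : forall x, enorm (f x) <= M * (1 + enorm x ^+ q)).
Context (f_diss : forall x y,
  inner (f x - f y) (x - y) <= - gamma * enorm (x - y) ^+ 2).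
Context (f_cont : continuous f) (x0 : 'rV[R]_d).

(** [h <= 1] serves the Ornstein-Uhlenbeck chain, the third condition keeps the taming factor above
    one half, and the last one keeps the coefficient of the Lyapunov recursion nonnegative. *)
Definition small_step h :=
  [/\ 0 < h, h <= 1, alpha ^+ 2 * h <= 1 & gamma / 2 * h <= 1].

Local Notation euler h := (tamed_euler f sigma beta alpha h x0).

Lemma eulerS h n w : euler h n.+1 w = euler h n w + h *: tamed f alpha h (euler h n w) +
  noise (n%:R * h) (n.+1%:R * h) w.
Proof. by rewrite /= /tamed scalerA. Qed.

Lemma tamed_continuous h : 0 <= h -> continuous (tamed f alpha h).
Proof.
move=> h0 x.
have cden : {for x, continuous (fun y => 1 + alpha * h * enorm (f y))}.
  have cf := continuous_comp (@f_cont x) (@continuous_enorm R d (f x)).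
  exact: (cvgD (cvg_cst _) (cvgM (cvg_cst _) cf)).
have dn0 : 1 + alpha * h * enorm (f x) != 0.
  by rewrite gt_eqF// (lt_le_trans ltr01)// tamed_factor.
have cinv : {for x, continuous (fun y => (1 + alpha * h * enorm (f y))^-1)}.
  by apply: continuousV.
exact: (cvgZ cinv (@f_cont x)).
Qed.

Lemma vadapted_euler h n : 0 < h -> vadapted (n%:R * h) (euler h n).
Proof.
move=> h0; elim: n => [|n ih]; first exact: vadapted_cst.
have n0 : 0 <= n%:R * h by rewrite mulr_ge0// ltW.
have nn : n%:R * h <= n.+1%:R * h by rewrite ler_wpM2r ?ler_nat// ltW.
have ih' := vadapted_le n0 nn ih.
rewrite (_ : euler h n.+1 = fun w => euler h n w + h *: tamed f alpha h (euler h n w) +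
  noise (n%:R * h) (n.+1%:R * h) w); last by apply/funext => w; exact: eulerS.
apply: vadaptedD; last exact: vadapted_noise.
apply: vadaptedD => //; apply: vadaptedZ; first exact: measurable_cst.
by apply: vadapted_comp ih'; apply: tamed_continuous; exact: ltW.
Qed.

Lemma euler_ou_recursion h w n : euler h n.+1 w = euler h n w +
  h *: tamed f alpha h (euler h n w) +
  (ou_vector h n.+1 w - (1 - h) *: ou_vector h n w).
Proof. by rewrite ou_vectorS eulerS. Qed.

Lemma ou_vector0 h w : ou_vector h 0 w = 0.
Proof. by rewrite /ou_vector big1// => k _; rewrite scale0r. Qed.

(** Finiteness only, from the crude bound, which grows with [n]; it makes the means meaningful
    before they are estimated uniformly. *)
Lemma euler_all_moments h n : 0 < h -> h <= 1 ->
  all_moments P (fun w => enorm (euler h n w)).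
Proof.
move=> h0 h1.
have am : all_moments P (fun w => crude_constant alpha x0 *
    \sum_(j < n.+1) zsize (ou_vector h j w)).
  apply: all_momentsZ; apply: all_moments_sum => j; exact: zsize_ou_all_moments.
apply: le_all_moments am => [|w].
  apply: (@adapted_measurable _ _ _ _ _ hF (n%:R * h)); first by rewrite mulr_ge0// ltW.
  by apply: adapted_enorm; exact: vadapted_euler.
rewrite ger0_norm ?enorm_ge0// (le_trans _ (ler_norm _))//.
exact: (crude_bound alpha0 h0 h1 erefl (ou_vector0 h w) (euler_ou_recursion h w)).
Qed.

Lemma euler_even_moment p : exists2 C : R, 0 <= C & forall h n, small_step h ->
  n%:R * h ^+ 2 <= 1 -> \int[P]_w (enorm (euler h n w) ^+ (2 * p)) <= C.
Proof.
(* The crude term carries [(n+1) ^ (2 p)] from the power of the crude bound and one more factor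
   [n+1] from the number of summands. This exponent supplies exactly one [h^2] for each of these
   [2 p + 1] factors. *)
pose L := (2 * (2 * p).+1)%N.
have [Cu Cu0 HCu] := zsize_ou_moment (2 * q.+1 * p).
have [Cz Cz0 HCz] := zsize_ou_moment (2 * p).
have [Cb Cb0 HCb] := zsize_ou_moment (2 * p + 2 * (q * q.+1) * L).
pose A := lyapunov_level gamma M x0.
have A0 : 0 <= A by rewrite (le_trans ler01)// lyapunov_level_ge1.
pose th := level_threshold gamma M q x0.
have th0 : 0 < th by exact: level_threshold_gt0.
(* An upper bound for both the initial value and the mean of the source, hence preserved by the
   convex recursion of the majorant. *)
pose U := (enorm x0 ^+ 2) ^+ p + A ^+ p * Cu.
pose cc := crude_constant alpha x0.
have cc0 : 0 <= cc by rewrite /cc /crude_constant; nonneg.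
have U0 : 0 <= U by rewrite /U; nonneg.
exists (4 ^+ p * (U + Cz) + cc ^+ (2 * p) / th ^+ L * 2 ^+ (2 * p).+1 * Cb) => [|h n].
  by nonneg.
move=> [h0 h1 ah gh] nh.
have g01 : 0 <= gamma / 2 * h by rewrite mulr_ge0 ?divr_ge0// ltW.
pose lm w n := lyapunov_majorant gamma M q h x0 (fun n => ou_vector h n w) p n.
have amz k j : all_moments P (fun w => zsize (ou_vector h j w) ^+ k).
  by apply: all_momentsX; exact: zsize_ou_all_moments.
have ezA j w : (A * zsize (ou_vector h j w) ^+ (2 * q.+1)) ^+ p =
    A ^+ p * zsize (ou_vector h j w) ^+ (2 * q.+1 * p) by rewrite exprMn -exprM.
have amu j : all_moments P (fun w => lm w j).
  elim: j => [|j ih]; first exact: all_moments_cst.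
  rewrite /lm /= -/A; apply: all_momentsD; first exact: all_momentsZ ih.
  under eq_fun do rewrite ezA; apply: all_momentsZ; exact: all_momentsZ.
have mu j : \int[P]_w lm w j <= U.
  elim: j => [|j ih].
    by rewrite mean_cst /U lerDl; nonneg.
  rewrite /lm /= -/A; under eq_Rintegral do rewrite ezA.
  rewrite meanD; [|exact: all_momentsZ (amu j)|by apply: all_momentsZ; exact: all_momentsZ].
  rewrite (meanZ _ (amu j)) (meanZ _ (all_momentsZ (A ^+ p) (amz _ j))) (meanZ _ (amz _ j)).
  have -> : U = (1 - gamma / 2 * h) * U + gamma / 2 * h * U by ring.
  rewrite lerD// ler_wpM2l ?subr_ge0//.
  apply: le_trans (_ : A ^+ p * Cu <= _); last by rewrite /U lerDr; nonneg.
  by rewrite ler_wpM2l ?exprn_ge0// HCu.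
set cn := (cc * n.+1%:R) ^+ (2 * p) * (h / th) ^+ L.
set kz := (2 * p + 2 * (q * q.+1) * L)%N in HCb.
have path w : enorm (euler h n w) ^+ (2 * p) <=
    4 ^+ p * (lm w n + zsize (ou_vector h n w) ^+ (2 * p)) +
    cn * \sum_(j < n.+1) zsize (ou_vector h j w) ^+ kz.
  exact: (moment_path alpha0 gamma0 M0 f_growth f_diss h0 h1 ah gh
    erefl (ou_vector0 h w) (euler_ou_recursion h w) n p L).
have am1 : all_moments P (fun w => lm w n + zsize (ou_vector h n w) ^+ (2 * p)).
  by apply: all_momentsD; [exact: amu|exact: amz].
have am2 : all_moments P (fun w => \sum_(j < n.+1) zsize (ou_vector h j w) ^+ kz).
  by apply: all_moments_sum => j; exact: amz.
have amr := all_momentsD (all_momentsZ (4 ^+ p) am1) (all_momentsZ cn am2).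
apply: le_trans (mean_le (all_momentsX (2 * p) (euler_all_moments n h0 h1)) amr path) _.
rewrite (meanD (all_momentsZ (4 ^+ p) am1) (all_momentsZ cn am2)) (meanZ _ am1) (meanZ _ am2).
rewrite (meanD (amu n) (amz _ n)) mean_sum; last by move=> j; exact: amz.
rewrite lerD//.
  by rewrite ler_wpM2l ?exprn_ge0// lerD ?HCz//; exact: mu.
have n0 : 0 <= n%:R :> R by [].
set S := \sum_(j < n.+1) _; have SE : S <= n.+1%:R * Cb.
  have -> : n.+1%:R * Cb = \sum_(j < n.+1) Cb by rewrite sumr_const card_ord mulr_natl.
  by apply: ler_sum => j _; exact: HCb.
apply: (@le_trans _ _ (cn * (n.+1%:R * Cb))).
  by rewrite ler_wpM2l// /cn; nonneg.
have -> : cn * (n.+1%:R * Cb) =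
    cc ^+ (2 * p) / th ^+ L * (n.+1%:R * h ^+ 2) ^+ (2 * p).+1 * Cb.
  rewrite /cn !exprMn exprVn [h ^+ L]exprM [n.+1%:R ^+ (2 * p).+1]exprS.
  set u := cc ^+ _; set v := (h ^+ 2) ^+ _; set x := _ ^+ (2 * p); set y := (th ^+ L)^-1.
  by rewrite -[h ^+ _ * h ^+ _]exprMn -expr2 -/v; ring.
apply: ler_wpM2r => //; apply: ler_wpM2l; first by nonneg.
rewrite lerXn2r ?nnegrE//; first by nonneg.
rewrite -natr1 mulrDl mul1r; have : h ^+ 2 <= 1 by rewrite expr_le1// ltW.
lra.
Qed.

Lemma euler_moment p : exists2 C : R, 0 <= C & forall h n, small_step h ->
  n%:R * h ^+ 2 <= 1 -> \int[P]_w (enorm (euler h n w) ^+ p) <= C.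
Proof.
have [C C0 HC] := euler_even_moment p.
exists (1 + C) => [|h n sh nh]; first by nonneg.
have am := euler_all_moments n; case: (sh) => h0 h1 _ _.
rewrite -(mean_cst P 1); apply: le_trans (lerD (lexx _) (HC h n sh nh)).
rewrite -meanD; [|exact: all_moments_cst|by apply: all_momentsX; exact: am].
apply: mean_le => [||w]; first by apply: all_momentsX; exact: am.
  by apply: all_momentsD; [exact: all_moments_cst|apply: all_momentsX; exact: am].
rewrite mulnC exprM; set a := _ ^+ p.
have h2 := sqr_ge0 (a - 1); have h3 := sqr_ge0 a; nra.
Qed.

End SchemeMoments.

(** * The scheme against its refinement on one step *)

Lemma weighted_amgm {R : realFieldType} (h a b : R) : 0 < h ->
  2 * (a * b) <= h * a ^+ 2 + b ^+ 2 / h.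
Proof.
move=> h0; have -> : h * a ^+ 2 + b ^+ 2 / h = h * (a - b / h) ^+ 2 + 2 * (a * b).
  by field; rewrite gt_eqF.
by rewrite lerDr mulr_ge0 ?sqr_ge0// ltW.
Qed.

(** What Young's inequality leaves of the cross terms. Here [p] and [r] stand for weights with
    bounded moments and [si], [sj] for norms of noise over a time at most [h]: fourth moments of
    order [h^2] and eighth moments of order [h^4] make its mean of order [h]. *)
Definition cross_weight {R : realFieldType} (h p r si sj : R) : R :=
  h * (1 + p ^+ 8 + r ^+ 8) + (si ^+ 4 + sj ^+ 4 + si ^+ 8) / h.

(** The part with [ei] is split with weight [g / 4], which costs [4 / g * C ^ 4]. In the rest, three
    squares bounded with a factor 3 each give 9 copies of the weight, and [sj ^ 2] gives the
    tenth. *)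
Lemma cross_term {R : realFieldType} (g C p r si sj ei h : R) :
  0 < g -> 0 <= C -> 0 <= p -> 0 <= r -> 0 <= si -> 0 <= sj -> 0 < h -> h <= 1 ->
  2 * (C ^+ 2 * p * r * sj * (ei + si + h + si ^+ 2)) <=
    g / 4 * ei ^+ 2 + (4 / g * C ^+ 4 + 10 * C ^+ 2) * cross_weight h p r si sj.
Proof.
move=> g0 C0 p0 r0 si0 sj0 h0 h1; set W := cross_weight h p r si sj; set Q := p * r.
have Q40 : 0 <= Q ^+ 4 by rewrite /Q; nonneg.
have p80 : 0 <= p ^+ 8 by nonneg.
have r80 : 0 <= r ^+ 8 by nonneg.
have i4 : 0 <= si ^+ 4 / h by nonneg.
have j4 : 0 <= sj ^+ 4 / h by nonneg.
have i8 : 0 <= si ^+ 8 / h by nonneg.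
have WE : W = h + h * p ^+ 8 + h * r ^+ 8 + si ^+ 4 / h + sj ^+ 4 / h + si ^+ 8 / h.
  by rewrite /W /cross_weight; ring.
have hp : 0 <= h * p ^+ 8 by nonneg.
have hr : 0 <= h * r ^+ 8 by nonneg.
have Q4 : 2 * (h * Q ^+ 4) <= h * p ^+ 8 + h * r ^+ 8.
  rewrite -mulrDr mulrCA ler_wpM2l ?(ltW h0)//.
  have := sqr_ge0 (p ^+ 4 - r ^+ 4).
  have -> : (p ^+ 4 - r ^+ 4) ^+ 2 = p ^+ 8 + r ^+ 8 - 2 * Q ^+ 4 by rewrite /Q; ring.
  lra.
have sqq (x : R) : (x ^+ 2) ^+ 2 = x ^+ 4 by rewrite -exprM.
have h2 := @weighted_amgm R h.
have Wj : Q ^+ 2 * sj ^+ 2 <= W by have := h2 (Q ^+ 2) (sj ^+ 2) h0; rewrite !sqq; lra.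
have Wi : Q ^+ 2 * si ^+ 2 <= W by have := h2 (Q ^+ 2) (si ^+ 2) h0; rewrite !sqq; lra.
have Wi4 : Q ^+ 2 * si ^+ 4 <= W.
  have := h2 (Q ^+ 2) (si ^+ 4) h0; rewrite sqq (_ : (si ^+ 4) ^+ 2 = si ^+ 8);
    last by rewrite -exprM.
  lra.
have Wh : Q ^+ 2 * h ^+ 2 <= W.
  have e1 : Q ^+ 2 * h ^+ 2 <= h * Q ^+ 2.
    rewrite mulrC expr2 -mulrA ler_wpM2l ?(ltW h0)//.
    by rewrite ler_piMl// sqr_ge0.
  have e2 : 2 * (h * Q ^+ 2) <= h + h * Q ^+ 4.
    have : 0 <= h * (Q ^+ 2 - 1) ^+ 2 by nonneg.
    have -> : h * (Q ^+ 2 - 1) ^+ 2 = h + h * Q ^+ 4 - 2 * (h * Q ^+ 2) by ring.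
    lra.
  lra.
have Wsj : sj ^+ 2 <= W by have := h2 1 (sj ^+ 2) h0; rewrite sqq expr1n; lra.
have t1 : 2 * (C ^+ 2 * Q * sj * ei) <= g / 4 * ei ^+ 2 + 4 / g * C ^+ 4 * W.
  have g4 : 0 < g / 4 by exact: divr_gt0.
  have := weighted_amgm ei (C ^+ 2 * Q * sj) g4.
  rewrite (mulrC ei) => /le_trans; apply; rewrite lerD2l.
  have -> : (C ^+ 2 * Q * sj) ^+ 2 / (g / 4) = 4 / g * C ^+ 4 * (Q ^+ 2 * sj ^+ 2).
    by field; rewrite gt_eqF.
  by rewrite ler_wpM2l//; nonneg.
have t2 : 2 * (C ^+ 2 * Q * sj * (si + h + si ^+ 2)) <= 10 * C ^+ 2 * W.
  have e1 : 2 * (Q * (si + h + si ^+ 2) * sj) <=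
      Q ^+ 2 * (si + h + si ^+ 2) ^+ 2 + sj ^+ 2.
    have := sqr_ge0 (Q * (si + h + si ^+ 2) - sj); nra.
  have e2 : (si + h + si ^+ 2) ^+ 2 <= 3 * (si ^+ 2 + h ^+ 2 + si ^+ 4).
    have := sqr_ge0 (si - h); have := sqr_ge0 (si - si ^+ 2); have := sqr_ge0 (h - si ^+ 2).
    have -> : si ^+ 4 = (si ^+ 2) ^+ 2 by rewrite sqq.
    nra.
  have e3 := ler_wpM2l (sqr_ge0 Q) e2.
  have e4 : 2 * (Q * (si + h + si ^+ 2) * sj) <= 10 * W by lra.
  have := ler_wpM2l (sqr_ge0 C) e4; lra.
have -> : 2 * (C ^+ 2 * p * r * sj * (ei + si + h + si ^+ 2)) =
  2 * (C ^+ 2 * Q * sj * ei) + 2 * (C ^+ 2 * Q * sj * (si + h + si ^+ 2)).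
  by rewrite /Q; ring.
rewrite mulrDl; lra.
Qed.

Section LocalError.
Context {R : realType} {d : nat}.
Context (f : 'rV[R]_d -> 'rV[R]_d) (alpha gamma M : R) (q : nat).
Context (alpha0 : 0 < alpha) (gamma0 : 0 < gamma) (M0 : 0 < M).
Context (f_diff : forall x, differentiable f x).
Context (f_growth : forall x, enorm (f x) <= M * (1 + enorm x ^+ q)).
Context (f_derive : forall x v, enorm ('D_v f x) <= M * (1 + enorm x ^+ q) * enorm v).
Context (f_lip : forall x y, enorm (f y - f x) <=
  M * (1 + enorm x ^+ q + enorm y ^+ q) * enorm (y - x)).
Context (f_taylor : forall x y, enorm (f y - f x - 'D_(y - x) f x) <=
  M * (1 + enorm x ^+ q + enorm y ^+ q) * enorm (y - x) ^+ 2).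
Context (f_diss : forall x y,
  inner (f x - f y) (x - y) <= - gamma * enorm (x - y) ^+ 2).
Implicit Types (x y xi : 'rV[R]_d).

Definition weight x y xi : R := 1 + enorm x + enorm y + enorm xi.

Lemma weight_ge1 x y xi : 1 <= weight x y xi.
Proof. by rewrite /weight -!addrA lerDl; nonneg. Qed.

Lemma weight_ge0 x y xi : 0 <= weight x y xi.
Proof. exact: le_trans (weight_ge1 x y xi). Qed.

(** The interpolated point has size of order [L ^ (q+1)], so the growth of [f] there costs
    [q (q+1)]; the squared displacement in the Taylor remainder costs [2 q]. *)
Definition weight_exponent : nat := q * q.+1 + 2 * q.

Definition local_constant : R :=
  (3 + (2 + 2 * M) ^+ q) * M * (2 * M + 1) ^+ 2 * 2 + 4 * M ^+ 2 * (1 + 2 * alpha) + 4 * M.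

(** The difference of drifts is split into [f y - f xt], on which dissipativity acts, the part
    linear in the noise, whose mean will vanish, and [rho]. The remainder [rho] consists of two
    taming defects and the derivative along [u *: G], all of order [h], and of the Taylor remainder,
    of order [h + |xi|^2]. *)
Lemma local_error h delta u x y xi (L := weight x y xi)
    (G := tamed f alpha h x) (xt := x + u *: G + xi)
    (rho := tamed f alpha delta y - G - (f y - f xt) - 'D_xi f x) :
  0 < delta -> delta <= h -> h <= 1 -> 0 <= u -> u <= h ->
  [/\ enorm rho <= local_constant * L ^+ weight_exponent * (h + enorm xi ^+ 2),
      enorm ('D_xi f x) <= local_constant * L ^+ weight_exponent * enorm xi,
      enorm (f y - f xt) <= local_constant * L ^+ weight_exponent * enorm (y - xt) &
      enorm (tamed f alpha delta y - G) <= local_constant * L ^+ weight_exponent].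
Proof.
move=> d0 dh h1 u0 uh.
have h0 : 0 < h by exact: lt_le_trans dh.
have L1 : 1 <= L by exact: weight_ge1.
have L0 : 0 <= L by exact: weight_ge0.
have Lk k : (k <= weight_exponent)%N -> L ^+ k <= L ^+ weight_exponent.
  by move=> ka; exact: ler_weXn2l.
have Lk1 k : 1 <= L ^+ k by rewrite exprn_ege1.
have Lk0 k : 0 <= L ^+ k by rewrite exprn_ge0.
have [x0 y0 xi0] := And3 (enorm_ge0 x) (enorm_ge0 y) (enorm_ge0 xi).
have xL : enorm x <= L by rewrite /L /weight; lra.
have yL : enorm y <= L by rewrite /L /weight; lra.
have xiL : enorm xi <= L by rewrite /L /weight; lra.
have pw (v : 'rV[R]_d) k : enorm v <= L -> enorm v ^+ k <= L ^+ k.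
  by move=> vL; rewrite lerXn2r ?nnegrE ?enorm_ge0.
have fL (v : 'rV[R]_d) : enorm v <= L -> enorm (f v) <= 2 * M * L ^+ q.
  move=> vL; apply: le_trans (f_growth v) _; rewrite [2 * M]mulrC -mulrA.
  by rewrite ler_wpM2l ?(ltW M0)//; have := pw v q vL; have := Lk1 q; lra.
have fx := fL x xL; have fy := fL y yL.
have Gx : enorm G <= enorm (f x) by apply: tamed_le => //; exact: ltW.
have uG : enorm (u *: G) <= h * (2 * M * L ^+ q).
  rewrite enormZ ger0_norm// ler_pM ?enorm_ge0//; exact: le_trans fx.
have hML : h * (2 * M * L ^+ q) <= 2 * M * L ^+ q.
  by rewrite ler_piMl// !mulr_ge0// ltW.
have xtL : enorm xt <= (2 + 2 * M) * L ^+ q.+1.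
  apply: le_trans (enormD _ _) _; apply: le_trans (lerD (enormD _ _) (lexx _)) _.
  have e1 : L <= L ^+ q.+1 by rewrite exprS ler_peMr.
  have e2 : L ^+ q <= L ^+ q.+1 by rewrite ler_weXn2l.
  have e3 : 2 * M * L ^+ q <= 2 * M * L ^+ q.+1 by rewrite ler_wpM2l// mulr_ge0// ltW.
  lra.
have xtq : enorm xt ^+ q <= (2 + 2 * M) ^+ q * L ^+ (q * q.+1).
  rewrite mulnC exprM -exprMn lerXn2r ?nnegrE ?enorm_ge0//.
  by rewrite mulr_ge0// addr_ge0// mulr_ge0// ltW.
have c1 : 0 <= (2 + 2 * M) ^+ q by rewrite exprn_ge0// addr_ge0// mulr_ge0// ltW.
have Lq : L ^+ q <= L ^+ (q * q.+1) by rewrite ler_weXn2l// leq_pmulr.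
have sumq (v : 'rV[R]_d) : enorm v <= L -> 1 + enorm v ^+ q + enorm xt ^+ q <=
    (2 + (2 + 2 * M) ^+ q) * L ^+ (q * q.+1).
  move=> vL; have := pw v q vL; have := Lk1 (q * q.+1)%N.
  rewrite mulrDl; lra.
have cM : 0 <= (2 + (2 + 2 * M) ^+ q) * M by rewrite mulr_ge0 ?addr_ge0// ltW.
have p0 : 0 <= M ^+ 2 * alpha by nonneg.
have p1 : 0 <= M ^+ 2 by nonneg.
have sq1 : 1 <= (2 * M + 1) ^+ 2 by rewrite exprn_ege1// lerDr; nonneg.
have s0 : 0 <= h + enorm xi ^+ 2 by nonneg.
have bound2 : M * (1 + enorm x ^+ q) <= 2 * M * L ^+ q.
  by rewrite [2 * M]mulrC -mulrA ler_wpM2l ?(ltW M0)//; have := pw x q xL; have := Lk1 q; lra.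
have main_c : (2 + (2 + 2 * M) ^+ q) * M * (2 * M + 1) ^+ 2 * 2 +
    4 * M ^+ 2 * (1 + 2 * alpha) <= local_constant.
  rewrite /local_constant -[leLHS]addr0 lerD//; last by nonneg.
  rewrite lerD2r; have : 0 <= M * (2 * M + 1) ^+ 2 by nonneg.
  lra.
have cM2 : (2 + (2 + 2 * M) ^+ q) * M <= local_constant.
  apply: le_trans main_c; rewrite -[leLHS]addr0 lerD//; last by nonneg.
  by rewrite -mulrA ler_peMr// -[1]mul1r ler_pM//; lra.
have twoM : 4 * M <= local_constant.
  by rewrite /local_constant lerDr; nonneg.
have L2q : L ^+ (2 * q) <= L ^+ weight_exponent by rewrite Lk// leq_addl.
have Lqa : L ^+ q <= L ^+ weight_exponent.
  by rewrite Lk// (leq_trans _ (leq_addl _ _))// leq_pmull.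
have C0 : 0 <= local_constant by exact: le_trans cM2.
split.
- have -> : rho = - (f y - tamed f alpha delta y) + (f x - G) + 'D_(u *: G) f x
      + (f xt - f x - 'D_(xt - x) f x).
    have -> : xt - x = u *: G + xi by rewrite /xt -[x + _ + _]addrA [x + _]addrC addrK.
    have -> : 'D_(u *: G + xi) f x = 'D_(u *: G) f x + 'D_xi f x.
      by rewrite !deriveE// linearD.
    rewrite /rho; move: (tamed f alpha delta y) ('D_xi f x) ('D_(u *: G) f x) (f xt) => a b c e.
    by apply/rowP => i; rewrite !mxE; ring.
  have b1 : enorm (f y - tamed f alpha delta y) <= alpha * h * (4 * M ^+ 2 * L ^+ (2 * q)).
    apply: le_trans (tamed_consistent _ alpha0 _ (ltW d0)) _.
    apply: ler_pM; [by nonneg|by nonneg|by rewrite ler_wpM2l// ltW|].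
    have -> : 4 * M ^+ 2 * L ^+ (2 * q) = (2 * M * L ^+ q) ^+ 2.
      by rewrite mulnC exprM; ring.
    by rewrite lerXn2r ?nnegrE ?enorm_ge0//; nonneg.
  have b2 : enorm (f x - G) <= alpha * h * (4 * M ^+ 2 * L ^+ (2 * q)).
    apply: le_trans (tamed_consistent _ alpha0 _ (ltW h0)) _.
    rewrite ler_wpM2l//; first by nonneg.
    have -> : 4 * M ^+ 2 * L ^+ (2 * q) = (2 * M * L ^+ q) ^+ 2.
      by rewrite mulnC exprM; ring.
    by rewrite lerXn2r ?nnegrE ?enorm_ge0//; nonneg.
  have b3 : enorm ('D_(u *: G) f x) <= h * (4 * M ^+ 2 * L ^+ (2 * q)).
    apply: le_trans (f_derive _ _) _.
    have -> : h * (4 * M ^+ 2 * L ^+ (2 * q)) = (2 * M * L ^+ q) * (h * (2 * M * L ^+ q)).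
      by rewrite mulnC exprM; ring.
    by apply: ler_pM => //; nonneg.
  have b4 : enorm (f xt - f x - 'D_(xt - x) f x) <=
      (2 + (2 + 2 * M) ^+ q) * M * (2 * M + 1) ^+ 2 * 2 * L ^+ weight_exponent *
      (h + enorm xi ^+ 2).
    apply: le_trans (f_taylor _ _) _.
    have t1 : enorm (xt - x) <= (2 * M + 1) * L ^+ q * (h + enorm xi).
      have -> : xt - x = u *: G + xi by rewrite /xt -[x + _ + _]addrA [x + _]addrC addrK.
      apply: le_trans (enormD _ _) _.
      have e1 : enorm xi <= L ^+ q * enorm xi by rewrite ler_peMl.
      have e2 : 0 <= M * L ^+ q * enorm xi by nonneg.
      have e3 : 0 <= L ^+ q * h by nonneg.
      lra.
    have t2 : enorm (xt - x) ^+ 2 <= (2 * M + 1) ^+ 2 * 2 * L ^+ (2 * q) * (h + enorm xi ^+ 2).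
      apply: (@le_trans _ _ (((2 * M + 1) * L ^+ q * (h + enorm xi)) ^+ 2)).
        by rewrite lerXn2r ?nnegrE ?enorm_ge0//; nonneg.
      have -> : (2 * M + 1) ^+ 2 * 2 * L ^+ (2 * q) * (h + enorm xi ^+ 2) =
          ((2 * M + 1) * L ^+ q) ^+ 2 * (2 * (h + enorm xi ^+ 2)).
        by rewrite mulnC exprM; ring.
      rewrite exprMn ler_wpM2l ?sqr_ge0//.
      have : h ^+ 2 <= h by rewrite expr2 ler_piMl// ltW.
      have := sqr_ge0 (h - enorm xi); nra.
    have -> : (2 + (2 + 2 * M) ^+ q) * M * (2 * M + 1) ^+ 2 * 2 * L ^+ weight_exponent *
        (h + enorm xi ^+ 2) = (M * ((2 + (2 + 2 * M) ^+ q) * L ^+ (q * q.+1))) *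
        ((2 * M + 1) ^+ 2 * 2 * L ^+ (2 * q) * (h + enorm xi ^+ 2)).
      by rewrite /weight_exponent exprD; ring.
    apply: ler_pM => //; [by nonneg|by nonneg|].
    by rewrite ler_wpM2l ?(ltW M0)//; exact: sumq.
  apply: le_trans (enormD _ _) _; apply: le_trans (lerD (enormD _ _) b4) _.
  apply: le_trans (lerD (lerD (enormD _ _) b3) (lexx _)) _.
  apply: le_trans (lerD (lerD (lerD (lexx _) b2) (lexx _)) (lexx _)) _.
  rewrite enormN; apply: le_trans (lerD (lerD (lerD b1 (lexx _)) (lexx _)) (lexx _)) _.
  apply: (@le_trans _ _ (((2 + (2 + 2 * M) ^+ q) * M * (2 * M + 1) ^+ 2 * 2 +
    4 * M ^+ 2 * (1 + 2 * alpha)) * L ^+ weight_exponent * (h + enorm xi ^+ 2))); last first.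
    by rewrite ler_wpM2r// ler_wpM2r.
  have key : 4 * M ^+ 2 * (1 + 2 * alpha) * (L ^+ (2 * q) * h) <=
      4 * M ^+ 2 * (1 + 2 * alpha) * (L ^+ weight_exponent * (h + enorm xi ^+ 2)).
    rewrite ler_wpM2l//; first by nonneg.
    by apply: ler_pM => //; [exact: ltW|rewrite lerDl sqr_ge0].
  set K1 := (2 + (2 + 2 * M) ^+ q) * M * (2 * M + 1) ^+ 2 * 2.
  set S := h + enorm xi ^+ 2 in key *; set LW := L ^+ weight_exponent in key *.
  lra.
- apply: le_trans (f_derive _ _) _; rewrite ler_wpM2r ?enorm_ge0//.
  apply: le_trans bound2 _; apply: ler_pM => //; first by nonneg.
  by apply: le_trans twoM; have := ltW M0; lra.
- have := f_lip xt y; move=> /le_trans; apply; rewrite ler_wpM2r ?enorm_ge0//.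
  apply: (@le_trans _ _ ((2 + (2 + 2 * M) ^+ q) * M * L ^+ (q * q.+1))).
    rewrite addrAC [_ * M]mulrC -mulrA ler_wpM2l ?(ltW M0)//; exact: sumq.
  by apply: ler_pM => //; apply: Lk; rewrite leq_addr.
- apply: le_trans (enormB _ _) _.
  have ty : enorm (tamed f alpha delta y) <= enorm (f y) by apply: tamed_le => //; exact: ltW.
  apply: (@le_trans _ _ (4 * M * L ^+ q)); first by lra.
  by apply: ler_pM => //; nonneg.
Qed.

Lemma local_constant_ge0 : 0 <= local_constant.
Proof. by rewrite /local_constant; nonneg. Qed.

Section BlockStep.
Context (h delta : R) (x : 'rV[R]_d) (y xi : nat -> 'rV[R]_d).
Context (d0 : 0 < delta) (dh : delta <= h) (h1 : h <= 1).

Let G := tamed f alpha h x.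
Let xt j := x + (j%:R * delta) *: G + xi j.
Let E j := y j - xt j.
Let C := local_constant.
Let p j := weight x (y j) (xi j) ^+ weight_exponent.
Let s j := enorm (xi j).

Context (ES : forall j, E j.+1 = E j + delta *: (tamed f alpha delta (y j) - G)).

Definition cross_constant (c : R) : R := 4 / gamma * c ^+ 4 + 10 * c ^+ 2.

(* The linear part of the local error is decorrelated from [E 0]; replacing
   [E j] by [E 0] in it costs [E j - E 0], which is of order [delta * j]. *)
Lemma block_step j : j%:R * delta <= h ->
  enorm (E j.+1) ^+ 2 <=
    (1 - 3 / 2 * gamma * delta) * enorm (E j) ^+ 2
    + 2 * delta * inner (E 0%N) ('D_(xi j) f x)
    + delta * (8 * C ^+ 2 / gamma) * (h ^+ 2 * p j ^+ 4 + s j ^+ 8 / h ^+ 2)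
    + delta ^+ 2 * C ^+ 2 * p j ^+ 2
    + delta * delta * \sum_(i < j) (gamma / 4 * enorm (E i) ^+ 2 +
        cross_constant C * cross_weight h (p i) (p j) (s i) (s j)).
Proof.
move=> jh.
have h0 : 0 < h by exact: lt_le_trans dh.
have C0 : 0 <= C by exact: local_constant_ge0.
have p0 i : 0 <= p i by rewrite /p exprn_ge0// weight_ge0.
have p1 i : 1 <= p i by rewrite /p exprn_ege1// weight_ge1.
have s0 i : 0 <= s i by exact: enorm_ge0.
have le i : (i <= j)%N -> [/\
    enorm (tamed f alpha delta (y i) - G - (f (y i) - f (xt i)) - 'D_(xi i) f x)
      <= C * p i * (h + s i ^+ 2),
    enorm ('D_(xi i) f x) <= C * p i * s i,
    enorm (f (y i) - f (xt i)) <= C * p i * enorm (E i) &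
    enorm (tamed f alpha delta (y i) - G) <= C * p i].
  move=> ij; apply: local_error => //.
    by rewrite mulr_ge0// ltW.
  by apply: le_trans jh; rewrite ler_wpM2r ?ler_nat// ltW.
pose inc i := tamed f alpha delta (y i) - G.
have incle i : (i <= j)%N -> enorm (inc i) <= C * p i * (enorm (E i) + s i + h + s i ^+ 2).
  move=> ij; have [l1 l2 l3 _] := le i ij.
  have -> : inc i = (inc i - (f (y i) - f (xt i)) - 'D_(xi i) f x) + 'D_(xi i) f x
      + (f (y i) - f (xt i)).
    by rewrite !subrK.
  apply: le_trans (enormD _ _) _; apply: le_trans (lerD (enormD _ _) (lexx _)) _.
  have := lerD (lerD l1 l2) l3; rewrite -/(inc i); lra.
have Ediff : enorm (E j - E 0%N) <= delta * \sum_(i < j) enorm (inc i).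
  have aux k : enorm (E k - E 0%N) <= delta * \sum_(i < k) enorm (inc i).
    elim: k => [|k ih]; first by rewrite subrr enorm0 big_ord0 mulr0.
    rewrite ES big_ord_recr/= mulrDr addrAC; apply: le_trans (enormD _ _) _.
    by rewrite lerD// enormZ ger0_norm// ltW.
  exact: aux.
have [l1 l2 l3 l4] := le j (leqnn j).
set A := 'D_(xi j) f x in l1 l2 *.
rewrite ES enorm_sqrD innerZr enormZ exprMn (ger0_norm (ltW d0)) -/(inc j).
set e := enorm (E j); set rho := inc j - (f (y j) - f (xt j)) - A in l1.
have incE : inc j = rho + A + (f (y j) - f (xt j)) by rewrite !subrK.
have in1 : inner (E j) (inc j) <= - gamma * e ^+ 2 + inner (E j) A + e * enorm rho.
  rewrite incE innerDr (innerDr _ rho A) (innerC (E j) (f (y j) - f (xt j))).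
  have := f_diss (y j) (xt j); rewrite -/(E j) -/e.
  have := inner_le (E j) rho; rewrite -/e; lra.
(* A rate [gamma / 2] out of [2 * gamma] is spent here, which leaves [3 / 2 * gamma]. A second use
   of Young's inequality separates [p j] from [s j], which are dependent, so that separate moments
   suffice. *)
have rho2 : 2 * (e * enorm rho) <= gamma / 2 * e ^+ 2 +
    (8 * C ^+ 2 / gamma) * (h ^+ 2 * p j ^+ 4 + s j ^+ 8 / h ^+ 2).
  have g2 : 0 < gamma / 2 by exact: divr_gt0.
  apply: le_trans (weighted_amgm _ _ g2) _; rewrite lerD2l.
  apply: (@le_trans _ _ ((C * p j * (h + s j ^+ 2)) ^+ 2 / (gamma / 2))).
    rewrite ler_wpM2r ?invr_ge0 ?(ltW g2)// lerXn2r ?nnegrE ?enorm_ge0//; nonneg.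
  have -> : (C * p j * (h + s j ^+ 2)) ^+ 2 / (gamma / 2) =
      2 * C ^+ 2 / gamma * (p j ^+ 2 * (h + s j ^+ 2) ^+ 2).
    by field; rewrite gt_eqF.
  have -> : 8 * C ^+ 2 / gamma * (h ^+ 2 * p j ^+ 4 + s j ^+ 8 / h ^+ 2) =
      2 * C ^+ 2 / gamma * (4 * (h ^+ 2 * p j ^+ 4 + s j ^+ 8 / h ^+ 2)).
    by field; rewrite !gt_eqF.
  rewrite ler_wpM2l//; first by nonneg.
  have k1 : p j ^+ 2 * (h + s j ^+ 2) ^+ 2 <= 2 * (p j ^+ 2 * h ^+ 2) + 2 *
    (p j ^+ 2 * s j ^+ 4).
    have : 0 <= p j ^+ 2 * (h - s j ^+ 2) ^+ 2 by nonneg.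
    have -> : s j ^+ 4 = (s j ^+ 2) ^+ 2 by rewrite -exprM.
    lra.
  have k2 : p j ^+ 2 * h ^+ 2 <= h ^+ 2 * p j ^+ 4.
    by rewrite mulrC ler_wpM2l ?sqr_ge0// ler_weXn2l.
  have k3 : 2 * (p j ^+ 2 * s j ^+ 4) <= h ^+ 2 * p j ^+ 4 + s j ^+ 8 / h ^+ 2.
    have := @weighted_amgm R (h ^+ 2) (p j ^+ 2) (s j ^+ 4) (exprn_gt0 _ h0).
    rewrite (_ : (p j ^+ 2) ^+ 2 = p j ^+ 4); last by ring.
    by rewrite (_ : (s j ^+ 4) ^+ 2 = s j ^+ 8); last by ring.
  have k4 : 0 <= s j ^+ 8 / h ^+ 2 by nonneg.
  have k5 : 0 <= h ^+ 2 * p j ^+ 4 by nonneg.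
  lra.
have inc2 : enorm (inc j) ^+ 2 <= C ^+ 2 * p j ^+ 2.
  by rewrite -exprMn lerXn2r ?nnegrE ?enorm_ge0//; nonneg.
have EA : 2 * inner (E j) A <= 2 * inner (E 0%N) A + delta * \sum_(i < j)
    (gamma / 4 * enorm (E i) ^+ 2 +
     cross_constant C * cross_weight h (p i) (p j) (s i) (s j)).
  have -> : inner (E j) A = inner (E 0%N) A + inner (E j - E 0%N) A.
    by rewrite -innerDl addrC subrK.
  rewrite mulrDr lerD2l; apply: (@le_trans _ _ (2 *
      (delta * (\sum_(i < j) enorm (inc i)) * (C * p j * s j)))).
    rewrite ler_pM2l//; apply: le_trans (inner_le _ _) _.
    by apply: ler_pM; [exact: enorm_ge0|exact: enorm_ge0|exact: Ediff|exact: l2].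
  set S1 := \sum_(i < j) enorm _.
  have -> : 2 * (delta * S1 * (C * p j * s j)) = delta * (S1 * (2 * (C * (p j * s j)))) by ring.
  rewrite ler_wpM2l ?(ltW d0)// mulr_suml; apply: ler_sum => i _.
  apply: le_trans (_ : _ <= 2 * (C ^+ 2 * p i * p j * s j *
      (enorm (E i) + s i + h + s i ^+ 2))) _; last exact: cross_term.
  have -> : 2 * (C ^+ 2 * p i * p j * s j * (enorm (E i) + s i + h + s i ^+ 2)) =
     C * p i * (enorm (E i) + s i + h + s i ^+ 2) * (2 * (C * (p j * s j))) by ring.
  apply: ler_wpM2r; first by nonneg.
  exact: incle (ltnW (ltn_ord i)).
set S := \sum_(i < j) _ in EA *.
have dd : delta ^+ 2 * enorm (inc j) ^+ 2 <= delta ^+ 2 * (C ^+ 2 * p j ^+ 2).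
  by rewrite ler_wpM2l// sqr_ge0.
set H := 8 * C ^+ 2 / gamma * _ in rho2.
have tot : 2 * inner (E j) (inc j) <= - (3 / 2) * gamma * e ^+ 2 + 2 * inner (E 0%N) A +
    delta * S + H by lra.
have := ler_wpM2l (ltW d0) tot.
rewrite -[delta * (8 * C ^+ 2 / gamma) * _]mulrA -/H; lra.
Qed.

End BlockStep.
End LocalError.

(** * Pathwise convergence and contraction *)

Lemma segment_uniformly_continuous {R : realType} {V : normedModType R}
    (g : R -> V) (a b e : R) : {within `[a, b], continuous g} -> 0 < e ->
  exists2 r, 0 < r & forall s t, s \in `[a, b] -> t \in `[a, b] ->
    `|t - s| < r -> `|g t - g s| < e.
Proof.
move=> /subspace_continuousP g_cont e0.
have /compact_near_coveringP cpt := @segment_compact R a b.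
pose Q (r s : R) := s \in `[a, b] -> forall t, t \in `[a, b] -> `|t - s| < r ->
  `|g t - g s| < e.
have : \forall r \near (0 : R)^'+, `[a, b] `<=` Q r.
  apply: cpt => x abx.
  have /cvgrPdist_lt /(_ (e / 2)) := g_cont _ abx.
  rewrite divr_gt0// => /(_ isT); rewrite near_withinE.
  case=> rho /= rho0 Hrho.
  exists (ball x (rho / 2), [set r | 0 < r < rho / 2]) => /=; first split.
  - by exists (rho / 2) => //=; rewrite divr_gt0.
  - near=> r; apply/andP; split; near: r; first exact: nbhs_right_gt.
    by apply: nbhs_right_lt; rewrite divr_gt0.
  move=> [s r] /= [xs /andP[r0 rrho]] sab t tab ts.
  have xs' : `|x - s| < rho / 2 := xs.
  have gs : `|g x - g s| < e / 2.
    by apply: Hrho => //=; rewrite (lt_trans xs')// ltr_pdivrMr// ltr_pMr// ltr1n.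
  have gt : `|g x - g t| < e / 2.
    apply: Hrho => //=.
    have -> : x - t = (x - s) + (s - t) by ring.
    rewrite (le_lt_trans (ler_normD _ _))// [rho]splitr ltrD//.
    by rewrite distrC (lt_trans ts).
  have -> : g t - g s = (g x - g s) - (g x - g t).
    by rewrite opprB [RHS]addrC subrKA.
  by rewrite (le_lt_trans (ler_normB _ _))// [e]splitr ltrD.
move=> QN; near (0 : R)^'+ => r.
have r0 : 0 < r by near: r; exact: nbhs_right_gt.
have Qr : `[a, b] `<=` Q r by near: r.
by exists r => // s t sab; exact: Qr.
Unshelve. all: by end_near.
Qed.

Section PathSolution.
Context {R : realType} {d : nat}.
Implicit Types (f : 'rV[R]_d -> 'rV[R]_d) (W y : R -> 'rV[R]_d) (x : 'rV[R]_d).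

(** The equation for one fixed noise path [W]: additive noise makes it a deterministic integral
    equation. *)
Definition path_solution f W x y :=
  {within `[0, +oo[, continuous y} /\ forall t : R, 0 <= t ->
  y t = x + \row_(i < d) Rintegral lebesgue_measure `[0, t]
                           (fun s => f (y s) ord0 i) + W t.

Lemma within_continuous_comp f y (A : set R) : continuous f ->
  {within A, continuous y} -> {within A, continuous (f \o y)}.
Proof.
move=> fc /subspace_continuousP yc; apply/subspace_continuousP => t At.
by apply: cvg_comp (yc _ At) _; exact: fc.
Qed.

Lemma path_solution_continuous f W x y T : path_solution f W x y ->
  {within `[0, T], continuous y}.
Proof.
move=> [yc _]; apply: continuous_subspaceW yc => t /=.
by rewrite !in_itv/= => /andP[->].
Qed.

Lemma segment_bounded (y : R -> 'rV[R]_d) T : {within `[0, T], continuous y} ->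
  exists2 B, 0 <= B & forall t, 0 <= t -> t <= T -> enorm (y t) <= B.
Proof.
move=> yc; have := compact_bounded (continuous_compact yc (@segment_compact R 0 T)).
move=> [B [_ HB]]; exists (d%:R * (`|B| + 1)); first by nonneg.
move=> t t0 tT; apply: le_trans (enorm_le_mx_norm _) _.
rewrite ler_wpM2l//; apply: (HB (`|B| + 1)); first by rewrite ltr_pwDr// ler_norm.
by exists t => //=; rewrite in_itv/= t0.
Qed.

(** Uniform continuity of [f] along the path makes the solution an explicit Euler step up to an
    error small compared with the step, uniformly on [[0, T]]. *)
Lemma path_increment f W x y T e : continuous f -> path_solution f W x y -> 0 < e ->
  exists2 r, 0 < r & forall s t : R, 0 <= s -> s <= t -> t <= T -> t - s < r ->
    enorm (y t - y s - (t - s) *: f (y s) - (W t - W s)) <= (t - s) * e.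
Proof.
move=> fc ys e0.
have gc : {within `[0, T], continuous (f \o y)}.
  exact: within_continuous_comp (path_solution_continuous ys).
(* One share for each coordinate; the divisor [d+1] is nonzero also when [d = 0]. *)
have d0 : 0 < e / d.+1%:R by rewrite divr_gt0.
have [r r0 Hr] := segment_uniformly_continuous gc d0.
exists r => // s t s0 st tT tsr.
have t0 := le_trans s0 st.
have ts0 : 0 <= t - s by rewrite subr_ge0.
set v := (X in enorm X).
have coord_int i :
    lebesgue_measure.-integrable `[0, T] (EFin \o (fun u => f (y u) ord0 i)).
  apply: continuous_compact_integrable; first exact: segment_compact.
  apply/subspace_continuousP => u /= uT.
  have /subspace_continuousP /(_ u uT) gcu := gc.
  apply: (@cvg_comp _ _ _ (f \o y) (fun z : 'rV[R]_d => z ord0 i) _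
    (nbhs (f (y u)))) => //.
  exact: coord_continuous.
have cst_int (c : R) : lebesgue_measure.-integrable `]s, t] (EFin \o (fun _ : R => c)).
  have cc : lebesgue_measure.-integrable `[s, t] (EFin \o (fun _ : R => c)).
    apply: continuous_compact_integrable; first exact: segment_compact.
    by apply: continuous_subspaceT => u; exact: cvg_cst.
  by apply: integrableS cc => //; exact: subset_itv_oc_cc.
have int_st i : lebesgue_measure.-integrable `]s, t]
    (EFin \o (fun u => f (y u) ord0 i)).
  by apply: integrableS (coord_int i) => //; apply: subset_itvScc; rewrite bnd_simp.
have int_0t i : lebesgue_measure.-integrable `[0, t]
    (EFin \o (fun u => f (y u) ord0 i)).
  by apply: integrableS (coord_int i) => //; apply: subset_itvScc; rewrite bnd_simp.
have length_st c : Rintegral lebesgue_measure `]s, t] (fun=> c) = (t - s) * c.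
  rewrite Rintegral_cst//= lebesgue_measure_itv/= lte_fin mulrC; congr (_ * _).
  by case: ltP => //=; rewrite le_eqVlt ltNge st orbF => /eqP->; rewrite subrr.
have int_diff i : lebesgue_measure.-integrable `]s, t]
    (EFin \o (fun u => f (y u) ord0 i - f (y s) ord0 i)).
  apply: eq_integrable (integrableB _ (int_st i) (cst_int (f (y s) ord0 i))) => //.
have vi i : `|v ord0 i| <= (t - s) * (e / d.+1%:R).
  have -> : v ord0 i = Rintegral lebesgue_measure `]s, t]
     (fun u => f (y u) ord0 i - f (y s) ord0 i).
    rewrite RintegralB//.
    rewrite length_st -(Rintegral_itvB (int_0t i)) ?bnd_simp//.
    rewrite /v; move: (f (y s)) => c.
    by rewrite (ys.2 t)// (ys.2 s)// !mxE; ring.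
  rewrite -length_st; apply: le_trans (le_normr_Rintegral _ (int_diff i)) _ => //.
  apply: le_Rintegral => //; first exact: integrable_norm.
  move=> u /= /itvP us; apply/ltW; apply: le_lt_trans (Hr s u _ _ _).
  - by have := coord_le_mx_norm (f (y u) - f (y s)) i; rewrite !mxE.
  - by rewrite in_itv/= s0 (le_trans st).
  - by rewrite in_itv/= (le_trans s0) ?us//= (le_trans _ tT)// us.
  - by rewrite ger0_norm ?subr_ge0 ?us// (le_lt_trans _ tsr)// lerD2r us.
apply: (le_trans (enorm_le_sum v)).
apply: le_trans (ler_sum _ (fun i _ => vi i)) _.
rewrite sumr_const card_ord -mulrnAr ler_wpM2l// -mulr_natl mulrCA.
apply: ler_piMr; first exact: ltW.
by rewrite ler_pdivrMr// mul1r ler_nat.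
Qed.

Lemma path_solution0 f W x y : path_solution f W x y -> y 0 = x + W 0.
Proof.
move=> [_ /(_ 0 (lexx _))->]; congr (_ + _); rewrite -[RHS]addr0; congr (_ + _).
by apply/rowP => i; rewrite !mxE set_itv1 Rintegral_set1.
Qed.

(** The energy estimate shared by the contraction of two solutions and the convergence of the
    scheme: [D] is a difference of states, [g] the difference of the drifts there, and [e] the
    consistency error. *)
Lemma dissipative_step gamma delta rho B G (D g e : 'rV[R]_d) :
  0 <= delta -> 0 <= rho -> inner g D <= - gamma * enorm D ^+ 2 ->
  enorm D <= B -> enorm g <= G -> enorm e <= delta * rho ->
  enorm (D + delta *: g + e) ^+ 2 <=
    (1 - 2 * gamma * delta) * enorm D ^+ 2 + delta * (2 * B * rho + delta * (G + rho) ^+ 2).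
Proof.
move=> delta0 rho0 gD DB gG erho; rewrite -addrA enorm_sqrD innerDr innerZr [inner D g]innerC.
have B0 := le_trans (enorm_ge0 D) DB; have G0 := le_trans (enorm_ge0 g) gG.
have H1 : inner D e <= B * (delta * rho).
  by apply: le_trans (inner_le _ _) _; apply: ler_pM; rewrite ?enorm_ge0.
have H2 : enorm (delta *: g + e) <= delta * (G + rho).
  apply: le_trans (enormD _ _) _; rewrite enormZ ger0_norm// mulrDr lerD//.
  exact: ler_wpM2l.
have H3 : enorm (delta *: g + e) ^+ 2 <= delta ^+ 2 * (G + rho) ^+ 2.
  by rewrite -exprMn lerXn2r// nnegrE ?enorm_ge0//; nonneg.
have H4 : delta * inner g D <= delta * (- gamma * enorm D ^+ 2) by exact: ler_wpM2l.
move: H1 H3 H4; set u := enorm D; set v := enorm (_ + _); set p := inner D e.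
set q := inner g D => H1 H3 H4.
have -> : (1 - 2 * gamma * delta) * u ^+ 2 + delta * (2 * B * rho + delta * (G + rho) ^+ 2) =
  u ^+ 2 + 2 * (delta * (- gamma * u ^+ 2)) + 2 * (B * (delta * rho)) +
  delta ^+ 2 * (G + rho) ^+ 2 by ring.
lra.
Qed.

Lemma affine_recursion (u : nat -> R) (a b : R) n : 0 <= a -> a <= 1 -> 0 <= b ->
  (forall k, (k < n)%N -> u k.+1 <= a * u k + b) -> u n <= a ^+ n * u 0 + n%:R * b.
Proof.
move=> a0 a1 b0; elim: n => [|n IH] H; first by rewrite mul1r mul0r addr0.
apply: le_trans (H n (ltnSn _)) _.
have := IH (fun k kn => H k (ltnW kn)); set un := u n; set v := a ^+ n * _ => uv.
rewrite exprS -mulrA -/v -natr1 mulrDl mul1r addrA lerD2r.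
apply: le_trans (ler_wpM2l a0 uv) _; rewrite mulrDr lerD2l.
by rewrite ler_piMl// mulr_ge0.
Qed.

Lemma small_mesh (c r : R) : 0 < r -> 
  exists n0, forall n, (n0 <= n)%N -> c / n.+1%:R < r.
Proof.
move=> r0; exists (Num.truncn (c / r)) => n n0n; rewrite ltr_pdivrMr// mulrC -ltr_pdivrMr//.
by apply: lt_le_trans (truncnS_gt _) _; rewrite ler_nat ltnS.
Qed.

Section Dissipative.
Context (f : 'rV[R]_d -> 'rV[R]_d) (alpha gamma : R) (alpha0 : 0 < alpha) (gamma0 : 0 < gamma).
Context (f_cont : continuous f).
Context (f_diss : forall u v : 'rV[R]_d, inner (f u - f v) (u - v) <= - gamma * enorm
  (u - v) ^+ 2).

(** Along a fine mesh the squared distance satisfies [dissipative_step], since the common noise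
    cancels. The powers of [1 - 2 gamma delta] are below [expR (- 2 gamma T)], and the accumulated
    errors are below an arbitrary [eta]. *)
Lemma path_contraction W x1 x2 y1 y2 T : 0 <= T ->
  path_solution f W x1 y1 -> path_solution f W x2 y2 ->
  enorm (y1 T - y2 T) <= expR (- gamma * T) * enorm (x1 - x2).
Proof.
move=> T0 ys1 ys2.
rewrite -ler_sqr ?nnegrE ?enorm_ge0 ?mulr_ge0 ?expR_ge0 ?enorm_ge0// exprMn -expRM_natl.
apply/ler_addgt0Pr => eta eta0.
have [yc1 yc2] := (path_solution_continuous (T := T) ys1, path_solution_continuous
  (T := T) ys2).
have [B1 B10 HB1] := segment_bounded yc1.
have [B2 B20 HB2] := segment_bounded yc2.
have [G1 G10 HG1] := segment_bounded (within_continuous_comp f_cont yc1).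
have [G2 G20 HG2] := segment_bounded (within_continuous_comp f_cont yc2).
pose B := B1 + B2; pose G := G1 + G2.
pose rho := eta / (4 * (B + 1) * (T + 1)).
have B1_gt0 : 0 < B + 1 by rewrite ltr_wpDl// addr_ge0.
have T1_gt0 : 0 < T + 1 by rewrite ltr_wpDl.
have rho0 : 0 < rho by rewrite divr_gt0 ?mulr_gt0.
pose Q := T * (G + rho) ^+ 2.
have Q0 : 0 <= Q by rewrite /Q /G; nonneg.
have Q1_gt0 : 0 < Q + 1 by rewrite ltr_wpDl.
have rho20 : 0 < rho / 2 by rewrite divr_gt0.
have [r1 r10 H1] := path_increment T f_cont ys1 rho20.
have [r2 r20 H2] := path_increment T f_cont ys2 rho20.
(* The last two entries make [delta * Q] at most [eta / 2] and [1 - 2 gamma delta] nonnegative. *)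
pose r := Num.min (Num.min r1 r2) (Num.min (eta / 2 / (Q + 1)) (2 * gamma)^-1).
have r0 : 0 < r.
  by rewrite !lt_min r10 r20 /= invr_gt0 !mulr_gt0// invr_gt0.
have [n0 /(_ n0 (leqnn _))] := small_mesh T r0.
set delta := T / _; rewrite !lt_min => /andP[/andP[dr1 dr2] /andP[dr3 dr4]].
have delta0 : 0 <= delta by rewrite /delta; nonneg.
have Tn : n0.+1%:R * delta = T by rewrite /delta mulrC divfK// gt_eqF.
pose t k := k%:R * delta.
have t0 k : 0 <= t k by rewrite /t; nonneg.
have tS k : t k.+1 - t k = delta by rewrite /t -natr1; ring.
have tle k : t k <= t k.+1 by rewrite -subr_ge0 tS.
have tT k : (k <= n0.+1)%N -> t k <= T.
  by move=> kn; rewrite -Tn /t ler_wpM2r// ler_nat.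
have := @affine_recursion (fun k => enorm (y1 (t k) - y2 (t k)) ^+ 2)
  (1 - 2 * gamma * delta) (delta * (2 * B * rho + delta * (G + rho) ^+ 2)) n0.+1.
rewrite [t n0.+1]Tn [t 0%N]mul0r (path_solution0 ys1) (path_solution0 ys2).
have -> : x1 + W 0 - (x2 + W 0) = x1 - x2 by rewrite opprD addrACA subrr addr0.
have gd : 2 * gamma * delta <= 1.
  by rewrite mulrC -ler_pdivlMr ?mul1r ?ltW// ?mulr_gt0.
have step : forall k, (k < n0.+1)%N -> enorm (y1 (t k.+1) - y2 (t k.+1)) ^+ 2 <=
    (1 - 2 * gamma * delta) * enorm (y1 (t k) - y2 (t k)) ^+ 2 +
    delta * (2 * B * rho + delta * (G + rho) ^+ 2).
  move=> k kn.
  have := H1 (t k) (t k.+1) (t0 k) (tle k) (tT _ kn).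
  have := H2 (t k) (t k.+1) (t0 k) (tle k) (tT _ kn).
  rewrite tS => /(_ dr2); set e2 := (X in enorm X <= _) => He2.
  move=> /(_ dr1); set e1 := (X in enorm X <= _) => He1.
  have -> : y1 (t k.+1) - y2 (t k.+1) =
     (y1 (t k) - y2 (t k)) + delta *: (f (y1 (t k)) - f (y2 (t k))) + (e1 - e2).
    by rewrite /e1 /e2; apply/rowP => i; rewrite !mxE; ring.
  have tkT := tT _ (ltnW kn).
  apply: dissipative_step => //; first exact: ltW.
  - by apply: le_trans (enormB _ _) _; rewrite lerD// (HB1, HB2).
  - by apply: le_trans (enormB _ _) _; rewrite lerD// (HG1, HG2).
  - by apply: le_trans (enormB _ _) _; rewrite [rho]splitr mulrDr lerD.
have b0 : 0 <= delta * (2 * B * rho + delta * (G + rho) ^+ 2).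
  by rewrite /B; nonneg.
move=> /(_ _ _ b0 step) H; apply: le_trans (H _ _) _.
- by rewrite subr_ge0.
- by rewrite gerBl; nonneg.
apply: lerD.
  apply: ler_wpM2r; first by rewrite exprn_ge0// enorm_ge0.
  have -> : 2 * (- gamma * T) = n0.+1%:R * (- (2 * gamma * delta)) by rewrite -Tn; ring.
  rewrite expRM_natl lerXn2r ?nnegrE ?expR_ge0 ?subr_ge0//.
  exact: expR_ge1Dx.
rewrite mulrA Tn.
have -> : T * (2 * B * rho + delta * (G + rho) ^+ 2) = 2 * T * B * rho + delta * Q.
  by rewrite /Q; ring.
rewrite [eta]splitr lerD//.
  rewrite /rho mulrA ler_pdivrMr ?mulr_gt0//.
  have : T * B <= (B + 1) * (T + 1) by rewrite /B; nra.
  nra.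
apply: le_trans (_ : delta * (Q + 1) <= _); first by rewrite ler_wpM2l// lerDl.
by apply/ltW; rewrite -ltr_pdivlMr.
Qed.

(** Dissipativity controls the difference of drifts, so only a bound on the drift along the scheme
    is missing. Staying within distance 1 of the solution, which is bounded on [[0, T]], provides
    it, and the induction on the error maintains this distance. *)
Lemma path_euler_cvg W x y T (M : R) (q : nat) e : 0 <= M ->
  (forall v : 'rV[R]_d, enorm (f v) <= M * (1 + enorm v ^+ q)) ->
  0 <= T -> W 0 = 0 -> path_solution f W x y -> 0 < e ->
  exists n0, forall n, (n0 <= n)%N -> forall z : nat -> 'rV[R]_d, z 0%N = x ->
  (forall k, z k.+1 = z k + (T / n.+1%:R) *: tamed f alpha (T / n.+1%:R) (z k) +
     (W (k.+1%:R * (T / n.+1%:R)) - W (k%:R * (T / n.+1%:R)))) ->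
  enorm (z n.+1 - y T) <= e.
Proof.
move=> M0 f_growth T0 W0 ys e0.
have yc := path_solution_continuous (T := T) ys.
have [B B0 HB] := segment_bounded yc.
pose G := M * (1 + (B + 1) ^+ q).
have G0 : 0 <= G by rewrite /G; nonneg.
have fG v : enorm v <= B + 1 -> enorm (f v) <= G.
  move=> vB; apply: le_trans (f_growth _) _; rewrite ler_wpM2l// lerD2l.
  by rewrite lerXn2r// nnegrE ?enorm_ge0//; nonneg.
(* The squared error must stay below [e ^ 2] and below 1, the latter to keep the scheme where the
   drift is at most [G]. *)
pose eta := Num.min 1 e ^+ 2.
have min0 : 0 < Num.min 1 e by rewrite lt_min ltr01.
have eta0 : 0 < eta by rewrite exprn_gt0.
have T1_gt0 : 0 < T + 1 by rewrite ltr_wpDl.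
pose rho := eta / (4 * (T + 1)).
have rho0 : 0 < rho by rewrite divr_gt0 ?mulr_gt0.
pose Q := T * (2 * G + rho) ^+ 2.
have Q0 : 0 <= Q by rewrite /Q; nonneg.
have Q1_gt0 : 0 < Q + 1 by rewrite ltr_wpDl.
have rho20 : 0 < rho / 2 by rewrite divr_gt0.
have [r1 r10 H1] := path_increment T f_cont ys rho20.
have aG1_gt0 : 0 < alpha * G ^+ 2 + 1 by rewrite ltr_wpDl//; nonneg.
pose r := Num.min (Num.min r1 (2 * gamma)^-1)
  (Num.min (eta / 2 / (Q + 1)) (rho / 2 / (alpha * G ^+ 2 + 1))).
have r0 : 0 < r.
  rewrite !lt_min r10 /=; apply/and3P; split.
  - by rewrite invr_gt0 mulr_gt0.
  - by apply: divr_gt0 => //; exact: divr_gt0.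
  - exact: divr_gt0.
have [n0 Hn0] := small_mesh T r0; exists n0 => n /Hn0 {Hn0}.
set delta := T / _; rewrite !lt_min => /andP[/andP[dr1 dr4] /andP[dr3 dr2]] z z0 zS.
have delta0 : 0 <= delta by rewrite /delta; nonneg.
have Tn : n.+1%:R * delta = T by rewrite /delta mulrC divfK// gt_eqF.
pose t k := k%:R * delta.
have t0 k : 0 <= t k by rewrite /t; nonneg.
have tS k : t k.+1 - t k = delta by rewrite /t -natr1; ring.
have tle k : t k <= t k.+1 by rewrite -subr_ge0 tS.
have tT k : (k <= n.+1)%N -> t k <= T.
  by move=> kn; rewrite -Tn /t ler_wpM2r// ler_nat.
pose b := delta * (2 * 1 * rho + delta * (2 * G + rho) ^+ 2).
have b0 : 0 <= b by rewrite /b; nonneg.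
have nb : n.+1%:R * b <= eta.
  rewrite /b mulrA Tn.
  have -> : T * (2 * 1 * rho + delta * (2 * G + rho) ^+ 2) = 2 * T * rho + delta * Q.
    by rewrite /Q; ring.
  rewrite [eta]splitr lerD//.
    rewrite /rho mulrA ler_pdivrMr ?mulr_gt0//.
    by nra.
  apply: le_trans (_ : delta * (Q + 1) <= _); first by rewrite ler_wpM2l// lerDl.
  by apply/ltW; rewrite -ltr_pdivlMr.
have eta1 : eta <= 1 by rewrite /eta expr_le1// ?ge_min ?lexx// ltW.
have sqr_le u c : 0 <= c -> enorm (u : 'rV[R]_d) ^+ 2 <= c ^+ 2 -> enorm u <= c.
  by move=> c0; rewrite ler_sqr ?nnegrE ?enorm_ge0.
have main k : (k <= n.+1)%N -> enorm (y (t k) - z k) ^+ 2 <= k%:R * b.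
  elim: k => [|k IH] kn.
    by rewrite /t mul0r (path_solution0 ys) z0 W0 addr0 subrr enorm0 expr0n mul0r.
  have {}IH := IH (ltnW kn).
  have kb : k%:R * b <= eta by apply: le_trans nb; rewrite ler_wpM2r// ler_nat ltnW.
  have E1 : enorm (y (t k) - z k) <= 1.
    by apply: sqr_le => //; rewrite expr1n (le_trans IH)// (le_trans kb).
  have yB := HB _ (t0 k) (tT _ (ltnW kn)).
  have fy : enorm (f (y (t k))) <= G by apply: fG; rewrite (le_trans yB)// lerDl.
  have fz : enorm (f (z k)) <= G.
    apply: fG; apply: le_trans (enorm_dist_triangle _ (y (t k))) _.
    by rewrite enorm_distC lerD.
  have := H1 (t k) (t k.+1) (t0 k) (tle k) (tT _ kn).
  rewrite tS => /(_ dr1); set e1 := (X in enorm X <= _) => He1.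
  have -> : y (t k.+1) - z k.+1 =
     (y (t k) - z k) + delta *: (f (y (t k)) - f (z k)) +
     (delta *: (f (z k) - tamed f alpha delta (z k)) + e1).
    by rewrite zS /e1; apply/rowP => i; rewrite !mxE; ring.
  have g2 : (1 - 2 * gamma * delta) * enorm (y (t k) - z k) ^+ 2 <= k%:R * b.
    apply: le_trans IH; rewrite ler_piMl ?exprn_ge0 ?enorm_ge0// gerBl; nonneg.
  rewrite -natr1 mulrDl mul1r; apply: le_trans (lerD g2 (lexx _)).
  apply: dissipative_step => //; first exact: ltW.
  - apply: le_trans (enormB _ _) _; rewrite mulr_natl mulr2n lerD//.
  - apply: le_trans (enormD _ _) _; rewrite enormZ ger0_norm//.
    rewrite [rho in leRHS]splitr mulrDr lerD// ler_wpM2l//.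
    apply: le_trans (tamed_consistent _ _ _ _) _ => //.
    apply: le_trans (_ : delta * (alpha * G ^+ 2 + 1) <= _).
      have fz2 : enorm (f (z k)) ^+ 2 <= G ^+ 2.
        by rewrite lerXn2r ?nnegrE ?enorm_ge0//; exact: fz.
      have ad0 : 0 <= alpha * delta by nonneg.
      have := ler_wpM2l ad0 fz2; lra.
    by apply/ltW; rewrite -ltr_pdivlMr.
apply: le_trans (_ : Num.min 1 e <= _); last by rewrite ge_min lexx orbT.
apply: sqr_le; first exact: ltW.
by rewrite enorm_distC -Tn (le_trans (main _ (leqnn _))).
Qed.

End Dissipative.
End PathSolution.

(** * Means under almost sure limits and inequalities *)

Section MeanLimits.
Context {disp : measure_display} {T : measurableType disp} {R : realType}.
Context (P : probability T R).

Lemma fatou_bound (g : nat -> T -> R) (X : T -> R) (c : R) :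
  (forall m, measurable_fun [set: T] (g m)) -> measurable_fun [set: T] X ->
  (forall m w, 0 <= g m w) -> (forall w, 0 <= X w) ->
  (\forall w \ae P, g ^~ w @ \oo --> X w) ->
  (\forall m \near \oo, \int[P]_w (g m w)%:E <= c%:E)%E ->
  (\int[P]_w (X w)%:E <= c%:E)%E.
Proof.
move=> mg mX g0 X0 gX gc.
have mge n : measurable_fun [set: T] (fun w => (g n w)%:E) by exact/measurable_EFinP.
have ge0 n w : [set: T] w -> (0 <= (g n w)%:E)%E by rewrite lee_fin.
have := fatou P measurableT mge ge0.
rewrite (_ : (\int[P]_w (X w)%:E = \int[P]_w limn_einf (fun n => (g n w)%:E))%E); last first.
  apply: ge0_ae_eq_integral => //.
  - exact/measurable_EFinP.
  - rewrite (_ : (fun _ => _) = (fun w => - limn_esup (fun n => - (g n w)%:E))%E).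
      by apply: measurableT_comp => //; apply: measurable_fun_limn_esup => n;
        exact: measurableT_comp.
    by [].
  - by move=> w _; rewrite lee_fin.
  - move=> w _; rewrite limn_einf_lim; apply: lime_ge; first exact: is_cvg_einfs.
    apply: nearW => n; apply: le_ereal_inf_tmp => _ [k /= nk <-].
    by rewrite lee_fin.
  - apply: filterS gX => w gXw _; apply/esym.
    have /cvg_limn_einf_sup [-> _//] : (fun n => (g n w)%:E) @ \oo --> (X w)%:E.
    by apply: cvg_EFin => //; exact: nearW.
move=> /le_trans; apply; rewrite limn_einf_lim.
apply: lime_le; first exact: is_cvg_einfs.
apply: filterS gc => n gc.
by apply: le_trans gc; apply: ereal_inf_lbound; exists n => /=.
Qed.

Lemma all_moments_of_bounds (X : T -> R) : measurable_fun [set: T] X ->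
  (forall p, exists c : R, (\int[P]_w (`|X w| ^+ p)%:E <= c%:E)%E) -> all_moments P X.
Proof.
move=> mX H; split=> // p; apply/integrableP; split.
  by apply/measurable_EFinP; apply: measurable_funX; exact: measurableT_comp.
have [c] := H p; under [X in (X < _)%E]eq_integral do rewrite /= ger0_norm ?exprn_ge0//.
by move/le_lt_trans; apply; rewrite ltry.
Qed.

(** [Y] may be replaced by the maximum of [X] and [Y], equal to it almost everywhere, which reduces
    the claim to a pointwise inequality. *)
Lemma mean_le_ae (X Y : T -> R) : all_moments P X -> all_moments P Y ->
  (\forall w \ae P, X w <= Y w) -> \int[P]_w X w <= \int[P]_w Y w.
Proof.
move=> aX aY XY; pose Z w := Num.max (X w) (Y w).
have mX := all_moments_measurable aX; have mY := all_moments_measurable aY.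
have aZ : all_moments P Z.
  apply: le_all_moments (all_momentsD (all_moments_norm aX) (all_moments_norm aY)).
    exact: measurable_maxr.
  move=> w; rewrite [leRHS]ger0_norm ?addr_ge0// /Z.
  by case: (leP (X w) (Y w)) => _; rewrite ?lerDl ?lerDr.
have -> : \int[P]_w Y w = \int[P]_w Z w.
  rewrite /Rintegral; congr fine; apply: ae_eq_integral => //.
  - exact/measurable_EFinP.
  - by apply/measurable_EFinP; exact: (all_moments_measurable aZ).
  by apply: filterS XY => w XYw _; rewrite /Z max_r.
by apply: mean_le => // w; rewrite /Z le_max lexx.
Qed.

End MeanLimits.

(** * Strong and weak error *)

Section Comparison.
Context {disp : measure_display} {T : measurableType disp} {R : realType}.
Context {P : probability T R} (F : R -> set (set T)) (hF : usual_conditions P F).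
Context {d K : nat} (beta : 'I_K -> R -> T -> R)
  (hbeta : independent_wiener_processes P F beta).
Context (sigma : 'I_K -> 'rV[R]_d).
Context (f : 'rV[R]_d -> 'rV[R]_d) (alpha gamma M : R) (q : nat).
Context (alpha0 : 0 < alpha) (gamma0 : 0 < gamma) (M0 : 0 < M).
Context (f_diff : forall x, differentiable f x).
Context (f_derive_cont : forall v, continuous ('D_v f)).
Context (f_growth : forall x, enorm (f x) <= M * (1 + enorm x ^+ q)).
Context (f_derive : forall x v, enorm ('D_v f x) <= M * (1 + enorm x ^+ q) * enorm v).
Context (f_lip : forall x y, enorm (f y - f x) <=
  M * (1 + enorm x ^+ q + enorm y ^+ q) * enorm (y - x)).
Context (f_taylor : forall x y, enorm (f y - f x - 'D_(y - x) f x) <=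
  M * (1 + enorm x ^+ q + enorm y ^+ q) * enorm (y - x) ^+ 2).
Context (f_diss : forall x y,
  inner (f x - f y) (x - y) <= - gamma * enorm (x - y) ^+ 2).
Let f_cont : continuous f.
Proof. by move=> x; exact: differentiable_continuous. Qed.

(** * Mean-square distance between the scheme and its refinement *)

Section CoarseFine.
Context (x0 : 'rV[R]_d).

Local Notation euler h := (tamed_euler f sigma beta alpha h x0).
Local Notation noise_ := (noise beta sigma).
Local Notation a := (weight_exponent q).
Local Notation C := (local_constant alpha M q).

Lemma noise_refl t w : noise_ t t w = 0.
Proof. by rewrite /noise big1// => k _; rewrite /increment subrr scale0r. Qed.

Lemma noiseD s t u w : noise_ s u w = noise_ s t w + noise_ t u w.
Proof.
rewrite /noise -big_split; apply: eq_bigr => k _ /=.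
by rewrite -scalerDl /increment; congr (_ *: _); ring.
Qed.

Lemma noise_all_moments_le s t : 0 <= s -> s <= t ->
  all_moments P (fun w => enorm (noise_ s t w)).
Proof.
move=> s0; rewrite le_eqVlt => /predU1P[<-|st];
  last exact: (noise_all_moments hF hbeta sigma s0 st).
by under eq_fun do rewrite noise_refl enorm0; exact: all_moments_cst.
Qed.

Lemma noise_moment_le p : exists2 Cs : R, 0 <= Cs & forall s t, 0 <= s -> s <= t ->
  \int[P]_w (enorm (noise_ s t w) ^+ (2 * p)) <= Cs * (t - s) ^+ p.
Proof.
have [Cs Cs0 H] := noise_moment hF hbeta sigma (2 * p); exists (Cs + 1).
  by nonneg.
move=> s t s0; rewrite le_eqVlt => /predU1P[<-|st].
  under eq_Rintegral do rewrite noise_refl enorm0.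
  rewrite mean_cst subrr; case: p H => [|p] H; first by rewrite muln0 !expr0 mulr1 lerDr.
  by rewrite !expr0n muln_eq0 /= mulr0.
apply: le_trans (H _ _ s0 st) _; have ts : 0 <= t - s by rewrite subr_ge0 ltW.
rewrite exprM sqr_sqrtr// mulrDl lerDl mul1r; exact: exprn_ge0.
Qed.

(** The coarse scheme on the fine grid, with its drift frozen at the beginning of the coarse step
    and the full noise. The noise then cancels in [err], whose recursion contains drifts only. *)
Definition interpolant delta m n j w : 'rV[R]_d :=
  let h := m%:R * delta in
  euler h n w + (j%:R * delta) *: tamed f alpha h (euler h n w) +
  noise_ (n%:R * h) ((n * m + j)%:R * delta) w.

Definition err delta m n j w : 'rV[R]_d :=
  euler delta (n * m + j) w - interpolant delta m n j w.

Lemma errS delta m n j w : err delta m n j.+1 w = err delta m n j w + delta *: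
  (tamed f alpha delta (euler delta (n * m + j) w) -
   tamed f alpha (m%:R * delta) (euler (m%:R * delta) n w)).
Proof.
rewrite /err /interpolant addnS eulerS.
rewrite (noiseD (n%:R * (m%:R * delta)) ((n * m + j)%:R * delta)).
move: (noise_ _ _ w) (noise_ _ _ w) (tamed _ _ _ _) (tamed _ _ _ _) => u v g1 g2.
by rewrite -natr1; apply/rowP => i; rewrite !mxE; ring.
Qed.

Lemma time_block delta m n : (n * m + 0)%:R * delta = n%:R * (m%:R * delta) :> R.
Proof. by rewrite addn0 natrM mulrA. Qed.

Lemma err_start delta m n w :
  err delta m n 0 w = euler delta (n * m) w - euler (m%:R * delta) n w.
Proof.
by rewrite /err /interpolant /= time_block noise_refl mul0r scale0r !addr0 addn0.
Qed.

Lemma err_end delta m n w : err delta m n m w = err delta m n.+1 0 w.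
Proof.
rewrite err_start /err /interpolant eulerS.
have e : (n * m + m)%N = (n.+1 * m)%N by rewrite mulSn addnC.
by rewrite e natrM -mulrA.
Qed.

Lemma derive_noise s t w x : 'D_(noise_ s t w) f x =
  \sum_(k < K) increment beta k s t w *: 'D_(sigma k) f x.
Proof.
rewrite deriveE// linear_sum; apply: eq_bigr => k _.
by rewrite linearZ deriveE.
Qed.

Section Block.
Context (delta : R) (m n : nat).
Let h := m%:R * delta.
Context (d0 : 0 < delta) (dh : delta <= h) (sh : small_step alpha gamma h)
  (nh : n.+1%:R * h ^+ 2 <= 1) (gd : 3 / 2 * gamma * delta <= 1).

Let h0 : 0 < h. Proof. by case: sh. Qed.
Let h1 : h <= 1. Proof. by case: sh. Qed.

Let sd : small_step alpha gamma delta.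
Proof.
case: sh => _ _ ah gh; split=> //; first exact: le_trans h1.
  by apply: le_trans ah; rewrite ler_wpM2l// sqr_ge0.
by apply: le_trans gh; rewrite ler_wpM2l// divr_ge0// ltW.
Qed.

Let x w := euler h n w.
Let y j w := euler delta (n * m + j) w.
Let xi j w := noise_ (n%:R * h) ((n * m + j)%:R * delta) w.
Let s j w := enorm (xi j w).
Let p j w := weight (x w) (y j w) (xi j w) ^+ a.
Let E j w := err delta m n j w.
Let tn := n%:R * h.
Let tj j : R := (n * m + j)%:R * delta.

Let tn0 : 0 <= tn. Proof. by rewrite mulr_ge0// ltW. Qed.
Let tjE j : tj j = tn + j%:R * delta.
Proof. by rewrite /tj natrD mulrDl natrM /tn /h mulrA. Qed.
Let tnj j : tn <= tj j.
Proof. by rewrite tjE lerDl mulr_ge0// ltW. Qed.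
Let tj0 j : 0 <= tj j. Proof. exact: le_trans (tnj j). Qed.

Let vx j : vadapted F (tj j) x.
Proof.
apply: (vadapted_le hF tn0 (tnj j)).
by apply: (vadapted_euler hF hbeta).
Qed.

Let vy j : vadapted F (tj j) (y j).
Proof. by apply: (vadapted_euler hF hbeta). Qed.

Let vxi j : vadapted F (tj j) (xi j).
Proof. by apply: (vadapted_noise hF hbeta); [exact: tn0|exact: tnj|exact: lexx]. Qed.

Let vE j : vadapted F (tj j) (E j).
Proof.
apply: vadaptedB; first exact: vy.
apply: vadaptedD; last exact: vxi.
apply: vadaptedD; first exact: vx.
apply: vadaptedZ; first exact: measurable_cst.
apply: (@vadapted_comp _ _ _ _ _ _ (tamed f alpha h)); last exact: vx.
apply: tamed_continuous => //; exact: ltW.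
Qed.

Let ax : all_moments P (fun w => enorm (x w)).
Proof. exact: (euler_all_moments hF hbeta sigma alpha0 f_cont x0 n h0 h1). Qed.

Let ay j : all_moments P (fun w => enorm (y j w)).
Proof.
apply: (euler_all_moments hF hbeta sigma alpha0 f_cont x0 _ d0).
exact: le_trans h1.
Qed.

Let as_ j : all_moments P (s j).
Proof. exact: noise_all_moments_le tn0 (tnj j). Qed.

Let ap j : all_moments P (p j).
Proof.
apply: all_momentsX; apply: all_momentsD; last exact: as_.
apply: all_momentsD; last exact: ay.
by apply: all_momentsD => //; exact: all_moments_cst.
Qed.

Let aE j : all_moments P (fun w => enorm (E j w)).
Proof.
have am : all_moments P (fun w => enorm (y j w) +
    (enorm (x w) + alpha^-1 * m%:R * j%:R + s j w)).
  apply: all_momentsD; first exact: ay.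
  apply: all_momentsD; last exact: as_.
  by apply: all_momentsD => //; exact: all_moments_cst.
apply: le_all_moments am => [|w].
  by apply: (adapted_measurable hF (tj0 j)); apply: adapted_enorm; exact: vE.
rewrite ger0_norm ?enorm_ge0// (le_trans _ (ler_norm _))//.
apply: le_trans (enormB _ _) _; rewrite lerD2l.
apply: le_trans (enormD _ _) _; rewrite lerD2r.
apply: le_trans (enormD _ _) _; rewrite lerD2l enormZ ger0_norm ?mulr_ge0 ?(ltW d0)//.
have t := tamed_bounded f alpha0 (x w) h0.
have m1 : 1 <= m%:R :> R.
  have : 0 < m%:R :> R by rewrite -(pmulr_lgt0 _ d0) h0.
  by rewrite ltr0n ler1n.
have k0 : 0 <= enorm (tamed f alpha h (x w)) by exact: enorm_ge0.
apply: (@le_trans _ _ (j%:R * alpha^-1)).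
  rewrite -mulrA ler_wpM2l//; apply: le_trans t.
  by rewrite ler_wpM2r.
rewrite mulrC -mulrA ler_wpM2l ?invr_ge0 ?(ltW alpha0)//.
by rewrite ler_peMl.
Qed.

(** By linearity of the derivative the term is a sum of increments after time [tn], each multiplied
    by a quantity known at [tn]: both the error [E 0] and the coarse state are determined there. *)
Lemma mean_decorrelated j :
  all_moments P (fun w => inner (E 0 w) ('D_(xi j w) f (x w))) /\
  \int[P]_w inner (E 0 w) ('D_(xi j w) f (x w)) = 0.
Proof.
have e w : inner (E 0 w) ('D_(xi j w) f (x w)) = \sum_(k < K)
    inner (E 0 w) ('D_(sigma k) f (x w)) * increment beta k tn (tj j) w.
  rewrite derive_noise inner_sumr; apply: eq_bigr => k _.
  by rewrite innerZr mulrC.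
(* For an interval of length zero the increment is not Gaussian with positive variance; the term is
   then simply zero. *)
have [et|ne] := eqVneq tn (tj j).
  have e0 w : inner (E 0 w) ('D_(xi j w) f (x w)) = 0.
    by rewrite e big1// => k _; rewrite /increment -et subrr mulr0.
  split; first by under eq_fun do rewrite e0; exact: all_moments_cst.
  by under eq_Rintegral do rewrite e0; rewrite mean_cst.
have tlt : tn < tj j by rewrite lt_neqAle ne tnj.
have t00 : tj 0 = tn by rewrite tjE mul0r addr0.
have adG k : adapted F tn (fun w => inner (E 0 w) ('D_(sigma k) f (x w))).
  rewrite -t00; apply: adapted_inner; first exact: vE.
  by apply: (@vadapted_comp _ _ _ _ _ _ ('D_(sigma k) f)); [exact: f_derive_cont|exact: vx].
have amG k : all_moments P (fun w => inner (E 0 w) ('D_(sigma k) f (x w))).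
  have am : all_moments P (fun w => enorm (E 0 w) *
      (M * (1 + enorm (x w) ^+ q) * enorm (sigma k))).
    apply: all_momentsM; first exact: aE.
    apply: all_momentsM; last exact: all_moments_cst.
    apply: all_momentsZ; apply: all_momentsD; first exact: all_moments_cst.
    exact: all_momentsX.
  apply: le_all_moments am => [|w]; first exact: (adapted_measurable hF tn0).
  rewrite (le_trans _ (ler_norm _))//; apply: le_trans (inner_norm_le _ _) _.
  by rewrite ler_wpM2l ?enorm_ge0.
have amI k : all_moments P (increment beta k tn (tj j)).
  have := increment_subgaussian hF hbeta k tn0 tlt; apply: subgaussian_all_moments.
  by rewrite subr_gt0.
split; first by under eq_fun do rewrite e; apply: all_moments_sum => k; exact: all_momentsM.
under eq_Rintegral do rewrite e.
rewrite mean_sum => [|k]; last exact: all_momentsM.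
by rewrite big1// => k _; exact: (mean_adapted_increment hF hbeta).
Qed.

(** The errors of the earlier fine steps return with coefficient [gamma / 4], multiplied by
    [j * delta <= 1]; this lowers the rate from [3 / 2 * gamma] to [5 / 4 * gamma]. *)
Lemma mean_block_step (B Cw Cs : R) : 0 <= B -> 0 <= Cw -> 0 <= Cs ->
  (forall j, (j <= m)%N -> [/\ \int[P]_w (p j w ^+ 2) <= Cw,
     \int[P]_w (p j w ^+ 4) <= Cw & \int[P]_w (p j w ^+ 8) <= Cw]) ->
  (forall j, (j <= m)%N -> \int[P]_w (s j w ^+ 4) <= Cs * h ^+ 2 /\
     \int[P]_w (s j w ^+ 8) <= Cs * h ^+ 4) ->
  forall j, (j < m)%N ->
  (forall i, (i <= j)%N -> \int[P]_w (enorm (E i w) ^+ 2) <= B) ->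
  \int[P]_w (enorm (E j.+1 w) ^+ 2) <=
    (1 - 5 / 4 * gamma * delta) * B + delta * (h ^+ 2 *
      (8 * C ^+ 2 / gamma * (Cw + Cs) +
       cross_constant gamma C * (1 + 2 * Cw + 3 * Cs)) + delta * (C ^+ 2 * Cw)).
Proof.
move=> B0 Cw0 Cs0 Hw Hs j jm HE.
have jh : j%:R * delta <= h by rewrite ler_wpM2r ?(ltW d0)// ler_nat ltnW.
have path w := block_step alpha0 gamma0 M0 f_diff f_growth f_derive f_lip f_taylor
  f_diss d0 dh h1 (fun i => errS delta m n i w) jh.
have [amA mA] := mean_decorrelated j.
have aE2 i : all_moments P (fun w => enorm (E i w) ^+ 2) by exact: all_momentsX.
have apk i k : all_moments P (fun w => p i w ^+ k) by exact: all_momentsX.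
have ask i k : all_moments P (fun w => s i w ^+ k) by exact: all_momentsX.
have am3 : all_moments P (fun w => h ^+ 2 * p j w ^+ 4 + s j w ^+ 8 / h ^+ 2).
  apply: all_momentsD; first exact: all_momentsZ.
  by under eq_fun do rewrite mulrC; exact: all_momentsZ.
have amcw i : all_moments P (fun w => cross_weight h (p i w) (p j w) (s i w) (s j w)).
  apply: all_momentsD.
    apply: all_momentsZ; apply: all_momentsD => //.
    by apply: all_momentsD => //; exact: all_moments_cst.
  under eq_fun do rewrite mulrC; apply: all_momentsZ; apply: all_momentsD => //.
  exact: all_momentsD.
have am5i (i : 'I_j) : all_moments P (fun w => gamma / 4 * enorm (E i w) ^+ 2 +
    cross_constant gamma C * cross_weight h (p i w) (p j w) (s i w) (s j w)).
  by apply: all_momentsD; apply: all_momentsZ.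
have am5 := all_moments_sum (index_enum 'I_j) am5i.
have a1 := all_momentsZ (1 - 3 / 2 * gamma * delta) (aE2 j).
have a2 := all_momentsZ (2 * delta) amA.
have a3 := all_momentsZ (delta * (8 * C ^+ 2 / gamma)) am3.
have a4 := all_momentsZ (delta ^+ 2 * C ^+ 2) (apk j 2%N).
have a5 := all_momentsZ (delta * delta) am5.
have a12 := all_momentsD a1 a2.
have a123 := all_momentsD a12 a3.
have a1234 := all_momentsD a123 a4.
apply: le_trans (mean_le (aE2 j.+1) (all_momentsD a1234 a5) path) _.
rewrite (meanD a1234 a5) (meanD a123 a4) (meanD a12 a3) (meanD a1 a2).
rewrite (meanZ _ (aE2 j)) (meanZ _ amA) (meanZ _ am3) (meanZ _ (apk j 2%N)) (meanZ _ am5).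
rewrite mA mulr0 addr0 mean_sum//.
have hh : 0 < h ^+ 2 by exact: exprn_gt0.
have [w2 w4 w8] := Hw j (ltnW jm); have [s4 s8] := Hs j (ltnW jm).
have b3 : \int[P]_w (h ^+ 2 * p j w ^+ 4 + s j w ^+ 8 / h ^+ 2) <= h ^+ 2 * (Cw + Cs).
  under eq_Rintegral do rewrite [s j _ ^+ 8 / _]mulrC.
  rewrite meanD; [|exact: all_momentsZ|exact: all_momentsZ].
  rewrite !meanZ// mulrDr lerD//; first by rewrite ler_wpM2l// ltW.
  by rewrite ler_pdivrMl// mulrA -exprD mulrC.
have b5 (i : 'I_j) : \int[P]_w (gamma / 4 * enorm (E i w) ^+ 2 +
    cross_constant gamma C * cross_weight h (p i w) (p j w) (s i w) (s j w)) <=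
    gamma / 4 * B + cross_constant gamma C * (h * (1 + 2 * Cw + 3 * Cs)).
  have im : (i <= m)%N by rewrite ltnW// (ltn_trans (ltn_ord i)).
  have [_ _ iw8] := Hw i im; have [is4 is8] := Hs i im.
  rewrite meanD; [|exact: all_momentsZ|exact: all_momentsZ].
  rewrite (meanZ _ (aE2 i)) (meanZ _ (amcw i)) lerD//.
    rewrite ler_wpM2l//; first by nonneg.
    by apply: HE; rewrite ltnW.
  rewrite ler_wpM2l//; first by rewrite /cross_constant; nonneg.
  rewrite /cross_weight; under eq_Rintegral do rewrite [_ / h]mulrC.
  have q1 : all_moments P (fun w => 1 + p i w ^+ 8)
    by apply: all_momentsD => //; exact: all_moments_cst.
  have q2 := all_momentsD q1 (apk j 8).
  have q3 : all_moments P (fun w => s i w ^+ 4 + s j w ^+ 4) by exact: all_momentsD.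
  have q4 := all_momentsD q3 (ask i 8).
  rewrite (meanD (all_momentsZ h q2) (all_momentsZ h^-1 q4)) (meanZ _ q2) (meanZ _ q4).
  rewrite (meanD q1 (apk j 8)) (meanD (all_moments_cst P 1) (apk i 8)) mean_cst.
  rewrite (meanD q3 (ask i 8)) (meanD (ask i 4) (ask j 4)).
  have -> : h * (1 + 2 * Cw + 3 * Cs) = h * (1 + Cw + Cw) + h^-1 * (h ^+ 2 * (3 * Cs)).
    by field; rewrite gt_eqF.
  rewrite lerD//; first by rewrite ler_wpM2l ?(ltW h0)//; lra.
  rewrite ler_wpM2l ?invr_ge0 ?(ltW h0)//.
  have h42 : Cs * h ^+ 4 <= Cs * h ^+ 2.
    by rewrite ler_wpM2l// ler_wiXn2l// ltW.
  lra.
set S := \sum_(i < j) _.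
have SB : S <= j%:R * (gamma / 4 * B + cross_constant gamma C * (h * (1 + 2 * Cw + 3 * Cs))).
  set X := _ + _; have -> : j%:R * X = \sum_(i < j) X by rewrite sumr_const card_ord mulr_natl.
  by apply: ler_sum => i _; exact: b5.
have t1 : (1 - 3 / 2 * gamma * delta) * \int[P]_w (enorm (E j w) ^+ 2) <=
    (1 - 3 / 2 * gamma * delta) * B.
  by rewrite ler_wpM2l ?subr_ge0//; exact: HE.
have t3 : delta * (8 * C ^+ 2 / gamma) * \int[P]_w
  (h ^+ 2 * p j w ^+ 4 + s j w ^+ 8 / h ^+ 2) <=
    delta * (8 * C ^+ 2 / gamma) * (h ^+ 2 * (Cw + Cs)).
  by rewrite ler_wpM2l//; nonneg.
have t4 : delta ^+ 2 * C ^+ 2 * \int[P]_w (p j w ^+ 2) <= delta ^+ 2 * C ^+ 2 * Cw.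
  by rewrite ler_wpM2l//; nonneg.
set X := cross_constant gamma C in SB *; set Y := 1 + 2 * Cw + 3 * Cs in SB *.
have X0 : 0 <= X by rewrite /X /cross_constant; nonneg.
have Y0 : 0 <= Y by rewrite /Y; nonneg.
(* The factor [j * delta] is bounded by 1 in front of [B], but by [h] in front of the cross weights,
   whose mean of order [h] thus becomes [h ^ 2]. *)
have t5 : delta * delta * S <= delta * (gamma / 4 * B + X * (h ^+ 2 * Y)).
  rewrite -mulrA ler_wpM2l ?(ltW d0)//; apply: le_trans (ler_wpM2l (ltW d0) SB) _.
  have -> : delta * (j%:R * (gamma / 4 * B + X * (h * Y))) =
      j%:R * delta * (gamma / 4 * B) + j%:R * delta * (X * (h * Y)) by ring.
  apply: lerD; first by rewrite ler_piMl//; [nonneg|exact: le_trans h1].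
  have -> : X * (h ^+ 2 * Y) = h * (X * (h * Y)) by ring.
  by rewrite ler_wpM2r//; nonneg.
lra.
Qed.

End Block.

(** A level for the mean-square error that one fine step cannot cross is never crossed, so the bound
    does not grow with [n]. The condition on [n.+1] gives moment bounds over the whole block that
    starts at step [n]. *)
Lemma euler_compare : exists2 Cc : R, 0 <= Cc & forall delta m n,
  0 < delta -> (0 < m)%N -> small_step alpha gamma (m%:R * delta) ->
  3 / 2 * gamma * delta <= 1 -> n.+1%:R * (m%:R * delta) ^+ 2 <= 1 ->
  \int[P]_w (enorm (euler delta (n * m) w - euler (m%:R * delta) n w) ^+ 2) <=
    Cc * ((m%:R * delta) ^+ 2 + delta).
Proof.
have wmom k : exists2 Cw : R, 0 <= Cw & forall delta m n j, 0 < delta -> (0 < m)%N ->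
    (j <= m)%N -> small_step alpha gamma (m%:R * delta) ->
    n.+1%:R * (m%:R * delta) ^+ 2 <= 1 ->
    \int[P]_w ((weight (euler (m%:R * delta) n w) (euler delta (n * m + j) w)
      (noise_ (n%:R * (m%:R * delta)) ((n * m + j)%:R * delta) w) ^+ a) ^+ k) <= Cw.
  have [Cx Cx0 Hx] := euler_moment hF hbeta sigma alpha0 gamma0 M0 f_growth f_diss f_cont x0
    (2 * (a * k)).
  have [Cs Cs0 Hs] := noise_moment_le (a * k).
  exists (2 ^+ (2 * (a * k)) * (1 + 4 ^+ (2 * (a * k)) *
    (Cx + Cx + Cs))) => [|delta m n j d0 m0 jm sh nh].
    by nonneg.
  have h0 : 0 < m%:R * delta by case: sh.
  have dh : delta <= m%:R * delta by rewrite ler_peMl ?(ltW d0)// ler1n.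
  have h1 : m%:R * delta <= 1 by case: sh.
  have sd : small_step alpha gamma delta.
    case: sh => _ _ ah gh; split=> //; first exact: le_trans h1.
      by apply: le_trans ah; rewrite ler_wpM2l// sqr_ge0.
    by apply: le_trans gh; rewrite ler_wpM2l// divr_ge0// ltW.
  set s := n%:R * _; set t := (n * m + j)%:R * delta.
  have s0 : 0 <= s by rewrite mulr_ge0// ltW.
  have st : s <= t by rewrite /s /t natrD mulrDl natrM mulrA lerDl mulr_ge0// ltW.
  have nx : n%:R * (m%:R * delta) ^+ 2 <= 1.
    by apply: le_trans nh; rewrite ler_wpM2r ?sqr_ge0// ler_nat.
  (* The fine chain has to meet the horizon condition with its own number of steps:
     [(n+1) m delta^2 <= (n+1) h^2] because [m <= m^2]. *)
  have ny : (n * m + j)%:R * delta ^+ 2 <= 1.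
    apply: le_trans nh; apply: (@le_trans _ _ ((n.+1 * m)%:R * delta ^+ 2)).
      by rewrite ler_wpM2r ?sqr_ge0// ler_nat mulSn addnC leq_add2r.
    rewrite natrM -mulrA ler_wpM2l// exprMn ler_wpM2r ?sqr_ge0//.
    by rewrite expr2 ler_peMl// ler1n.
  have ax : all_moments P (fun w => enorm (euler (m%:R * delta) n w)).
    exact: (euler_all_moments hF hbeta sigma alpha0 f_cont x0 n h0 h1).
  have ay : all_moments P (fun w => enorm (euler delta (n * m + j) w)).
    apply: (euler_all_moments hF hbeta sigma alpha0 f_cont x0 _ d0).
    exact: le_trans h1.
  have az : all_moments P (fun w => enorm (noise_ s t w)) by exact: noise_all_moments_le.
  have mz : \int[P]_w (enorm (noise_ s t w) ^+ (2 * (a * k))) <= Cs.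
    apply: le_trans (Hs _ _ s0 st) _; rewrite ler_piMr// exprn_ile1 ?subr_ge0//.
    have -> : t - s = j%:R * delta by rewrite /s /t natrD mulrDl natrM; ring.
    by apply: le_trans h1; rewrite ler_wpM2r ?(ltW d0)// ler_nat.
  set b := (2 * (a * k))%N in Hx mz *.
  have axb : all_moments P (fun w => enorm (euler (m%:R * delta) n w) ^+ b)
    by exact: all_momentsX.
  have ayb : all_moments P (fun w => enorm (euler delta (n * m + j) w) ^+ b)
    by exact: all_momentsX.
  have azb : all_moments P (fun w => enorm (noise_ s t w) ^+ b) by exact: all_momentsX.
  have axy := all_momentsD axb ayb; have axyz := all_momentsD axy azb.
  have a1 := all_momentsD (all_moments_cst P 1) (all_momentsZ (4 ^+ b) axyz).
  have ar := all_momentsZ (2 ^+ b) a1.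
  have aw : all_moments P (fun w => (weight (euler (m%:R * delta) n w)
      (euler delta (n * m + j) w) (noise_ s t w) ^+ a) ^+ k).
    apply: all_momentsX; apply: all_momentsX; apply: all_momentsD => //.
    apply: all_momentsD => //; apply: all_momentsD => //; exact: all_moments_cst.
  have path w : (weight (euler (m%:R * delta) n w)
      (euler delta (n * m + j) w) (noise_ s t w) ^+ a) ^+ k <=
      2 ^+ b * (1 + 4 ^+ b * (enorm (euler (m%:R * delta) n w) ^+ b +
      enorm (euler delta (n * m + j) w) ^+ b + enorm (noise_ s t w) ^+ b)).
    rewrite -exprM; apply: le_trans (_ : weight (euler (m%:R * delta) n w)
      (euler delta (n * m + j) w) (noise_ s t w) ^+ b <= _).
      by rewrite ler_weXn2l ?weight_ge1// /b leq_pmull.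
    rewrite /weight -!addrA; apply: le_trans (expr_sum_le _ _ _) _ => //; first by nonneg.
    rewrite ler_wpM2l ?exprn_ge0// expr1n lerD2l !addrA.
    by apply: expr_add_le3; exact: enorm_ge0.
  apply: le_trans (mean_le aw ar path) _.
  rewrite (meanZ _ a1) (meanD (all_moments_cst P 1) (all_momentsZ (4 ^+ b) axyz)) mean_cst.
  rewrite (meanZ _ axyz) (meanD axy azb) (meanD axb ayb).
  rewrite ler_wpM2l ?exprn_ge0// lerD2l ler_wpM2l ?exprn_ge0// lerD//.
  by rewrite lerD//; apply: Hx.
have [Cw2 Cw20 Hw2] := wmom 2%N; have [Cw4 Cw40 Hw4] := wmom 4%N.
have [Cw8 Cw80 Hw8] := wmom 8%N.
have [Cs4 Cs40 Hs4] := noise_moment_le 2; have [Cs8 Cs80 Hs8] := noise_moment_le 4.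
pose Cw := Cw2 + Cw4 + Cw8; pose Cs := Cs4 + Cs8.
have Cw0 : 0 <= Cw by rewrite /Cw; nonneg.
have Cs0 : 0 <= Cs by rewrite /Cs; nonneg.
pose K1 := 8 * C ^+ 2 / gamma * (Cw + Cs) +
  cross_constant gamma C * (1 + 2 * Cw + 3 * Cs).
pose K2 := C ^+ 2 * Cw.
have K10 : 0 <= K1 by rewrite /K1 /cross_constant; nonneg.
have K20 : 0 <= K2 by rewrite /K2; nonneg.
(* Chosen so that the sources of one fine step are at most [5 / 4 * gamma * delta * B], the amount
   by which the level [B] is contracted. *)
exists ((K1 + K2) / gamma) => [|delta m n d0 m0 sh gd nh]; first by nonneg.
set h := m%:R * delta in sh nh *; set B := (K1 + K2) / gamma * (h ^+ 2 + delta).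
have dh : delta <= h by rewrite ler_peMl ?(ltW d0)// ler1n.
have h0 : 0 < h by exact: lt_le_trans dh.
have h1 : h <= 1 by case: sh.
have B0 : 0 <= B by rewrite /B; nonneg.
have gB : h ^+ 2 * K1 + delta * K2 <= 5 / 4 * gamma * B.
  have -> : 5 / 4 * gamma * B = 5 / 4 * ((K1 + K2) * (h ^+ 2 + delta)).
    by rewrite /B; field; rewrite gt_eqF.
  have : 0 <= h ^+ 2 * K1 by nonneg. have : 0 <= delta * K2 by nonneg.
  have : 0 <= h ^+ 2 * K2 by nonneg. have : 0 <= delta * K1 by nonneg.
  lra.
(* The bound is carried for all [l <= j] at once, since a fine step involves every earlier error of
   the same block. *)
have block i : (i <= n)%N ->
    \int[P]_w (enorm (err delta m i 0 w) ^+ 2) <= B ->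
    forall j, (j <= m)%N -> forall l, (l <= j)%N ->
    \int[P]_w (enorm (err delta m i l w) ^+ 2) <= B.
  move=> ni start; have ih' : i.+1%:R * h ^+ 2 <= 1.
    by apply: le_trans nh; rewrite ler_wpM2r ?sqr_ge0// ler_nat.
  elim=> [_ l|j ih jm l]; first by rewrite leqn0 => /eqP ->.
  rewrite leq_eqVlt => /predU1P[->|]; last by rewrite ltnS; apply: ih; exact: ltnW.
  have iB := ih (ltnW jm).
  apply: le_trans (mean_block_step d0 dh sh gd B0 Cw0 Cs0 _ _ jm iB) _.
  - move=> u um; split.
    + by apply: le_trans (Hw2 _ _ _ _ d0 m0 um sh ih') _; rewrite /Cw; lra.
    + by apply: le_trans (Hw4 _ _ _ _ d0 m0 um sh ih') _; rewrite /Cw; lra.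
    + by apply: le_trans (Hw8 _ _ _ _ d0 m0 um sh ih') _; rewrite /Cw; lra.
  - move=> u um; rewrite -/h; set s := i%:R * h; set t := (i * m + u)%:R * delta.
    have s0 : 0 <= s by rewrite mulr_ge0// ltW.
    have tsE : t - s = u%:R * delta by rewrite /s /t /h natrD mulrDl natrM; ring.
    have ts0 : 0 <= t - s by rewrite tsE mulr_ge0// ltW.
    have ts : t - s <= h by rewrite tsE ler_wpM2r ?(ltW d0)// ler_nat.
    have st : s <= t by rewrite -subr_ge0.
    split.
    + apply: le_trans (Hs4 _ _ s0 st) _; apply: ler_pM => //; first by nonneg.
        by rewrite /Cs lerDl.
      by rewrite lerXn2r ?nnegrE// ltW.
    + apply: le_trans (Hs8 _ _ s0 st) _; apply: ler_pM => //; first by nonneg.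
        by rewrite /Cs lerDr.
      by rewrite lerXn2r ?nnegrE// ltW.
  rewrite -/h -/K1 -/K2.
  have := ler_wpM2l (ltW d0) gB; lra.
have all_n i : (i <= n)%N -> \int[P]_w (enorm (err delta m i 0 w) ^+ 2) <= B.
  elim: i => [_|i ih ni].
    under eq_Rintegral do rewrite err_start mul0n /= subrr enorm0 expr0n /=.
    by rewrite mean_cst.
  under eq_Rintegral do rewrite -err_end.
  exact: (block i (ltnW ni) (ih (ltnW ni)) m (leqnn m)).
have := all_n n (leqnn n).
by under eq_Rintegral do rewrite err_start.
Qed.

End CoarseFine.

(** * From the refined schemes to the solution *)

Context (X : 'rV[R]_d -> R -> T -> 'rV[R]_d)
  (hX : forall x : 'rV[R]_d, sde_solution P F f sigma beta x (X x)).

Definition brownian w t : 'rV[R]_d := \sum_(k < K) beta k t w *: sigma k.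

Lemma noise_brownian s t w : noise beta sigma s t w = brownian w t - brownian w s.
Proof. by rewrite /noise /brownian -sumrB; apply: eq_bigr => k _; rewrite -scalerBl. Qed.

Lemma ae_path_solution x : \forall w \ae P,
  path_solution f (brownian w) x (fun t => X x t w) /\ brownian w 0 = 0.
Proof.
have b0 : \forall w \ae P, forall k, beta k 0 w = 0.
  by apply: filter_forall => k; exact: (wiener_start hbeta k).
have sol := hX x.
apply: filterS3 b0 (sde_continuous sol) (sde_equation sol) => w b0 Xc Xe; split.
  by split.
by rewrite /brownian big1// => k _; rewrite b0 scale0r.
Qed.

Lemma solution_measurable x t : 0 <= t -> 
  forall i, measurable_fun [set: T] (fun w => X x t w ord0 i).
Proof.
move=> t0; apply/measurable_borel_rVP => _ A mA; rewrite setTI.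
exact: (uc_measurable hF t0 (sde_adapted (hX x) t0 mA)).
Qed.

Lemma solution_contraction x y t : 0 <= t -> \forall w \ae P,
  enorm (X x t w - X y t w) <= expR (- gamma * t) * enorm (x - y).
Proof.
move=> t0; apply: filterS2 (ae_path_solution x) (ae_path_solution y).
move=> w [Hx _] [Hy _].
exact: (path_contraction gamma0 f_cont f_diss t0 Hx Hy).
Qed.

Lemma solution_start x : \forall w \ae P, X x 0 w = x.
Proof.
apply: filterS (ae_path_solution x) => w [Hx W0].
by rewrite (path_solution0 Hx) W0 addr0.
Qed.

Local Notation euler h := (tamed_euler f sigma beta alpha h).

Lemma ae_euler_cvg x t : 0 <= t -> \forall w \ae P, forall e, 0 < e ->
  exists n0, forall n, (n0 <= n)%N ->
    enorm (euler (t / n.+1%:R) x n.+1 w - X x t w) <= e.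
Proof.
move=> t0; apply: filterS (ae_path_solution x) => w [Hx W0] e e0.
have [n0 H] := path_euler_cvg alpha0 gamma0 f_cont f_diss (ltW M0) f_growth t0 W0 Hx e0.
exists n0 => n n0n; apply: (H n n0n (fun k => euler (t / n.+1%:R) x k w)) => // k.
by rewrite eulerS noise_brownian.
Qed.

Lemma euler_measurable x n h : 0 < h ->
  forall i, measurable_fun [set: T] (fun w => euler h x n w ord0 i).
Proof.
move=> h0; have nh0 : 0 <= n%:R * h by rewrite mulr_ge0// ltW.
apply: (vadapted_measurable hF nh0).
exact: (vadapted_euler hF hbeta).
Qed.

Lemma measurable_enorm_dist (u v : T -> 'rV[R]_d) :
  (forall i, measurable_fun [set: T] (fun w => u w ord0 i)) ->
  (forall i, measurable_fun [set: T] (fun w => v w ord0 i)) ->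
  measurable_fun [set: T] (fun w => enorm (u w - v w)).
Proof.
move=> mu mv; apply: (@measurable_continuous_comp _ _ _ _ (fun w => u w - v w));
  last exact: continuous_enorm.
by move=> i; under eq_fun do rewrite !mxE; exact: measurable_funB.
Qed.

Lemma all_moments_dist (u v : T -> 'rV[R]_d) :
  (forall i, measurable_fun [set: T] (fun w => u w ord0 i)) ->
  (forall i, measurable_fun [set: T] (fun w => v w ord0 i)) ->
  all_moments P (fun w => enorm (u w)) -> all_moments P (fun w => enorm (v w)) ->
  all_moments P (fun w => enorm (u w - v w)).
Proof.
move=> mu mv au av; apply: le_all_moments (all_momentsD au av).
  exact: measurable_enorm_dist.
by move=> w; rewrite !ger0_norm ?addr_ge0 ?enorm_ge0//; exact: enormB.
Qed.

Lemma cvg_of_enorm (u : nat -> 'rV[R]_d) (l : 'rV[R]_d) :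
  (forall e, 0 < e -> exists n0, forall n, (n0 <= n)%N -> enorm (u n - l) <= e) ->
  u @ \oo --> l.
Proof.
move=> H; apply/cvgrPdist_le => e e0; have [n0 Hn] := H e e0.
exists n0 => // n /= n0n; apply: le_trans (mx_norm_le_enorm _) _.
by rewrite enorm_distC Hn.
Qed.

(** Fatou's lemma along the steps [t / (n+1)]. For fixed [t] the horizon condition reads
    [t * h n <= 1] and holds for large [n], so the constant of the scheme is inherited uniformly in
    [t]. *)
Lemma solution_moment x p : exists2 C : R, 0 <= C & forall t, 0 <= t ->
  (\int[P]_w (enorm (X x t w) ^+ p)%:E <= C%:E)%E.
Proof.
have [C C0 HC] := euler_moment hF hbeta sigma alpha0 gamma0 M0 f_growth f_diss f_cont x p.
have cont_pow : continuous (fun v : 'rV[R]_d => enorm v ^+ p).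
  by move=> v; apply: (@continuous_comp _ _ _ (@enorm R d) (fun r => r ^+ p));
    [exact: continuous_enorm|exact: exprn_continuous].
have mX t : 0 <= t -> measurable_fun [set: T] (fun w => enorm (X x t w) ^+ p).
  by move=> t0; exact: (measurable_continuous_comp (solution_measurable x t0) cont_pow).
(* The second summand serves [t = 0], where [t / (n+1)] is not an admissible step. *)
exists (C + enorm x ^+ p); first by nonneg.
move=> t; rewrite le_eqVlt => /predU1P[<-|t0].
  rewrite (_ : integral _ _ _ = (\int[P]_w (enorm x ^+ p)%:E)%E); last first.
    apply: ge0_ae_eq_integral => //.
    - by apply/measurable_EFinP; exact: mX.
    - by move=> w _; rewrite lee_fin; nonneg.
    - by move=> w _; rewrite lee_fin; nonneg.
    - by apply: filterS (solution_start x) => w -> _.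
  by rewrite integral_cst//= probability_setT mule1 lee_fin lerDr.
pose h n : R := t / n.+1%:R.
have h_small : \forall n \near \oo, small_step alpha gamma (h n) /\ n.+1%:R * h n ^+ 2 <= 1.
  pose r := Num.min (Num.min 1 (t^-1)) (Num.min (alpha ^+ 2)^-1 (gamma / 2)^-1).
  have r0 : 0 < r.
    by rewrite !lt_min ltr01 !invr_gt0 t0 exprn_gt0//= divr_gt0.
  have [n0 Hn0] := small_mesh t r0.
  exists n0 => // n /= /Hn0; rewrite -/(h n) !lt_min.
  have hn0 : 0 < h n by rewrite divr_gt0.
  move=> /andP[/andP[h1 h2] /andP[h3 h4]]; split; first split => //.
  - exact: ltW.
  - by rewrite mulrC -ler_pdivlMr ?exprn_gt0// mul1r ltW.
  - by rewrite mulrC -ler_pdivlMr ?divr_gt0// mul1r ltW.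
  have -> : n.+1%:R * h n ^+ 2 = t * h n.
    by rewrite expr2 mulrA /h; congr (_ * _); rewrite mulrC divfK// gt_eqF.
  by rewrite mulrC -ler_pdivlMr// mul1r ltW.
apply: (@fatou_bound _ _ _ _ (fun n w => enorm (euler (h n) x n.+1 w) ^+ p)) => //.
- move=> n; have hn0 : 0 < h n by rewrite divr_gt0.
  exact: (measurable_continuous_comp (euler_measurable x n.+1 hn0) cont_pow).
- by apply: mX; exact: ltW.
- by move=> n w; nonneg.
- by move=> w; nonneg.
- apply: filterS (ae_euler_cvg x (ltW t0)) => w /cvg_of_enorm H.
  exact: (cvg_comp _ _ H (@cont_pow (X x t w))).
- apply: filterS h_small => n [sm nh]; have [h0 h1 _ _] := sm.
  rewrite EFin_mean; last first.
    apply: all_momentsX.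
    by apply: (euler_all_moments hF hbeta sigma alpha0 f_cont x) => //.
  by rewrite lee_fin (le_trans (HC _ _ sm nh))// lerDl; nonneg.
Qed.

Lemma solution_all_moments x t : 0 <= t -> all_moments P (fun w => enorm (X x t w)).
Proof.
move=> t0; apply: all_moments_of_bounds.
  exact: (measurable_continuous_comp (solution_measurable x t0) (@continuous_enorm R d)).
move=> p; have [C _ HC] := solution_moment x p; exists C.
under eq_integral do rewrite ger0_norm ?enorm_ge0//.
exact: HC.
Qed.

Lemma euler_enorm_all_moments x n h : 0 < h -> h <= 1 ->
  all_moments P (fun w => enorm (euler h x n w)).
Proof. by move=> h0 h1; apply: (euler_all_moments hF hbeta sigma alpha0 f_cont x). Qed.

Lemma error_all_moments x n h : 0 < h -> h <= 1 ->
  all_moments P (fun w => enorm (euler h x n w - X x (n%:R * h) w)).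
Proof.
move=> h0 h1; have nh0 : 0 <= n%:R * h by rewrite mulr_ge0// ltW.
apply: all_moments_dist; first exact: euler_measurable.
- exact: solution_measurable.
- exact: euler_enorm_all_moments.
- exact: solution_all_moments.
Qed.

Lemma strong_error x : exists2 C : R, 0 <= C & forall h n, small_step alpha gamma h ->
  3 / 2 * gamma * h <= 1 -> n.+1%:R * h ^+ 2 <= 1 ->
  \int[P]_w (enorm (euler h x n w - X x (n%:R * h) w) ^+ 2) <= C * h ^+ 2.
Proof.
have [C C0 HC] := euler_compare x.
exists (2 * C) => [|h n sm gh nh]; first by nonneg.
have [h0 h1 _ _] := sm.
have nh0 : 0 <= n%:R * h by rewrite mulr_ge0// ltW.
rewrite -lee_fin -EFin_mean; last by apply: all_momentsX; exact: error_all_moments.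
apply: (@fatou_bound _ _ _ _
  (fun m w => enorm (euler h x n w - euler (h / m.+1%:R) x (n * m.+1) w) ^+ 2)) => //.
- move=> m; apply: measurable_funX; apply: measurable_enorm_dist; apply: euler_measurable => //.
  by rewrite divr_gt0.
- apply: measurable_funX; apply: measurable_enorm_dist; first exact: euler_measurable.
  exact: solution_measurable.
- by move=> m w; nonneg.
- by move=> w; nonneg.
(* Pathwise convergence is stated for a positive number of steps, so time 0 is separate. For the
   others, the refinements by [m+1] form a subsequence of the subdivisions of [[0, (n+1) h]]. *)
- case: n nh nh0 => [|n] nh nh0.
    apply: filterS (solution_start x) => w Xx; rewrite mul0r Xx.
    by rewrite (_ : (fun _ => _) = cst (enorm (x - x) ^+ 2)); first exact: cvg_cst.
  apply: filterS (ae_euler_cvg x nh0) => w H.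
  have cont_dist : continuous (fun v : 'rV[R]_d => enorm (euler h x n.+1 w - v) ^+ 2).
    move=> v; apply: (@cvg_comp _ _ _ (fun v => enorm (euler h x n.+1 w - v))
      (fun r => r ^+ 2));
      last exact: exprn_continuous.
    apply: (@cvg_comp _ _ _ (fun v => euler h x n.+1 w - v) (@enorm R d));
      last exact: continuous_enorm.
    exact: (cvgB (cvg_cst _) cvg_id).
  have E : euler (h / m.+1%:R) x (n.+1 * m.+1) w @[m --> \oo] --> X x (n.+1%:R * h) w.
    apply: cvg_of_enorm => e /H [n0 Hn0]; exists n0 => m n0m.
    have := Hn0 (n.+1 * m.+1).-1; rewrite prednK ?muln_gt0// => /(_ _).
    have -> : n.+1%:R * h / (n.+1 * m.+1)%:R = h / m.+1%:R.
      by rewrite natrM -mulf_div divff ?mul1r// pnatr_eq0.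
    apply; rewrite (leq_trans n0m)// -ltnS prednK ?muln_gt0//.
    by rewrite mulSn ltn_addr.
  exact: (cvg_comp _ _ E (@cont_dist _)).
(* Once [1 / (m+1) < h^2], the term [delta] of the comparison is itself below [h^2], whence the
   factor 2 in the constant. *)
- have [m0 Hm0] := small_mesh 1 (exprn_gt0 2 h0).
  exists m0 => // m /= /Hm0 hm; rewrite EFin_mean; last first.
    apply: all_momentsX; apply: all_moments_dist; try exact: euler_measurable.
    - by apply: euler_measurable; rewrite divr_gt0.
    - exact: euler_enorm_all_moments.
    - apply: euler_enorm_all_moments; first by rewrite divr_gt0.
      by rewrite ler_pdivrMr// mul1r (le_trans h1)// ?ler1n.
  have delta0 : 0 < h / m.+1%:R by rewrite divr_gt0.
  have mh : m.+1%:R * (h / m.+1%:R) = h by rewrite mulrC divfK// pnatr_eq0.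
  have deltah : h / m.+1%:R <= h by rewrite ler_pdivrMr// ler_peMr ?ler1n ?ltW.
  have := HC (h / m.+1%:R) m.+1 n delta0 isT; rewrite mh => /(_ sm).
  rewrite lee_fin; under eq_Rintegral do rewrite enorm_distC.
  move=> H; apply: le_trans (H _ nh) _.
    by apply: le_trans gh; rewrite ler_wpM2l// ?mulr_ge0// ltW.
  have hm2 : h / m.+1%:R <= h ^+ 2.
    by apply: le_trans (ltW hm); rewrite ler_wpM2r// invr_ge0.
  by rewrite [2 * C]mulrC -mulrA ler_wpM2l// mulr_natl mulr2n lerD2l.
Qed.

(** * From the mean-square error to the weak error *)

Section WeakError.
Context (psi : 'rV[R]_d -> R) (M' : R) (r : nat).
Context (M'0 : 0 < M') (psi_cont : continuous psi).
Context (psi_growth : forall x, `|psi x| <= M' * (1 + enorm x ^+ r)).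
Context (psi_lip : forall x y, `|psi y - psi x| <=
  M' * (1 + enorm x ^+ r + enorm y ^+ r) * enorm (y - x)).

Lemma all_moments_growth (u : T -> 'rV[R]_d) :
  (forall i, measurable_fun [set: T] (fun w => u w ord0 i)) ->
  all_moments P (fun w => enorm (u w)) -> all_moments P (fun w => psi (u w)).
Proof.
move=> mu au.
apply: le_all_moments (all_momentsZ M' (all_momentsD (all_moments_cst P 1)
  (all_momentsX r au))).
  exact: measurable_continuous_comp mu psi_cont.
move=> w; apply: le_trans (psi_growth _) _; exact: ler_norm.
Qed.

(** Young's inequality with the weight [h] in place of the Cauchy-Schwarz inequality: a mean-square
    error of order [h^2] is divided by [2 h], and the moments of the local Lipschitz constant are
    multiplied by [h]. *)
Lemma mean_difference_le (u v : T -> 'rV[R]_d) h : 0 < h ->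
  (forall i, measurable_fun [set: T] (fun w => u w ord0 i)) ->
  (forall i, measurable_fun [set: T] (fun w => v w ord0 i)) ->
  all_moments P (fun w => enorm (u w)) -> all_moments P (fun w => enorm (v w)) ->
  `|\int[P]_w psi (u w) - \int[P]_w psi (v w)| <=
  M' * (3 / 2 * h * (1 + \int[P]_w (enorm (u w) ^+ (r * 2)) +
                         \int[P]_w (enorm (v w) ^+ (r * 2))) +
        (2 * h)^-1 * \int[P]_w (enorm (u w - v w) ^+ 2)).
Proof.
move=> h0 mu mv au av.
have aun := all_momentsX (r * 2) au; have avn := all_momentsX (r * 2) av.
have ad := all_momentsX 2 (all_moments_dist mu mv au av).
have pu := all_moments_growth mu au; have pv := all_moments_growth mv av.
have a1 := all_momentsD (all_momentsD (all_moments_cst P 1) aun) avn.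
have a2 := all_momentsD (all_momentsZ (3 / 2 * h) a1) (all_momentsZ (2 * h)^-1 ad).
have a3 := all_momentsZ M' a2.
have -> : M' * (3 / 2 * h * (1 + \int[P]_w (enorm (u w) ^+ (r * 2)) +
                         \int[P]_w (enorm (v w) ^+ (r * 2))) +
        (2 * h)^-1 * \int[P]_w (enorm (u w - v w) ^+ 2)) =
  \int[P]_w (M' * (3 / 2 * h * (1 + enorm (u w) ^+ (r * 2) + enorm (v w) ^+ (r * 2)) +
    (2 * h)^-1 * enorm (u w - v w) ^+ 2)).
  rewrite meanZ// meanD; [|exact: all_momentsZ|exact: all_momentsZ].
  rewrite !meanZ// !meanD ?mean_cst//; first exact: all_moments_cst.
  by apply: all_momentsD => //; exact: all_moments_cst.
have key w : `|psi (u w) - psi (v w)| <=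
   M' * (3 / 2 * h * (1 + enorm (u w) ^+ (r * 2) + enorm (v w) ^+ (r * 2)) +
    (2 * h)^-1 * enorm (u w - v w) ^+ 2).
  apply: le_trans (psi_lip _ _) _; rewrite -mulrA ler_wpM2l ?(ltW M'0)// !exprM.
  set a := enorm (v w) ^+ r; set b := enorm (u w) ^+ r; set c := enorm (u w - v w).
  rewrite -(ler_pM2l (mulr_gt0 (ltr0n R 2) h0)).
  rewrite [leRHS](_ : _ = h ^+ 2 * (3 * (1 + b ^+ 2 + a ^+ 2)) + c ^+ 2); last first.
    by field; rewrite gt_eqF.
  have H1 := sqr_ge0 (c - h * (1 + a + b)).
  have H2 : (1 + a + b) ^+ 2 <= 3 * (1 + b ^+ 2 + a ^+ 2).
    have := sqr_ge0 (a - b); have := sqr_ge0 (a - 1); have := sqr_ge0 (b - 1); nra.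
  have H3 := ler_wpM2l (sqr_ge0 h) H2; lra.
rewrite -[X in `|X|](_ : \int[P]_w (psi (u w) + -1 * psi (v w)) = _); last first.
  rewrite meanD//; last exact: all_momentsZ.
  by rewrite meanZ// mulN1r.
have aD := all_momentsD pu (all_momentsZ (-1) pv).
rewrite ler_norml; apply/andP; split; last first.
  by apply: mean_le => // w; apply: le_trans (key w); rewrite mulN1r ler_norm.
rewrite -[leLHS]mulN1r -meanZ//; apply: mean_le => //; first exact: all_momentsZ.
move=> w; have := key w; rewrite ler_norml => /andP[+ _].
by rewrite !mulN1r.
Qed.

Lemma weak_error x : exists2 C : R, 0 <= C & forall h n, small_step alpha gamma h ->
  3 / 2 * gamma * h <= 1 -> n.+1%:R * h ^+ 2 <= 1 ->
  `|\int[P]_w psi (euler h x n w) - \int[P]_w psi (X x (n%:R * h) w)| <= C * h.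
Proof.
have [C1 C10 HC1] := euler_moment hF hbeta sigma alpha0 gamma0 M0 f_growth f_diss f_cont x
  (r * 2).
have [C2 C20 HC2] := solution_moment x (r * 2).
have [C3 C30 HC3] := strong_error x.
exists (M' * (3 / 2 * (1 + C1 + C2) + C3 / 2)) => [|h n sm gh nh]; first by nonneg.
have [h0 h1 _ _] := sm.
have nh0 : 0 <= n%:R * h by rewrite mulr_ge0// ltW.
have nh' : n%:R * h ^+ 2 <= 1.
  by apply: le_trans nh; rewrite ler_wpM2r// ?sqr_ge0// ler_nat.
have B1 := HC1 h n sm nh'.
have B2 : \int[P]_w (enorm (X x (n%:R * h) w) ^+ (r * 2)) <= C2.
  rewrite -lee_fin -EFin_mean; first exact: HC2.
  by apply: all_momentsX; exact: solution_all_moments.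
have B3 := HC3 h n sm gh nh.
apply: le_trans (mean_difference_le h0 _ _ _ _) _.
- exact: euler_measurable.
- exact: solution_measurable.
- exact: euler_enorm_all_moments.
- exact: solution_all_moments.
rewrite -[leRHS]mulrA ler_wpM2l ?(ltW M'0)// [leRHS]mulrDl; apply: lerD.
  rewrite mulrAC ler_wpM2r ?(ltW h0)// ler_wpM2l ?divr_ge0//.
  by rewrite lerD// lerD.
rewrite ler_pdivrMl ?mulr_gt0//; apply: le_trans B3 _.
by have -> : 2 * h * (C3 / 2 * h) = C3 * h ^+ 2 by field.
Qed.

End WeakError.
End Comparison.

(** * Integration against the invariant distribution *)

Section TransitionKernel.
Context {disp : measure_display} {T : measurableType disp} {R : realType}.
Context {P : probability T R} {d : nat}.

Lemma le_measure_ae (A B : set T) : measurable A -> measurable B ->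
  (\forall w \ae P, A w -> B w) -> (P A <= P B)%E.
Proof.
move=> mA mB [N [mN N0 sub]].
rewrite -(measureU0 mB mN N0); apply: le_measure; rewrite ?inE//.
  exact: measurableU.
move=> w Aw; have [Nw|Nw] := pselect (N w); [by right|left].
by apply: contrapT => nB; apply: Nw; apply: sub => /= /(_ Aw).
Qed.

Context (Y : 'rV[R]_d -> T -> 'rV[R]_d).
Context (Y_meas : forall x i, measurable_fun [set: T] (fun w => Y x w ord0 i)).
Context (Y_lip : forall x y, \forall w \ae P, enorm (Y x w - Y y w) <= enorm (x - y)).

Let Y_preimage x (A : set (borel_rV R d)) : measurable A -> measurable (Y x @^-1` A).
Proof.
move=> mA; have /measurable_borel_rVP /(_ measurableT _ mA) := Y_meas x.
by rewrite setTI.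
Qed.

(* A point of [core U k] stays in [U] when moved by less than 1/(k+1), so that
   [P (Y x @^-1` core U k) <= P (Y y @^-1` U)] for [y] close to [x]. *)
Let core (U : set 'rV[R]_d) (k : nat) := ~` \bigcup_(u in ~` U) ball u k.+1%:R^-1.

Lemma open_transition_lsc U : open U ->
  lower_semicontinuous (fun x : 'rV[R]_d => P (Y x @^-1` U)).
Proof.
move=> oU x a aU.
have mU : measurable (U : set (borel_rV R d)) by exact: sub_sigma_algebra.
have mcore k : measurable (core U k : set (borel_rV R d)).
  apply: measurableC; apply: sub_sigma_algebra.
  by apply: bigcup_open => u _; exact: ball_open.
have coreU : \bigcup_k (Y x @^-1` core U k) = Y x @^-1` U.
  apply/seteqP; split => w /=.
    move=> [k _ /= H]; apply: contrapT => nU; apply: H; exists (Y x w) => //.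
    exact: ballxx.
  move=> Uw; have : nbhs (Y x w) U by exact: open_nbhs_nbhs.
  move=> /nbhs_ballP [e /= e0 He]; have [k0 /(_ k0 (leqnn _)) Hk] := small_mesh 1 e0.
  exists k0 => // -[u nU /ball_sym b]; apply: nU; apply: He.
  by apply: le_ball b; rewrite -[leLHS]mul1r ltW.
have core_cvg : P (Y x @^-1` core U k) @[k --> \oo] --> P (Y x @^-1` U).
  rewrite -coreU; apply: nondecreasing_cvg_mu.
  - by move=> k; exact: Y_preimage.
  - by apply: bigcup_measurable => k _; exact: Y_preimage.
  - move=> m n mn; apply/subsetPset => w /= H [u nU b]; apply: H; exists u => //.
    by apply: le_ball b; rewrite lef_pV2 ?posrE// ler_nat.
have [k ak] : exists k, (a%:E < P (Y x @^-1` core U k))%E.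
  apply: contrapT => H; move: aU; apply/negP; rewrite -leNgt.
  have <- := cvg_lim (@ereal_hausdorff R) core_cvg.
  apply: lime_le; first by apply: cvgP core_cvg.
  by apply: nearW => k; rewrite leNgt; apply/negP => ak; apply: H; exists k.
have dist_cont : enorm (x - y) @[y --> x] --> enorm (x - x).
  apply: (@cvg_comp _ _ _ (fun y => x - y) (@enorm R d)); last exact: continuous_enorm.
  exact: (cvgB (cvg_cst _) cvg_id).
exists [set y | enorm (x - y) < k.+1%:R^-1].
  move/cvgrPdist_lt : dist_cont => /(_ k.+1%:R^-1); rewrite invr_gt0 => /(_ (ltr0Sn _ _)).
  apply: filterS => y; rewrite subrr enorm0 sub0r normrN /=.
  by apply: le_lt_trans; exact: ler_norm.
move=> y /= xy; apply: lt_le_trans ak _.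
apply: le_measure_ae; [exact: Y_preimage|exact: Y_preimage|].
apply: filterS (Y_lip x y) => w xyw /= H; apply: contrapT => nU; apply: H.
exists (Y y w) => //; rewrite -ball_normE /= distrC.
by apply: le_lt_trans (mx_norm_le_enorm _) _; apply: le_lt_trans xyw xy.
Qed.

(** Lower semicontinuity settles open sets, which are stable under intersection, and Dynkin's
    theorem extends this to Borel sets. The transition probabilities thereby form a kernel. *)
Lemma transition_measurable (A : set (borel_rV R d)) : measurable A ->
  measurable_fun [set: borel_rV R d] (fun x => P (Y x @^-1` A)).
Proof.
pose Q (A : set (borel_rV R d)) :=
  measurable A /\ measurable_fun [set: borel_rV R d] (fun x => P (Y x @^-1` A)).
move=> mA; suff : Q A by case.
apply: (@dynkin_induction _ (borel_rV R d) (@open 'rV[R]_d)) => //.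
- by move=> U V; exact: openI.
- split => //; rewrite (_ : (fun _ => _) = cst 1%E) => [|]; first exact: measurable_cst.
  by apply/funext => x; rewrite preimage_setT probability_setT.
- move=> U oU; split; first exact: sub_sigma_algebra.
  apply: (measurability _ (ErealGenOInfty.measurableE R)).
  move=> /= _ [_ [a ->]] <-; apply: measurableI => //; apply: sub_sigma_algebra.
  rewrite preimage_itvoy.
  by have /lower_semicontinuousP := open_transition_lsc oU; exact.
- move=> S mS [_ QS]; split; first exact: measurableC.
  rewrite (_ : (fun _ => _) = fun x => (1 - P (Y x @^-1` S))%E).
    by apply: emeasurable_funB => //; exact: measurable_cst.
  by apply/funext => x; rewrite preimage_setC probability_setC//; exact: Y_preimage.
- move=> S mS tS QS; split; first exact: bigcup_measurable.
  rewrite (_ : (fun _ => _) = fun x => (\sum_(0 <= n <oo) P (Y x @^-1` S n))%E).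
    by apply: ge0_emeasurable_sum => // n; have [] := QS n.
  apply/funext => x; rewrite preimage_bigcup measure_bigcup//.
  - by apply: eq_eseriesl => n; rewrite in_setT.
  - by move=> n _; exact: Y_preimage.
  - apply/trivIsetP => i j _ _ ij; rewrite -preimage_setI.
    by move/trivIsetP : tS => ->//; rewrite preimage_set0.
Qed.

Context (mu : probability (borel_rV R d) R).
Context (mu_inv : forall A : set (borel_rV R d), measurable A ->
  (\int[mu]_x P (Y x @^-1` A) = mu A)%E).

Let law x : probability (borel_rV R d) R :=
  distribution P (HB.pack_for {mfun T >-> borel_rV R d} (Y x)
    (isMeasurableFun.Build _ _ _ _ _ (proj1 (measurable_borel_rVP (Y x)) (Y_meas x)))).

Let integral_law x (g : borel_rV R d -> \bar R) : (forall y, (0 <= g y)%E) ->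
  measurable_fun [set: borel_rV R d] g ->
  (\int[law x]_y g y = \int[P]_w g (Y x w))%E.
Proof. by move=> g0 mg; rewrite ge0_integral_distribution. Qed.

Lemma measurable_transition_integral (g : borel_rV R d -> \bar R) :
  (forall y, (0 <= g y)%E) -> measurable_fun [set: borel_rV R d] g ->
  measurable_fun [set: borel_rV R d] (fun x => \int[P]_w g (Y x w))%E.
Proof.
move=> g0 mg; under eq_fun do rewrite -integral_law//.
apply: measurable_fun_integral_kernel => // U mU.
exact: transition_measurable.
Qed.

(** Invariance on sets says that [mu] composed with the transition kernel is [mu]; the claim is the
    integral formula for a composed kernel. *)
Lemma invariant_integral (g : borel_rV R d -> \bar R) :
  (forall y, (0 <= g y)%E) -> measurable_fun [set: borel_rV R d] g ->
  (\int[mu]_x g x = \int[mu]_x \int[P]_w g (Y x w))%E.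
Proof.
move=> g0 mg.
(* Composition is an operation on kernels, so [mu] is seen as a kernel with source [unit], and the
   transition kernel carries a dummy first argument. *)
pose lawP (z : unit * borel_rV R d) : pprobability (borel_rV R d) R := law z.2.
have mlawP : measurable_fun [set: unit * borel_rV R d] lawP.
  apply: (measurability (@pset _ _ _ : set (set (pprobability (borel_rV R d) R)))) => //.
  move=> _ -[_ [r r01] [U mU <-]] <-.
  rewrite setTI /lawP.
  have mt : measurable_fun [set: unit * borel_rV R d] (fun z => P (Y z.2 @^-1` U)).
    exact: (measurableT_comp (transition_measurable mU) measurable_snd).
  by have := emeasurable_fun_infty_o measurableT mt r%:E; rewrite setTI.
have mmu : measurable_fun [set: unit] (fun _ : unit => mu : pprobability (borel_rV R d) R).
  exact: measurable_cst.
have := @integral_kcomp _ _ _ unit (borel_rV R d) (borel_rV R d) R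
  (kprobability mmu) (kprobability mlawP) tt g g0 mg.
rewrite (_ : (\int[kcomp _ _ _]_z g z = \int[mu]_z g z)%E); last first.
  by apply: eq_measure_integral => A mA _; rewrite /kcomp /=; exact: mu_inv.
move=> ->; apply: eq_integral => x _; exact: integral_law.
Qed.
End TransitionKernel.

(** * Moments of the invariant distribution and exponential convergence *)

Section InvariantDistribution.
Context {disp : measure_display} {T : measurableType disp} {R : realType}.
Context {P : probability T R} {d : nat} (X : 'rV[R]_d -> R -> T -> 'rV[R]_d) (gamma : R).
Context (gamma0 : 0 < gamma).
Context (X_meas : forall x t, 0 <= t ->
  forall i, measurable_fun [set: T] (fun w => X x t w ord0 i)).
Context (X_contraction : forall x y t, 0 <= t -> \forall w \ae P,
  enorm (X x t w - X y t w) <= expR (- gamma * t) * enorm (x - y)).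
Context (X_moment : forall x p, exists2 C : R, 0 <= C & forall t, 0 <= t ->
  (\int[P]_w (enorm (X x t w) ^+ p)%:E <= C%:E)%E).
Context (X_all_moments : forall x t, 0 <= t -> all_moments P (fun w => enorm (X x t w))).
Context (mu : probability (borel_rV R d) R) (mu_inv : invariant_distribution P X mu).

Lemma invariant_integral_at t (g : borel_rV R d -> \bar R) : 0 <= t ->
  (forall y, (0 <= g y)%E) -> measurable_fun [set: borel_rV R d] g ->
  measurable_fun [set: borel_rV R d] (fun x => \int[P]_w g (X x t w))%E /\
  (\int[mu]_x g x = \int[mu]_x \int[P]_w g (X x t w))%E.
Proof.
move=> t0 g0 mg.
have Y_meas x := X_meas x t0.
have Y_lip x y : \forall w \ae P, enorm (X x t w - X y t w) <= enorm (x - y).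
  apply: filterS (X_contraction x y t0) => w /le_trans; apply.
  by rewrite ler_piMl ?enorm_ge0// -expR0 ler_expR mulNr oppr_le0; nonneg.
split; first exact: (measurable_transition_integral Y_meas Y_lip).
apply: (invariant_integral Y_meas Y_lip) => // A mA; exact: mu_inv.
Qed.

Lemma enorm_borel_measurable : measurable_fun [set: borel_rV R d] (@enorm R d).
Proof. by apply: continuous_borel_measurable; exact: continuous_enorm. Qed.

(* By contraction the law of [X x t] forgets [x] as [t] grows, up to a term which the
   truncation makes integrable without any knowledge of [mu]. *)
Lemma truncated_moment_le x0 p (m : nat) C : 
  (forall t, 0 <= t -> (\int[P]_w (enorm (X x0 t w) ^+ p.+1)%:E <= C%:E)%E) ->
  (\int[mu]_x (Num.min m%:R (enorm x ^+ p.+1))%:E <= (2 ^+ p.+1 * C)%:E)%E.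
Proof.
move=> HC.
(* The truncation at [m] is the dominating function when [t] tends to infinity; the exponent [p.+1]
   is positive, without which [B t x] would not tend to 0. *)
pose B t x : R := Num.min m%:R (2 ^+ p.+1 * (expR (- gamma * t) * enorm (x - x0)) ^+ p.+1).
have B0 t x : 0 <= B t x by rewrite /B le_min ler0n; nonneg.
have mdist : measurable_fun [set: borel_rV R d] (fun x => enorm ((x : 'rV[R]_d) - x0)).
  apply: continuous_borel_measurable => x.
  apply: (@cvg_comp _ _ _ (fun y => y - x0) (@enorm R d)); last exact: continuous_enorm.
  exact: (cvgB cvg_id (cvg_cst _)).
have mB t : measurable_fun [set: borel_rV R d] (B t).
  apply: measurable_minr => //; apply: measurable_funM => //; apply: measurable_funX.
  exact: measurable_funM.
have m0 y : 0 <= Num.min m%:R (enorm (y : 'rV[R]_d) ^+ p.+1)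
  by rewrite le_min ler0n exprn_ge0 ?enorm_ge0.
have mmin : measurable_fun [set: borel_rV R d] (fun x => Num.min m%:R (enorm x ^+ p.+1)).
  by apply: measurable_minr => //; apply: measurable_funX; exact: enorm_borel_measurable.
have pointwise t x : 0 <= t ->
    (\int[P]_w (Num.min m%:R (enorm (X x t w) ^+ p.+1))%:E <= (2 ^+ p.+1 * C + B t x)%:E)%E.
  move=> t0.
  have ax := all_momentsD (all_momentsZ (2 ^+ p.+1) (all_momentsX p.+1 (X_all_moments x0 t0)))
    (all_moments_cst P (B t x)).
  apply: (@le_trans _ _ (\int[P]_w (2 ^+ p.+1 * enorm (X x0 t w) ^+ p.+1 + B t x)%:E)%E).
    apply: ae_ge0_le_integral => //.
    - by move=> w _; rewrite lee_fin.
    - apply/measurable_EFinP; apply: measurable_minr => //; apply: measurable_funX.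
      exact: (all_moments_measurable (X_all_moments x t0)).
    - by move=> w _; rewrite lee_fin addr_ge0//; nonneg.
    - by apply/measurable_EFinP; exact: (all_moments_measurable ax).
    apply: filterS (X_contraction x x0 t0) => w xw _; rewrite lee_fin.
    have : enorm (X x t w) <= enorm (X x0 t w) + expR (- gamma * t) * enorm (x - x0).
      by apply: le_trans (enorm_dist_triangle _ (X x0 t w)) _; rewrite lerD2l.
    set u := enorm (X x t w); set v := enorm (X x0 t w); rewrite /B; set z := _ * enorm _.
    move=> uvz; have u0 : 0 <= u by exact: enorm_ge0.
    have v0 : 0 <= v by exact: enorm_ge0.
    have z0 : 0 <= z by rewrite /z; nonneg.
    have H : u ^+ p.+1 <= 2 ^+ p.+1 * v ^+ p.+1 + 2 ^+ p.+1 * z ^+ p.+1.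
      rewrite -mulrDr; apply: le_trans (expr_sum_le p.+1 v0 z0).
      by rewrite lerXn2r// nnegrE// addr_ge0.
    have s0 : 0 <= 2 ^+ p.+1 * v ^+ p.+1 by nonneg.
    have m_ge0 : 0 <= m%:R :> R by [].
    case: (leP (m%:R : R) (u ^+ p.+1)) => ?; case: (leP (m%:R : R)
      (2 ^+ p.+1 * z ^+ p.+1)) => ?; lra.
  rewrite EFin_mean// lee_fin meanD;
    [|exact/all_momentsZ/all_momentsX/X_all_moments|exact: all_moments_cst].
  rewrite mean_cst lerD2r meanZ; last exact/all_momentsX/X_all_moments.
  rewrite ler_wpM2l ?exprn_ge0// -lee_fin -EFin_mean; first exact: HC.
  exact/all_momentsX/X_all_moments.
have C0 : 0 <= C.
  rewrite -lee_fin; apply: le_trans (HC 0 (lexx _)).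
  by apply: integral_ge0 => w _; rewrite lee_fin; nonneg.
have step t : 0 <= t ->
    (\int[mu]_x (Num.min m%:R (enorm x ^+ p.+1))%:E <=
     (2 ^+ p.+1 * C)%:E + \int[mu]_x (B t x)%:E)%E.
  move=> t0; pose g (y : borel_rV R d) := (Num.min m%:R (enorm y ^+ p.+1))%:E.
  have g0 y : (0 <= g y)%E by rewrite lee_fin.
  have mg : measurable_fun [set: borel_rV R d] g by exact/measurable_EFinP.
  have [mG GE] := invariant_integral_at t0 g0 mg; rewrite [leLHS]GE.
  apply: (@le_trans _ _ (\int[mu]_x (2 ^+ p.+1 * C + B t x)%:E)%E).
    apply: ge0_le_integral => //.
    - by move=> x _; apply: integral_ge0 => w _; rewrite lee_fin.
    - by apply/measurable_EFinP; exact: measurable_funD.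
    - by move=> x _; exact: pointwise.
  under eq_integral do rewrite EFinD.
  rewrite ge0_integralD//; last first.
  - exact/measurable_EFinP.
  - by move=> x _; rewrite lee_fin.
  - by move=> x _; rewrite lee_fin; nonneg.
  by rewrite integral_cst//= probability_setT mule1.
have e1 : expR (- gamma) < 1 by rewrite -expR0 ltr_expR oppr_lt0.
have decay x : B n%:R x @[n --> \oo] --> 0.
  have geo := cvg_geometric (2 ^+ p.+1 * enorm (x - x0) ^+ p.+1)
    (_ : `|expR (- gamma)| < 1).
  apply: (squeeze_cvgr _ (cvg_cst 0) (geo _)); last by rewrite ger0_norm// expR_ge0.
  apply: nearW => n; rewrite B0 /=.
  rewrite /B ge_min; apply/orP; right.
  rewrite -mulrA ler_wpM2l ?exprn_ge0// exprMn mulrC ler_wpM2l ?exprn_ge0 ?enorm_ge0//.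
  have -> : - gamma * n%:R = n%:R * (- gamma) by rewrite mulrC.
  rewrite expRM_natl exprS ler_piMr ?exprn_ge0 ?expR_ge0//.
  by rewrite !exprn_ile1 ?exprn_ge0 ?expR_ge0 ?ltW.
have lim : (\int[mu]_x (B n%:R x)%:E @[n --> \oo] --> \int[mu]_x (cst 0 x : \bar R))%E.
  apply: (@dominated_cvg _ _ _ mu setT measurableT _ _ (cst m%:R%:E)) => //.
  - by move=> n; apply/measurable_EFinP.
  - by move=> x _; apply: cvg_EFin; [exact: nearW|exact: decay].
  - have := all_moments_integrable (all_moments_cst mu m%:R); by [].
  - by move=> n x _; rewrite /= lee_fin ger0_norm// /B ge_min lexx.
rewrite integral0 in lim.
have : ((2 ^+ p.+1 * C)%:E + \int[mu]_x (B n%:R x)%:E @[n --> \oo] -->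
  (2 ^+ p.+1 * C)%:E + 0)%E.
  by apply: cvgeD => //; exact: cvg_cst.
rewrite adde0 => H; have <- := cvg_lim (@ereal_hausdorff R) H.
apply: lime_ge; first by apply: cvgP H.
by apply: nearW => n; exact: step.
Qed.

(** The truncated moments are bounded independently of the level [m], so Fatou's lemma removes the
    truncation. The point [x0] is only a reference from which a solution with bounded moments
    starts. *)
Lemma invariant_all_moments (x0 : 'rV[R]_d) : all_moments mu (@enorm R d).
Proof.
apply: all_moments_of_bounds; first exact: enorm_borel_measurable.
case=> [|p].
  by exists 1; under eq_integral do rewrite expr0; rewrite integral_cst//= probability_setT mule1.
have [C C0 HC] := X_moment x0 p.+1; exists (2 ^+ p.+1 * C).
have mX : measurable_fun [set: borel_rV R d] (fun x => enorm x ^+ p.+1).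
  by apply: measurable_funX; exact: enorm_borel_measurable.
under eq_integral do rewrite ger0_norm ?enorm_ge0//.
apply: (@fatou_bound _ _ _ mu (fun m x => Num.min m%:R (enorm x ^+ p.+1))) => //.
- by move=> m; exact: measurable_minr.
- by move=> m x; rewrite le_min ler0n; nonneg.
- by move=> x; nonneg.
- apply: aeW => x; apply: (@cvg_near_cst _ _ _ _ _ _).
  have := truncnS_gt (enorm x ^+ p.+1); set N := Num.truncn _ => HN.
  exists N.+1 => // n /= Nn; apply: min_r.
  by rewrite (le_trans (ltW HN))// ler_nat.
- by apply: nearW => m; exact: (@truncated_moment_le x0 p m C HC).
Qed.

Section Observable.
Context (psi : 'rV[R]_d -> R) (M : R) (r : nat) (M0 : 0 < M) (psi_cont : continuous psi).
Context (psi_growth : forall x, `|psi x| <= M * (1 + enorm x ^+ r)).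
Context (psi_lip : forall x y, `|psi y - psi x| <=
  M * (1 + enorm x ^+ r + enorm y ^+ r) * enorm (y - x)).

Lemma observable_all_moments (x0 : 'rV[R]_d) : all_moments mu psi.
Proof.
apply: (@all_moments_growth _ (borel_rV R d) _ mu _ psi M r psi_cont psi_growth id).
  by move=> i; apply: continuous_borel_measurable; exact: coord_continuous.
exact: invariant_all_moments.
Qed.

Let solution_psi x t : 0 <= t -> all_moments P (fun w => psi (X x t w)).
Proof.
move=> t0; apply: (all_moments_growth psi_cont psi_growth); first exact: X_meas.
exact: X_all_moments.
Qed.

(** Polynomial in the distance [D] of the starting points, hence integrable in [x] against a measure
    with all moments. *)
Let spread (C : R) (D : R) : R := M * (1 + (1 + 2 ^+ r) * C + 2 ^+ r * D ^+ r) * D.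

(** The two solutions share their noise, so their distance is at most [eps * D] almost surely. This
    replaces one solution by the other in the local Lipschitz constant as well, and [C] refers to
    the solution from [x0] alone. *)
Lemma transition_spread x x0 t C : 0 <= t ->
  (\int[P]_w (enorm (X x0 t w) ^+ r)%:E <= C%:E)%E ->
  `|\int[P]_w psi (X x t w) - \int[P]_w psi (X x0 t w)| <=
  expR (- gamma * t) * spread C (enorm (x - x0)).
Proof.
move=> t0 HC; set D := enorm (x - x0); set eps := expR _.
have D0 : 0 <= D by exact: enorm_ge0.
have eps0 : 0 <= eps by exact: expR_ge0.
have eps1 : eps <= 1 by rewrite -expR0 ler_expR mulNr oppr_le0; nonneg.
have amom := all_momentsX r (X_all_moments x0 t0).
have HC' : \int[P]_w (enorm (X x0 t w) ^+ r) <= C by rewrite -lee_fin -EFin_mean.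
pose c := M * (eps * D).
have c0 : 0 <= c by rewrite /c; nonneg.
pose Z w := c * (1 + 2 ^+ r * D ^+ r + (1 + 2 ^+ r) * enorm (X x0 t w) ^+ r).
have aS := all_momentsD (all_moments_cst P (1 + 2 ^+ r * D ^+ r)) (all_momentsZ
  (1 + 2 ^+ r) amom).
have aZ : all_moments P Z := all_momentsZ c aS.
have ZE : \int[P]_w Z w <= eps * spread C D.
  rewrite meanZ// meanD; [|exact: all_moments_cst|exact: all_momentsZ].
  rewrite mean_cst meanZ//.
  have -> : eps * spread C D = c * (1 + 2 ^+ r * D ^+ r + (1 + 2 ^+ r) * C).
    by rewrite /spread /c; ring.
  apply: ler_wpM2l => //; rewrite lerD2l; exact: ler_wpM2l.
have key : \forall w \ae P, `|psi (X x t w) - psi (X x0 t w)| <= Z w.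
  apply: filterS (X_contraction x x0 t0) => w; rewrite -/eps -/D => xw.
  apply: le_trans (psi_lip _ _) _; rewrite /Z /c.
  have H : enorm (X x t w) <= enorm (X x0 t w) + D.
    apply: le_trans (enorm_dist_triangle _ (X x0 t w)) _; rewrite lerD2l.
    by apply: le_trans xw _; rewrite ler_piMl.
  have Hr : enorm (X x t w) ^+ r <= 2 ^+ r * (enorm (X x0 t w) ^+ r + D ^+ r).
    apply: le_trans (expr_sum_le r (enorm_ge0 _) D0).
    by rewrite lerXn2r// nnegrE ?enorm_ge0// addr_ge0 ?enorm_ge0.
  rewrite [leRHS](_ : _ = M * (1 + enorm (X x0 t w) ^+ r +
     2 ^+ r * (enorm (X x0 t w) ^+ r + D ^+ r)) * (eps * D)); last by ring.
  apply: ler_pM => //; [by nonneg|by nonneg|].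
  by apply: ler_wpM2l; [exact: ltW|rewrite lerD2l].
have px := solution_psi x t0; have px0 := solution_psi x0 t0.
rewrite ler_norml; apply/andP; split.
  rewrite lerBrDl lerBlDr; apply: le_trans (lerD (lexx _) ZE).
  rewrite -meanD//; apply: mean_le_ae => //; first exact: all_momentsD.
  by apply: filterS key => w; rewrite ler_norml => /andP[+ _]; rewrite lerBrDl lerBlDr.
rewrite lerBlDl; apply: le_trans (lerD (lexx _) ZE).
rewrite -meanD//; apply: mean_le_ae => //; first exact: all_momentsD.
by apply: filterS key => w; rewrite ler_norml => /andP[_]; rewrite lerBlDl.
Qed.

(** Invariance turns the integral of [psi] into that of its transition [G], whose distance to [G x0]
    is at most [eps * S x]; the constant is the integral of [S]. Invariance is available here for
    nonnegative functions, whence the sign condition. *)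
Lemma ergodic_nonneg x0 : (forall x, 0 <= psi x) -> exists2 C : R, 0 <= C &
  forall t, 0 <= t -> `|\int[P]_w psi (X x0 t w) - \int[mu]_x psi x| <=
    C * expR (- gamma * t).
Proof.
move=> psi0; have [C C0 HC] := X_moment x0 r.
pose S (x : borel_rV R d) := spread C (enorm ((x : 'rV[R]_d) - x0)).
have S0 x : 0 <= S x by rewrite /S /spread; nonneg.
have aD : all_moments mu (fun x => enorm ((x : 'rV[R]_d) - x0)).
  have cst_meas i : measurable_fun [set: borel_rV R d] (fun=> x0 ord0 i)
    by exact: measurable_cst.
  apply: (all_moments_dist (P := mu) (u := id) (v := fun=> x0)) => //.
  - by move=> i; apply: continuous_borel_measurable; exact: coord_continuous.
  - exact: invariant_all_moments.
  - exact: all_moments_cst.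
have aS : all_moments mu S.
  apply: all_momentsM => //; apply: all_momentsZ; apply: all_momentsD;
    first exact: all_moments_cst.
  by apply: all_momentsZ; exact: all_momentsX.
exists (\int[mu]_x S x) => [|t t0].
  by rewrite -(mean_cst mu 0); apply: mean_le => //; exact: all_moments_cst.
set eps := expR _; have eps0 : 0 <= eps by exact: expR_ge0.
pose G (x : borel_rV R d) := \int[P]_w psi (X x t w).
have spreadG x : `|G x - G x0| <= eps * S x by apply: transition_spread => //; exact: HC.
have apsi := observable_all_moments x0.
pose g (y : borel_rV R d) := (psi y)%:E.
have g0 y : (0 <= g y)%E by rewrite lee_fin.
have mg : measurable_fun [set: borel_rV R d] g.
  by apply/measurable_EFinP; exact: continuous_borel_measurable.
have [mG GE] := invariant_integral_at t0 g0 mg.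
have GEfin x : (\int[P]_w g (X x t w))%E = (G x)%:E.
  by rewrite EFin_mean//; exact: solution_psi.
have mG' : measurable_fun [set: borel_rV R d] G.
  by apply/measurable_EFinP; apply: eq_measurable_fun mG => x _; rewrite GEfin.
have aSe := all_momentsZ eps aS.
have aG : all_moments mu G.
  apply: le_all_moments (all_momentsD aSe (all_moments_cst mu `|G x0|)) => // x.
  have rhs0 : 0 <= eps * S x + `|G x0| by rewrite addr_ge0// mulr_ge0.
  rewrite [leRHS](ger0_norm rhs0).
  by rewrite -lerBlDr; apply: le_trans (lerB_dist _ _) (spreadG x).
have intE : \int[mu]_x psi x = \int[mu]_x G x.
  rewrite /Rintegral; congr fine; rewrite [LHS]GE.
  by apply: eq_integral => x _; rewrite GEfin.
rewrite intE mulrC -meanZ// -/(G x0) distrC ler_norml; apply/andP; split.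
  rewrite lerBrDl lerBlDr -meanD// -{1}[G x0](mean_cst mu).
  apply: mean_le => [||x]; [exact: all_moments_cst|exact: all_momentsD|].
  by have := spreadG x; rewrite ler_norml => /andP[+ _]; rewrite lerBrDl lerBlDr.
rewrite lerBlDr -[X in _ + X](mean_cst mu) -meanD//; last exact: all_moments_cst.
apply: mean_le => // [|x]; first by apply: all_momentsD => //; exact: all_moments_cst.
by have := spreadG x; rewrite ler_norml => /andP[_]; rewrite lerBlDr.
Qed.

End Observable.

Lemma ergodic (phi : 'rV[R]_d -> R) (M : R) (r : nat) x0 : 0 < M -> continuous phi ->
  (forall x, `|phi x| <= M * (1 + enorm x ^+ r)) ->
  (forall x y, `|phi y - phi x| <= M * (1 + enorm x ^+ r + enorm y ^+ r) * enorm (y - x)) ->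
  exists2 C : R, 0 <= C & forall t, 0 <= t ->
    `|\int[P]_w phi (X x0 t w) - \int[mu]_x phi x| <= C * expR (- gamma * t).
Proof.
move=> M0 phi_cont phi_growth phi_lip.
(* [phi] is the difference [psi2 - psi1] of nonnegative continuous functions which satisfy the same
   kind of growth and Lipschitz bounds, with constants [2 * M] and [M]. *)
pose psi1 x := `|phi x|; pose psi2 x := `|phi x| + phi x.
have c1 : continuous psi1 by move=> x; exact: (cvg_norm (phi_cont x)).
have c2 : continuous psi2 by move=> x; exact: (cvgD (c1 x) (phi_cont x)).
have g1 x : `|psi1 x| <= M * (1 + enorm x ^+ r) by rewrite normr_id.
have g2 x : `|psi2 x| <= 2 * M * (1 + enorm x ^+ r).
  apply: le_trans (ler_normD _ _) _; rewrite normr_id -mulrA mulr_natl mulr2n.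
  exact: lerD.
have l1 x y : `|psi1 y - psi1 x| <= M * (1 + enorm x ^+ r + enorm y ^+ r) * enorm (y - x).
  exact: le_trans (ler_dist_dist _ _) (phi_lip x y).
have l2 x y : `|psi2 y - psi2 x| <=
    2 * M * (1 + enorm x ^+ r + enorm y ^+ r) * enorm (y - x).
  rewrite /psi2 opprD addrACA; apply: le_trans (ler_normD _ _) _.
  by rewrite -!mulrA mulr_natl mulr2n mulrA lerD// l1.
have p1 x : 0 <= psi1 x by exact: normr_ge0.
have p2 x : 0 <= psi2 x by rewrite /psi2 -lerBlDr sub0r -normrN ler_norm.
have M20 : 0 < 2 * M by rewrite mulr_gt0.
have [C1 C10 H1] := ergodic_nonneg M0 c1 g1 l1 x0 p1.
have [C2 C20 H2] := ergodic_nonneg M20 c2 g2 l2 x0 p2.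
exists (C1 + C2) => [|t t0]; first exact: addr_ge0.
have am1 := observable_all_moments c1 g1 x0.
have am2 := observable_all_moments c2 g2 x0.
have ap1 : all_moments P (fun w => psi1 (X x0 t w)).
  by apply: (all_moments_growth c1 g1); [exact: X_meas|exact: X_all_moments].
have ap2 : all_moments P (fun w => psi2 (X x0 t w)).
  by apply: (all_moments_growth c2 g2); [exact: X_meas|exact: X_all_moments].
have phiE x : phi x = psi2 x + -1 * psi1 x by rewrite /psi2 mulN1r addrAC subrr add0r.
have -> : \int[P]_w phi (X x0 t w) =
    \int[P]_w psi2 (X x0 t w) - \int[P]_w psi1 (X x0 t w).
  under eq_Rintegral do rewrite phiE.
  by rewrite meanD//; [rewrite meanZ// mulN1r|exact: all_momentsZ].
have -> : \int[mu]_x phi x = \int[mu]_x psi2 x - \int[mu]_x psi1 x.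
  under eq_Rintegral do rewrite phiE.
  by rewrite meanD//; [rewrite meanZ// mulN1r|exact: all_momentsZ].
have -> (a b c e : R) : a - b - (c - e) = (a - c) - (b - e) by ring.
apply: le_trans (ler_normB _ _) _; rewrite mulrDl addrC.
by apply: lerD; [exact: H1|exact: H2].
Qed.

End InvariantDistribution.

(** * Choice of the parameters *)

(** The step is proportional to [eps], and [N h] slightly exceeds [(|ln eps| + b) / gamma]. The
    maximum with 1 is needed as [eps] tends to 1, where the logarithm vanishes although [N >= 1]. *)
Lemma parameter_choice {R : realType} (alpha gamma dt0 C1 C2 : R) :
  0 < gamma -> 0 < dt0 -> 0 <= C1 -> 0 <= C2 ->
  exists2 C : R, 0 < C & forall eps, 0 < eps -> eps < 1 -> exists h N,
  [/\ [/\ 0 < h, h <= dt0, small_step alpha gamma h & 3 / 2 * gamma * h <= 1],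
      N.+1%:R * h ^+ 2 <= 1, C1 * h <= eps / 2,
      C2 * expR (- gamma * (N%:R * h)) <= eps / 2 &
      N%:R <= C * eps^-1 * Num.max 1 `|ln eps|].
Proof.
move=> gamma0 dt00 C10 C20.
(* An extra time [b / gamma] absorbs the constant [C2], since [expR b >= 1 + 2 * C2]. *)
pose b := 2 * C2; have b0 : 0 <= b by rewrite mulr_ge0.
pose A1 := dt0^-1; pose A2 := (1 + b) / gamma.
have A10 : 0 < A1 by rewrite invr_gt0.
have A20 : 0 < A2 by rewrite divr_gt0// ltr_wpDr.
(* Each summand secures a requirement on [h = eps / Q]: [A1] the bound by [dt0], [alpha ^ 2] and
   [2 * gamma] the smallness conditions, [2 * C1] the weak error, and [A2] with part of the 3 the
   horizon condition. *)
pose Q := 3 + A1 + alpha ^+ 2 + 2 * gamma + A2 + 2 * C1.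
have a20 := sqr_ge0 alpha.
have Q0 : 0 < Q by rewrite /Q; lra.
pose c := Q^-1; have c0 : 0 < c by rewrite invr_gt0.
have cQ z : z <= Q -> c * z <= 1 by move=> zQ; rewrite ler_pdivrMl// mulr1.
exists (A2 / c + 1) => [|eps eps0 eps1].
  by rewrite ltr_wpDl// divr_ge0// ltW.
pose h := c * eps; have h0 : 0 < h by rewrite mulr_gt0.
have hc : h <= c by rewrite /h ler_piMr ?ltW.
have hQ z : 0 <= z -> z <= Q -> h * z <= 1.
  by move=> z0 /cQ; apply: le_trans; rewrite ler_wpM2r.
pose l := - ln eps.
have l0 : 0 <= l by rewrite oppr_ge0 ln_le0// ltW.
have expl : expR (- l) = eps by rewrite opprK lnK// posrE.
(* This keeps the horizon condition uniform in [eps]: in [N h^2] the logarithm is multiplied by a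
   factor [eps] coming from [h]. *)
have epsl : eps * l <= 1.
  have : eps * (1 + l) <= eps * expR l by rewrite ler_pM2l// expR_ge1Dx.
  by rewrite -{2}expl -expRD addNr expR0; apply: le_trans; rewrite ler_pM2l// lerDr.
have lE : `|ln eps| = l by rewrite ler0_norm// -oppr_ge0.
pose s := (l + b) / (gamma * h).
have s0 : 0 <= s by rewrite divr_ge0// ?addr_ge0// mulr_ge0// ltW.
exists h, (Num.truncn s).+1; set N := (Num.truncn s).+1.
have sN : s < N%:R by exact: truncnS_gt.
have Ns : N%:R <= s + 1 by rewrite /N -natr1 lerD2r truncn_le.
have sh : s * h = (l + b) / gamma by rewrite /s; field; rewrite !gt_eqF.
have hA1 : h * A1 <= 1 by apply: hQ; [exact: ltW|rewrite /Q; lra].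
have hA2 : h * alpha ^+ 2 <= 1 by apply: hQ => //; rewrite /Q; lra.
have hg : h * (2 * gamma) <= 1 by apply: hQ; [lra|rewrite /Q; lra].
have h3 : h * 3 <= 1 by apply: hQ => //; rewrite /Q; lra.
have h1 : h <= 1 by lra.
split.
- split => //; last by lra.
    by move: hA1; rewrite /A1 ler_pdivrMr// mul1r.
  by split => //; [by rewrite mulrC|by lra].
- have H1 : (l + b) / gamma * h <= c * A2.
    have -> : c * A2 = (c + c * b) / gamma by rewrite /A2; ring.
    rewrite mulrAC ler_wpM2r ?invr_ge0 ?(ltW gamma0)// mulrDl lerD//.
      by rewrite /h mulrCA -[leRHS]mulr1 ler_pM2l// mulrC.
    by rewrite mulrC ler_wpM2r.
  have H2 : c * (A2 + 2) <= 1 by apply: cQ; rewrite /Q; lra.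
  have H3 : N.+1%:R * h ^+ 2 <= (s * h) * h + 2 * h ^+ 2.
    rewrite -mulrA -expr2 -mulrDl ler_wpM2r ?sqr_ge0// -natr1.
    by lra.
  have H4 : h ^+ 2 <= h by rewrite expr2 ler_piMr// ltW.
  rewrite sh in H3; lra.
- have : c * (2 * C1) <= 1 by apply: cQ; rewrite /Q; lra.
  by move/(ler_wpM2r (ltW eps0)); rewrite /h; lra.
- have lb : - gamma * (N%:R * h) <= - l - b.
    have -> : - l - b = - gamma * (s * h) by rewrite sh; field; rewrite gt_eqF.
    by rewrite !mulNr lerN2 ler_wpM2l ?(ltW gamma0)// ler_wpM2r ?(ltW h0)// ltW.
  have := ler_wpM2l C20 (_ : expR (- gamma * (N%:R * h)) <= expR (- l - b)).
  rewrite ler_expR => /(_ lb) /le_trans; apply.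
  rewrite expRD expl mulrCA ler_wpM2l ?(ltW eps0)//.
  rewrite expRN ler_pdivrMr ?expR_gt0//.
  have := expR_ge1Dx b; rewrite /b; lra.
- rewrite lE; set m := Num.max 1 l.
  have m1 : 1 <= m by rewrite le_max lexx.
  have lm : l <= m by rewrite le_max lexx orbT.
  have e1 : 1 <= eps^-1 by rewrite invf_ge1// ltW.
  apply: le_trans Ns _.
  have -> : (A2 / c + 1) * eps^-1 * m = (1 + b) * m / (gamma * h) + eps^-1 * m.
    by rewrite /A2 /h; field; rewrite !gt_eqF.
  apply: lerD; last by rewrite -[leLHS]mulr1 ler_pM.
  have lbm : l + b <= (1 + b) * m by rewrite mulrDl mul1r lerD// ler_peMr.
  by apply: ler_wpM2r => //; rewrite invr_ge0 mulr_ge0// ltW.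
Qed.

Theorem corollary3p3
  (R : realType) (d K : nat)
  (disp : measure_display) (Omega : measurableType disp)
  (P : probability Omega R) (F : R -> set (set Omega))
  (hF : usual_conditions P F)
  (beta : 'I_K -> R -> Omega -> R)
  (hbeta : independent_wiener_processes P F beta)
  (sigma : 'I_K -> 'rV[R]_d)
  (f : 'rV[R]_d -> 'rV[R]_d)
  (hf : exists q : nat, C2_growth (@enorm R d) q f)
  (hf_diss : exists gamma : R, 0 < gamma /\
     forall x1 x2 : 'rV[R]_d,
       inner (f x2 - f x1) (x2 - x1) <= - gamma * enorm (x2 - x1) ^+ 2)
  (X : 'rV[R]_d -> R -> Omega -> 'rV[R]_d)
  (hX : forall x : 'rV[R]_d, sde_solution P F f sigma beta x (X x))
  (mu : probability (borel_rV R d) R)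
  (hmu : invariant_distribution P X mu)
  (alpha dt0 kappa : R) (halpha : 0 < alpha) (hdt0 : 0 < dt0)
  (hkappa : 0 < kappa)
  (x0 : 'rV[R]_d) (r : nat) (phi : 'rV[R]_d -> R)
  (hphi : C2_growth (fun y : R => `|y|) r phi) :
  exists (C : R) (L : nat), 0 < C /\
    forall eps : R, 0 < eps -> eps < 1 ->
      exists (dt : R) (N : nat),
        [/\ 0 < dt <= dt0,
            (`| 'E_P[fun w => phi (tamed_euler f sigma beta alpha dt x0 N w)]
                - \int[mu]_x (phi x)%:E | <= eps%:E)%E &
            kappa * N%:R
              <= C * eps^-1 * Num.max 1 `|ln eps| ^+ (1 + L)].
Proof.
have [q hfq] := hf; have [[f_diff f_diff2 _] _] := hfq.
have [M [M0 bf]] := C2_growth_bound (@enorm_ge0 R d) hfq.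
have [gamma [gamma0 diss]] := hf_diss.
have [[phi_diff _ _] _] := hphi.
have [M' [M'0 bphi]] := C2_growth_bound (@normr_ge0 _ _) hphi.
have f_growth x : enorm (f x) <= M * (1 + enorm x ^+ q) by case: bf.
have f_derive_cont v : continuous ('D_v f).
  by move=> x; exact: differentiable_continuous.
have f_derive x v : enorm ('D_v f x) <= M * (1 + enorm x ^+ q) * enorm v.
  by apply: growth_derive_le bf => //; exact: enormZ.
have f_lip x y := C2_field_lipschitz x y f_diff bf (ltW M0).
have f_taylor x y := C2_field_taylor x y f_diff f_diff2 bf (ltW M0).
have f_diss x y : inner (f x - f y) (x - y) <= - gamma * enorm (x - y) ^+ 2 by exact: diss.
have phi_cont : continuous phi by move=> x; exact: differentiable_continuous.
have phi_growth x : `|phi x| <= M' * (1 + enorm x ^+ r) by case: bphi.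
have phi_lip x y := C2_scalar_lipschitz x y phi_diff bphi (ltW M'0).
have [C1 C10 HC1] := weak_error hF hbeta halpha gamma0 M0 f_diff f_derive_cont
  f_growth f_derive f_lip f_taylor f_diss hX M'0 phi_cont phi_growth phi_lip x0.
have X_meas x t (t0 : 0 <= t) := solution_measurable hF hX x t0.
have X_contr x y t (t0 : 0 <= t) := solution_contraction hbeta gamma0 f_diff f_diss hX x y t0.
have X_mom := solution_moment hF hbeta halpha gamma0 M0 f_diff f_growth f_diss hX.
have X_all x t (t0 : 0 <= t) :=
  solution_all_moments hF hbeta halpha gamma0 M0 f_diff f_growth f_diss hX x t0.
have [C2 C20 HC2] := ergodic gamma0 X_meas X_contr X_mom X_all hmu x0 M'0 phi_cont
  phi_growth phi_lip.
have phi_mu := observable_all_moments gamma0 X_meas X_contr X_mom X_all hmu phi_cont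
  phi_growth x0.
have [C C0 HC] := parameter_choice alpha gamma0 hdt0 C10 C20.
exists (kappa * C), 0%N; split=> [|eps eps0 eps1]; first exact: mulr_gt0.
have [h [N [[h0 hdt sm gh] Nh C1h C2h NC]]] := HC eps eps0 eps1.
exists h, N; split; first by rewrite h0.
- have [_ h1 _ _] := sm; have Nh0 : 0 <= N%:R * h by rewrite mulr_ge0// ltW.
  have phi_euler : all_moments P (fun w => phi (tamed_euler f sigma beta alpha h x0 N w)).
    apply: (all_moments_growth phi_cont phi_growth); first exact: (euler_measurable hF hbeta).
    exact: (euler_enorm_all_moments hF hbeta).
  rewrite unlock (EFin_mean phi_euler) (EFin_mean phi_mu) -EFinB abse_EFin lee_fin.
  rewrite -(subrKA (\int[P]_w phi (X x0 (N%:R * h) w))).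
  apply: le_trans (ler_normD _ _) _; rewrite [eps]splitr lerD//.
    exact: le_trans (HC1 _ _ sm gh Nh) C1h.
  exact: le_trans (HC2 _ Nh0) C2h.
- by rewrite addn0 expr1 -!mulrA ler_pM2l// mulrA.
Qed.
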